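(* Let $\{X(t)\}_{t\ge 0}$ be the stochastic replicator process with payoff matrix $A=(a_{ij})\in\mathbb{R}^{n\times n}$ and noise parameters $\sigma_1,\dots,\sigma_n$, let $\tilde A=(\tilde a_{ij})=(a_{ij}-\tfrac12\sigma_i^2)_{i,j}$, and let $k\in\{1,\dots,n\}$. (a) Suppose strategy $k$ is a strict Nash equilibrium in the game $\tilde A$, that is, $$a_{kk}>a_{jk}+\frac{\sigma_k^2}2-\frac{\sigma_j^2}2\qquad\text{for all }j\ne k.$$ Then $\mathbf{e}_k$ is stochastically asymptotically stable. (b) Suppose that for some $\mathbf{x}\in\operatorname{int}\Delta$, $$P_{\mathbf{x}}\Big\{\lim_{t\to\infty}X(t)=\mathbf{e}_k\Big\}>0.$$ Then strategy $k$ must be a Nash equilibrium of $\tilde A$ (that is, $\tilde a_{kk}\ge\tilde a_{jk}$ for all $j$). Moreover, if there exists $i\ne k$ with $\tilde a_{ik}=\tilde a_{kk}$, then there exists $j\ne k$ such that $\tilde a_{ij}<\tilde a_{kj}$.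
   Context: Setting. $n\ge2$; $A=(a_{ij})\in\mathbb{R}^{n\times n}$ is an arbitrary payoff matrix; $\sigma_1,\dots,\sigma_n>0$; $W=(W_1,\dots,W_n)^T$ is a standard $n$-dimensional Brownian motion (independent components). $\Delta=\{\mathbf{y}\in[0,1]^n:y_1+\cdots+y_n=1\}$ and $\operatorname{int}\Delta=\{\mathbf{y}\in\Delta: y_i>0\ \forall i\}$. The stochastic replicator process $\{X(t)\}$ is a strong solution of the Itô equation $$dX(t)=\mathbf{b}(X(t))\,dt+C(X(t))\,dW(t),\qquad X(0)=\mathbf{x}\in\operatorname{int}\Delta,$$ with $\mathbf{b}(\mathbf{x})=[\operatorname{diag}(x_1,\dots,x_n)-\mathbf{x}\mathbf{x}^T][A-\operatorname{diag}(\sigma_1^2,\dots,\sigma_n^2)]\mathbf{x}$ and $C(\mathbf{x})=[\operatorname{diag}(x_1,\dots,x_n)-\mathbf{x}\mathbf{x}^T]\operatorname{diag}(\sigma_1,\dots,\sigma_n)$ for $\mathbf{x}\in\Delta$. Equivalently, $X_i=Z_i/(Z_1+\cdots+Z_n)$ where $dZ_i(t)=Z_i(t)[\{AX(t)\}_i\,dt+\sigma_i\,dW_i(t)]$, $Z_i(0)>0$. Almost surely $X(t)\in\operatorname{int}\Delta$ for all $t\ge0$. $P_{\mathbf{x}}$ denotes probability under $X(0)=\mathbf{x}$, and $\mathbf{e}_k$ is the $k$th standard basis vector of $\mathbb{R}^n$ (the vertex of $\Delta$ corresponding to pure strategy $k$). A point $\mathbf{p}\in\Delta$ is a Nash equilibrium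 of $\tilde A$ if $\mathbf{p}^T\tilde A\mathbf{p}\ge\mathbf{q}^T\tilde A\mathbf{p}$ for all $\mathbf{q}\in\Delta$, strict if the inequality is strict for all $\mathbf{q}\ne\mathbf{p}$; ''strategy $k$'' is identified with $\mathbf{e}_k$. A point $\mathbf{p}\in\Delta$ is stochastically asymptotically stable if for every open neighborhood $U$ of $\mathbf{p}$ and every $\varepsilon>0$ there is a neighborhood $V$ of $\mathbf{p}$ such that for every initial state $\mathbf{x}\in V\cap\operatorname{int}\Delta$, $$P_{\mathbf{x}}\Big\{X(t)\in U\text{ for all }t\ge0,\ \lim_{t\to\infty}X(t)=\mathbf{p}\Big\}\ge1-\varepsilon.$$ *)

(* Defs.v *)
From HB Require Import structures.
From mathcomp Require Import all_boot all_order all_algebra.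
From mathcomp Require Import all_classical all_reals all_analysis.

Set Implicit Arguments.
Unset Strict Implicit.
Unset Printing Implicit Defensive.

Import Order.TTheory GRing.Theory Num.Theory.
Import numFieldNormedType.Exports.

Local Open Scope classical_set_scope.
Local Open Scope ring_scope.

Definition simplex {R : realType} {n : nat} : set 'cV[R]_n :=
  [set y | (forall i, 0 <= y i 0 <= 1) /\ \sum_(i < n) y i 0 = 1].

Definition int_simplex {R : realType} {n : nat} : set 'cV[R]_n :=
  [set y | simplex y /\ forall i, 0 < y i 0].

Definition vertex {R : realType} {n : nat} (k : 'I_n) : 'cV[R]_n :=
  delta_mx k 0.

(* [payoff B q p] is the number q^T B p. *)
Definition payoff {R : realType} {n : nat} (B : 'M[R]_n) (q p : 'cV[R]_n) : R :=
  (q^T *m B *m p) 0 0.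

Definition nash {R : realType} {n : nat} (B : 'M[R]_n) (p : 'cV[R]_n) : Prop :=
  simplex p /\ forall q, simplex q -> payoff B q p <= payoff B p p.

Definition strict_nash {R : realType} {n : nat} (B : 'M[R]_n) (p : 'cV[R]_n) :
    Prop :=
  simplex p /\ forall q, simplex q -> q <> p -> payoff B q p < payoff B p p.

Definition modified_payoff {R : realType} {n : nat} (A : 'M[R]_n)
    (sigma : 'rV[R]_n) : 'M[R]_n :=
  \matrix_(i, j) (A i j - sigma 0 i ^+ 2 / 2).

Section VertexEquilibria.
Context {R : realType} {n : nat}.
Implicit Types (B : 'M[R]_n) (q : 'cV[R]_n).

Lemma simplex_vertex (k : 'I_n) : simplex (vertex k : 'cV[R]_n).
Proof.
split=> [i|]; first by rewrite mxE eqxx andbT ler0n lern1 leq_b1.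
rewrite (bigD1 k) //= big1 ?mxE ?eqxx ?addr0 // => i /negbTE ik.
by rewrite mxE ik.
Qed.

Lemma payoff_vertex B q k : payoff B q (vertex k) = \sum_i q i 0 * B i k.
Proof.
by rewrite /payoff /vertex -colE !mxE; apply: eq_bigr => i _; rewrite !mxE.
Qed.

Lemma payoff_vertex2 B j k : payoff B (vertex j) (vertex k) = B j k.
Proof.
rewrite payoff_vertex (bigD1 j) //= big1 ?mxE ?eqxx ?mul1r ?addr0 // => i.
by move=> /negbTE ij; rewrite mxE ij mul0r.
Qed.

Lemma payoff_vertex_gap B q k : simplex q ->
  B k k - payoff B q (vertex k) = \sum_i q i 0 * (B k k - B i k).
Proof.
move=> [_ q1]; rewrite payoff_vertex -[in LHS](mul1r (B k k)) -q1 mulr_suml.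
by rewrite -sumrB; apply: eq_bigr => i _; rewrite mulrBr.
Qed.

Lemma nash_vertexP B k : nash B (vertex k) <-> forall j, B j k <= B k k.
Proof.
split=> [[_ Bk] j|Bk].
  by have := Bk _ (simplex_vertex j); rewrite !payoff_vertex2.
split=> [|q Dq]; first exact: simplex_vertex.
rewrite payoff_vertex2 -subr_ge0 payoff_vertex_gap // sumr_ge0 // => i _.
by rewrite mulr_ge0 ?subr_ge0 //; case: Dq => /(_ i)/andP[].
Qed.

Lemma strict_nash_vertexP B k :
  strict_nash B (vertex k) <-> forall j, j != k -> B j k < B k k.
Proof.
split=> [[_ Bk] j jk|Bk].
  have := Bk _ (simplex_vertex j); rewrite !payoff_vertex2; apply.
  move=> /matrixP/(_ j 0)/eqP; rewrite !mxE !eqxx (negbTE jk) /=.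
  by rewrite oner_eq0.
have gap_ge0 q i : simplex q -> 0 <= q i 0 * (B k k - B i k).
  move=> [/(_ i)/andP[qi0 _] _]; rewrite mulr_ge0 // subr_ge0.
  by have [->//|/Bk/ltW] := eqVneq i k.
split=> [|q Dq qk]; first exact: simplex_vertex.
rewrite payoff_vertex2 -subr_gt0 payoff_vertex_gap // lt_neqAle eq_sym.
rewrite sumr_ge0 ?andbT; last by move=> i _; exact: gap_ge0.
apply/negP; rewrite psumr_eq0 => [/allP q0|i _]; last exact: gap_ge0.
have {}q0 i : i != k -> q i 0 = 0.
  move=> ik; have := q0 i (mem_index_enum i); rewrite /= mulf_eq0 subr_eq0.
  by case/orP=> /eqP // Bki; move: (Bk _ ik); rewrite Bki ltxx.
apply: qk; apply/matrixP => i z; rewrite (ord1 z) !mxE eqxx andbT.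
have [->|ik] := eqVneq i k; last exact: q0.
case: Dq => _; rewrite (bigD1 k) //= big1 ?addr0 // => j; exact: q0.
Qed.

End VertexEquilibria.

Section Probability.
Context {d : measure_display} {T : measurableType d} {R : realType}.
Variable P : probability T R.

(* Product rule over every subfamily. *)
Definition mutually_independent {I : finType} (Y : I -> T -> R) : Prop :=
  forall (J : {set I}) (B : I -> set R), (forall i, measurable (B i)) ->
    P (\bigcap_(i in [set` J]) (Y i @^-1` B i)) =
    (\prod_(i in J) P (Y i @^-1` B i))%E.

(* Mutual independence of all the scalar increments, over both the time
   intervals and the coordinates, expresses at once that increments over
   disjoint intervals are independent and that the coordinates are independent
   processes.  Processes are indexed by [R]; only times [t >= 0] matter. *)
Definition brownian_motion {n : nat} (W : R -> T -> 'cV[R]_n) : Prop :=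
  [/\ forall t i, 0 <= t -> measurable_fun setT (fun w => W t w i 0),
      {ae P, forall w, W 0 w = 0},
      forall w, {within `[0, +oo[, continuous (fun t => W t w)},
      forall s t i (B : set R), 0 <= s -> s < t -> measurable B ->
        P ((fun w => W t w i 0 - W s w i 0) @^-1` B) =
        normal_prob 0 (Num.sqrt (t - s)) B
    & forall (m : nat) (t : nat -> R), 0 <= t 0%N ->
        {homo t : a b / (a <= b)%N >-> a <= b} ->
        mutually_independent (fun (ai : 'I_m * 'I_n) w =>
          W (t ai.1.+1) w ai.2 0 - W (t ai.1) w ai.2 0)].

Definition brownian_filtration {n : nat} (W : R -> T -> 'cV[R]_n) (t : R) :
    set (set T) :=
  <<s [set E | exists s i (B : set R),
         [/\ 0 <= s <= t, measurable B & E = (fun w => W s w i 0) @^-1` B]]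
      `|` [set E | measurable E /\ P E = 0%E] >>.

Definition measurable_wrt (G : set (set T)) (f : T -> R) : Prop :=
  forall B : set R, measurable B -> G (f @^-1` B).

(* The simple process \sum_(a < m) xi_a 1_(]t_a, t_(a+1)]]. *)
Definition simple_process (m : nat) (t : nat -> R) (xi : nat -> T -> R)
    (s : R) (w : T) : R :=
  \sum_(a < m) xi a w * \1_(`]t a, t a.+1]) s.

Definition simple_integral (m : nat) (t : nat -> R) (xi : nat -> T -> R)
    (B : R -> T -> R) (w : T) : R :=
  \sum_(a < m) xi a w * (B (t a.+1) w - B (t a) w).

Definition simple_data (F : R -> set (set T)) (u : R)
    (m : nat) (t : nat -> R) (xi : nat -> T -> R) : Prop :=
  [/\ t 0%N = 0, t m = u, {homo t : a b / (a <= b)%N >-> a <= b}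
    & forall a, (a < m)%N -> measurable_wrt (F (t a)) (xi a) /\
        exists K, forall w, `|xi a w| <= K].

(* [I] is the Ito integral \int_0^u H dB: it is the L^2(P)-limit of integrals
   of simple processes that converge to [H] in L^2([0, u] x T). *)
Definition is_ito_integral (F : R -> set (set T)) (B H : R -> T -> R) (u : R)
    (I : T -> R) : Prop :=
  measurable_fun setT I /\
  exists (m : nat -> nat) (t : nat -> nat -> R) (xi : nat -> nat -> T -> R),
    [/\ forall r, simple_data F u (m r) (t r) (xi r),
        (\int[P]_w \int[lebesgue_measure]_(s in `[0%R, u])
           ((simple_process (m r) (t r) (xi r) s w - H s w) ^+ 2)%:E)%E
          @[r --> \oo] --> 0%E
      & (\int[P]_w
           ((simple_integral (m r) (t r) (xi r) B w - I w) ^+ 2)%:E)%E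
          @[r --> \oo] --> 0%E].

Definition replicator_proj {n : nat} (x : 'cV[R]_n) : 'M[R]_n :=
  diag_mx x^T - x *m x^T.

Definition replicator_drift {n : nat} (A : 'M[R]_n) (sigma : 'rV[R]_n)
    (x : 'cV[R]_n) : 'cV[R]_n :=
  replicator_proj x *m (A - diag_mx (\row_i sigma 0 i ^+ 2)) *m x.

Definition replicator_diffusion {n : nat} (sigma : 'rV[R]_n) (x : 'cV[R]_n) :
    'M[R]_n :=
  replicator_proj x *m diag_mx sigma.

(* Strong solution, on the given space and driven by the given [W], of
   dX = b(X) dt + C(X) dW, X(0) = x.  Since b and C are bounded on the simplex,
   both integrals below are within the scope of the definitions used. *)
Definition stochastic_replicator {n : nat} (A : 'M[R]_n) (sigma : 'rV[R]_n)
    (W : R -> T -> 'cV[R]_n) (x : 'cV[R]_n) (X : R -> T -> 'cV[R]_n) : Prop :=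
  [/\ forall t w, 0 <= t -> simplex (X t w),
      forall w, {within `[0, +oo[, continuous (fun t => X t w)},
      forall t i, 0 <= t ->
        measurable_wrt (brownian_filtration W t) (fun w => X t w i 0),
      {ae P, forall w, X 0 w = x}
    & forall t, 0 <= t -> exists I : 'I_n -> 'I_n -> T -> R,
        (forall i j, is_ito_integral (brownian_filtration W)
           (fun s w => W s w j 0)
           (fun s w => replicator_diffusion sigma (X s w) i j) t (I i j)) /\
        {ae P, forall w, forall i,
           X t w i 0 = x i 0
             + (\int[lebesgue_measure]_(s in `[0, t])
                  replicator_drift A sigma (X s w) i 0)
             + \sum_(j < n) I i j w}].

(* [X x] is the process started at [x], so that P_x{X in S} is P {X x in S}. *)
Definition stoch_asymp_stable {n : nat} (X : 'cV[R]_n -> R -> T -> 'cV[R]_n)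
    (p : 'cV[R]_n) : Prop :=
  forall (U : set 'cV[R]_n) (eps : R), open U -> U p -> 0 < eps ->
    exists2 V : set 'cV[R]_n, nbhs p V &
      forall x, V x -> int_simplex x ->
        let E := [set w | (forall t, 0 <= t -> U (X x t w)) /\
                          (X x t w @[t --> +oo] --> p)] in
        ((1 - eps)%:E <= P E)%E.

End Probability.

(* Main.v *)
(** Dividing the equation for X_i by X_i and using Ito's formula, the Ito
    corrections turn A into the modified matrix: with B_ik = s_i W_i - s_k W_k,
      X_i(t) / X_k(t) = (x_i / x_k) exp (\int_0^t ((At X)_i - (At X)_k) ds + B_ik(t)),
    almost surely for all t, because the martingale parts of log X_i and log X_k
    differ exactly by B_ik.  Ito's formula is only needed for the logarithm, and
    is obtained by Taylor expansion along uniform grids of [0, u], the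
    remainders vanishing in mean; the positivity of X comes out of the identity
    itself, since a component could only vanish together with all others.

    Everything else is pathwise.  Near e_k the integrand is close to
    at_ik - at_kk.  If k is strict, this is negative and, since B_ik(t) = o(t),
    the paths of the event B_ik(t) <= c t / 2 + K, of probability close to 1,
    cannot leave a neighbourhood of e_k when started close enough to it, and
    converge to e_k.  Conversely, on {X -> e_k} a positive limit at_ik - at_kk
    would make X_i / X_k explode; and if at_ik = at_kk with at_ij >= at_kj for all
    j, the integral is nonnegative while B_ik > 0 at arbitrarily large times, so
    that X_i / X_k does not tend to 0. *)
Require Import Defs.
From HB Require Import structures.
From mathcomp Require Import all_boot all_order all_algebra.
From mathcomp Require Import all_classical all_reals all_analysis.
From mathcomp Require Import measurable_realfun.
From mathcomp Require Import ring lra.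
Import Order.TTheory GRing.Theory Num.Theory.
Import numFieldNormedType.Exports.
Local Open Scope classical_set_scope.
Local Open Scope ring_scope.
Set Implicit Arguments.
Unset Strict Implicit.
Unset Printing Implicit Defensive.

(** * Independence and the Brownian filtration *)

(** The definition of a solution supplies, for each time separately, Ito integrals known up to a
    null set, with no continuous version and no stated relation between different times. For fixed
    [u] the equation is read at the countably many points of the uniform grids of [0, u], and a
    subsequence of grids is extracted along which all mean remainders vanish almost surely. The
    martingale part of log X_i has an integrand depending on i only through s_i dW_i; the rest is
    common to all components and cancels on each grid already, leaving a telescoping sum, so that no
    limit of stochastic integrals has to be identified. The resulting identity involves only X, W
    and ordinary antiderivatives, all continuous in time, and so passes from rational to all times.
    No stopping time occurs: 1 / X_i is capped instead. Two further obstacles are the independence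
    of increments from the completed past, which must be derived from finite families of increments,
    and the measurability of staying in an arbitrary open set. *)

Lemma sub_sigma (T : Type) (G H : set (set T)) : G `<=` <<s H >> ->
  <<s G >> `<=` <<s H >>.
Proof. by move=> GH; apply: smallest_sub => //; exact: smallest_sigma_algebra. Qed.

Lemma mem_sigma (T : Type) (G : set (set T)) A : G A -> <<s G >> A.
Proof. by move=> GA; exact: sub_sigma_algebra. Qed.

Section Independence.
Context {d : measure_display} {T : measurableType d} {R : realType}.
Variable P : probability T R.

(** As functions of [A] both sides are finite measures, [P] restricted to [B] and [P] scaled by
    [P B]; they agree on the pi-system [G], hence on what it generates. *)
Lemma indep_generated (G : set (set T)) (B : set T) :
  G `<=` measurable -> setI_closed G -> G setT -> measurable B ->
  (forall A, G A -> P (A `&` B) = (P A * P B)%E) ->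
  forall A, <<s G >> A -> P (A `&` B) = (P A * P B)%E.
Proof.
move=> Gm GI GT mB GB A sA.
pose c : {nonneg R} := NngNum (fine_ge0 (measure_ge0 P B)).
have cE : (c%:num%:E = P B)%E by rewrite /= fineK// fin_num_measure.
have := @g_sigma_algebra_measure_unique _ R T G Gm (fun=> setT) (fun=> GT)
  _ (mrestr P mB) (mscale c P) GI.
have cov : \bigcup_(k : nat) [set: T] = setT.
  by rewrite -subTset => x _; exists 0%N.
move=> /(_ cov) H.
have -> : P (A `&` B) = mrestr P mB A by [].
rewrite H//=; first by rewrite /mscale/= cE muleC.
- by move=> C GC; rewrite /mrestr GB//= /mscale/= cE muleC.
- move=> _; rewrite (le_lt_trans (probability_le1 P _)) ?ltry//.
  by apply: measurableI => //; exact: measurableT.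
Qed.

Definition indep (G H : set (set T)) : Prop :=
  forall A B, G A -> H B -> P (A `&` B) = (P A * P B)%E.

Lemma indep_sigma (G H : set (set T)) :
  G `<=` measurable -> setI_closed G -> G setT ->
  H `<=` measurable -> setI_closed H -> H setT ->
  indep G H -> indep <<s G >> <<s H >>.
Proof.
move=> Gm GI GT Hm HI HT GH.
have sGm : <<s G >> `<=` measurable.
  by apply: smallest_sub => //; exact: sigma_algebra_measurable.
suff sGH : indep <<s G >> H.
  move=> A B sA sB; rewrite setIC muleC.
  apply: (@indep_generated H) => //; first exact: sGm.
  by move=> C HC; rewrite setIC muleC sGH.
move=> A B sA HB; apply: (@indep_generated G) => //; first exact: Hm.
by move=> C GC; exact: GH.
Qed.

Section families.
Variables (I : finType) (Y : I -> T -> R).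
Hypothesis mY : forall i, measurable_fun setT (Y i).
Hypothesis iY : mutually_independent P Y.

Definition preimages_of (J : {set I}) : set (set T) :=
  [set E | exists i (B : set R), [/\ i \in J, measurable B & E = Y i @^-1` B]].

Let rectangles (J : {set I}) : set (set T) :=
  [set E | exists B : I -> set R, (forall i, measurable (B i)) /\
     E = \bigcap_(i in [set` J]) (Y i @^-1` B i)].

Let rectanglesI J : setI_closed (rectangles J).
Proof.
move=> _ _ [B [mB ->]] [C [mC ->]].
exists (fun i => B i `&` C i); split; first by move=> i; exact: measurableI.
by rewrite -bigcapI; apply: eq_bigcapr => i _; rewrite preimage_setI.
Qed.

Let rectanglesm J : rectangles J `<=` measurable.
Proof.
move=> _ [B [mB ->]]; apply: fin_bigcap_measurable => // i _.
by rewrite -[_ @^-1` _]setTI; exact: mY.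
Qed.

Let rectanglesT J : rectangles J setT.
Proof.
exists (fun=> setT); split=> // ; apply/esym; rewrite -subTset => w _ i _.
by [].
Qed.

(** Events on a single coordinate do not form a pi-system, so each side is first enlarged to finite
    rectangles, which do. Since [J] and [K] are disjoint, a rectangle over [J] and one over [K]
    merge into a rectangle over [J :|: K], to which the product rule applies. *)
Lemma mutually_independent_sigma (J K : {set I}) :
  {in J, forall i, i \notin K} ->
  indep <<s preimages_of J >> <<s preimages_of K >>.
Proof.
move=> JK.
have sub L : <<s preimages_of L >> `<=` <<s rectangles L >>.
  apply: sub_sigma => _ [i [B [iL mB ->]]]; apply: mem_sigma.
  exists (fun j => if j == i then B else setT); split.
    by move=> j; case: ifP.
  apply/seteqP; split=> w /=.
    by move=> YB j jL; rewrite /=; case: eqP => [->|].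
  by move=> /(_ i iL); rewrite /= eqxx.
suff : indep <<s rectangles J >> <<s rectangles K >>.
  by move=> H A B /sub sA /sub sB; exact: H.
apply: indep_sigma => // _ _ [B [mB ->]] [C [mC ->]].
pose D i := if i \in J then B i else C i.
have mD i : measurable (D i) by rewrite /D; case: ifP.
have DB : \bigcap_(i in [set` J]) (Y i @^-1` B i) =
          \bigcap_(i in [set` J]) (Y i @^-1` D i).
  by apply: eq_bigcapr => i /= iJ; rewrite /D iJ.
have DC : \bigcap_(i in [set` K]) (Y i @^-1` C i) =
          \bigcap_(i in [set` K]) (Y i @^-1` D i).
  apply: eq_bigcapr => i /= iK; rewrite /D.
  by case: ifP => // /JK; rewrite iK.
rewrite DB DC -bigcap_setU.
have -> : [set` J] `|` [set` K] = [set` (J :|: K)].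
  apply/seteqP; split=> i /=; first by move=> [iJ|iK]; rewrite inE ?iJ ?iK ?orbT.
  by rewrite inE => /orP[]; [left|right].
rewrite !iY// (eq_bigl [predU J & K]); last by move=> i; rewrite !inE.
rewrite bigU//; apply/pred0P => i /=.
by apply/negbTE/negP => /andP[/JK /negP].
Qed.

End families.
End Independence.

Section GeneratedMeasurability.
Context {d : measure_display} {T : measurableType d} {R : realType}.
Implicit Types (G : set (set T)) (f g : T -> R).

Lemma sigma_setI G A B : <<s G >> A -> <<s G >> B -> <<s G >> (A `&` B).
Proof. exact: (@measurableI _ (g_sigma_algebraType G)). Qed.

Lemma sigma_setC G A : <<s G >> A -> <<s G >> (~` A).
Proof. exact: (@measurableC _ (g_sigma_algebraType G)). Qed.

Lemma sigma_setT G : <<s G >> setT.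
Proof. exact: (@measurableT _ (g_sigma_algebraType G)). Qed.

Lemma sigma_set0 G : <<s G >> set0.
Proof. exact: (@measurable0 _ (g_sigma_algebraType G)). Qed.

Lemma measurable_wrtP G f :
  measurable_wrt <<s G >> f <->
  measurable_fun setT (f : g_sigma_algebraType G -> R).
Proof.
split=> [mf _ B mB|mf B mB]; first by rewrite setTI; exact: mf.
by rewrite -[f @^-1` B]setTI; exact: mf.
Qed.

Lemma measurable_wrt_cst G (c : R) : measurable_wrt <<s G >> (fun=> c).
Proof. by apply/measurable_wrtP; exact: measurable_cst. Qed.

Lemma measurable_wrtD G f g : measurable_wrt <<s G >> f ->
  measurable_wrt <<s G >> g -> measurable_wrt <<s G >> (f \+ g).
Proof.
move=> /measurable_wrtP mf /measurable_wrtP mg; apply/measurable_wrtP.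
exact: (@measurable_funD _ (g_sigma_algebraType G)).
Qed.

Lemma measurable_wrtB G f g : measurable_wrt <<s G >> f ->
  measurable_wrt <<s G >> g -> measurable_wrt <<s G >> (f \- g).
Proof.
move=> /measurable_wrtP mf /measurable_wrtP mg; apply/measurable_wrtP.
exact: (@measurable_funB _ (g_sigma_algebraType G)).
Qed.

Lemma measurable_wrtM G f g : measurable_wrt <<s G >> f ->
  measurable_wrt <<s G >> g -> measurable_wrt <<s G >> (f \* g).
Proof.
move=> /measurable_wrtP mf /measurable_wrtP mg; apply/measurable_wrtP.
exact: (@measurable_funM _ (g_sigma_algebraType G)).
Qed.

Lemma measurable_wrt_sum (I : Type) (r : seq I) G (f : I -> T -> R) :
  (forall i, measurable_wrt <<s G >> (f i)) ->
  measurable_wrt <<s G >> (fun w => \sum_(i <- r) f i w).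
Proof.
move=> mf; elim: r => [|i r IH].
  rewrite (_ : (fun _ => _) = (fun=> 0)); first exact: measurable_wrt_cst.
  by apply/funext => w; rewrite big_nil.
rewrite (_ : (fun _ => _) = f i \+ (fun w => \sum_(i <- r) f i w)).
  exact: measurable_wrtD.
by apply/funext => w; rewrite big_cons.
Qed.

Lemma measurable_wrt_cvg G (h : nat -> T -> R) f :
  (forall r, measurable_wrt <<s G >> (h r)) ->
  (forall w, h r w @[r --> \oo] --> f w) -> measurable_wrt <<s G >> f.
Proof.
move=> mh hf; apply/measurable_wrtP.
apply: (@measurable_fun_cvg _ (g_sigma_algebraType G) R setT h) => // r.
exact/measurable_wrtP.
Qed.

Lemma measurable_wrt_comp G f (h : R -> R) : measurable_fun setT h ->
  measurable_wrt G f -> measurable_wrt G (h \o f).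
Proof.
move=> mh mf B mB; rewrite comp_preimage; apply: mf.
by rewrite -[h @^-1` B]setTI; exact: mh.
Qed.

Lemma measurable_wrt_sub G1 G2 f : G1 `<=` G2 ->
  measurable_wrt G1 f -> measurable_wrt G2 f.
Proof. by move=> G12 mf B /mf /G12. Qed.

End GeneratedMeasurability.

(** Freezing a path at its value at time 0 makes it continuous on the whole line, so that
    derivatives and limits can be taken at time 0 without one-sided versions. *)
Lemma continuous_comp_max0 {R : realType} {V : topologicalType} (f : R -> V) :
  {within `[0, +oo[, continuous f} -> continuous (fun t : R => f (Num.max 0 t)).
Proof.
move=> /subspace_continuousP cf t U.
have m0 : `[0, +oo[%classic (Num.max 0 t) by rewrite /= in_itv/= andbT le_max lexx.
move=> /(cf _ m0); rewrite /within /= => H.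
have cm : {for t, continuous (fun t : R => Num.max 0 t)}.
  by apply: (@continuous_max R R (fun=> 0) id t); [exact: cvg_cst|exact: cvg_id].
have := cm _ H; apply: (@filterS _ (nbhs t) _) => u /=; apply.
by rewrite in_itv/= andbT le_max lexx.
Qed.

Section BrownianFiltration.
Context {d : measure_display} {T : measurableType d} {R : realType}.
Variables (P : probability T R) (n : nat) (W : R -> T -> 'cV[R]_n).
Hypothesis bW : brownian_motion P W.
Local Notation F := (brownian_filtration P W).

Lemma brownian_measurable t i : 0 <= t ->
  measurable_fun setT (fun w => W t w i 0).
Proof. by case: bW => mW _ _ _ _; exact: mW. Qed.

Lemma filtration_measurable t : F t `<=` measurable.
Proof.
apply: smallest_sub; first exact: sigma_algebra_measurable.
move=> E [[s [i [B [/andP[s0 _] mB ->]]]]|[]//].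
by rewrite -[X in measurable X]setTI; exact: brownian_measurable.
Qed.

Lemma filtration_mono s t : s <= t -> F s `<=` F t.
Proof.
move=> st; apply: sub_sigma => E EF; apply: mem_sigma.
case: EF => [[u [i [B [/andP[u0 us] mB ->]]]]|].
  by left; exists u, i, B; split; rewrite ?u0 ?(le_trans us).
by right.
Qed.

Lemma filtration_brownian s t i : 0 <= s <= t ->
  measurable_wrt (F t) (fun w => W s w i 0).
Proof.
move=> st B mB; apply: mem_sigma; left.
by exists s, i, B.
Qed.

Lemma brownian_continuous w i : continuous (fun t : R => W (Num.max 0 t) w i 0).
Proof.
case: bW => _ _ /(_ w) /continuous_comp_max0 cW _ _ t.
apply: (@continuous_comp _ _ _ (fun t : R => W (Num.max 0 t) w)
  (fun M : 'cV[R]_n => M i 0)); first exact: cW.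
exact: coord_continuous.
Qed.

Definition increment_events (s t : R) : set (set T) :=
  [set E | exists i (B : set R),
    measurable B /\ E = (fun w => W t w i 0 - W s w i 0) @^-1` B].

Section indep.
Variables (s t : R).
Hypotheses (s0 : 0 <= s) (st : s <= t).

(** Dyadic points of [[0, s]]: these grids refine one another, so that the sigma-algebras generated
    at level [r] increase with [r]. *)
Let dyad (r a : nat) : R := s * (a%:R / 2 ^+ r).

Let dyad0 r : dyad r 0 = 0. Proof. by rewrite /dyad mul0r mulr0. Qed.

Let dyad_ge0 r a : 0 <= dyad r a.
Proof. by rewrite mulr_ge0 ?divr_ge0 ?exprn_ge0. Qed.

Let dyad_end r : dyad r (2 ^ r) = s.
Proof. by rewrite /dyad natrX divff ?mulr1// expf_neq0. Qed.

Let dyad_mono r a b : (a <= b)%N -> dyad r a <= dyad r b.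
Proof.
by move=> ab; rewrite ler_wpM2l// ler_pM2r ?ler_nat// invr_gt0 exprn_gt0.
Qed.

Let dyad_gen (r : nat) : set (set T) :=
  [set E | exists a i (B : set R), [/\ (a <= 2 ^ r)%N, measurable B &
    E = (fun w => W (dyad r a) w i 0 - W 0 w i 0) @^-1` B]].

Let dyad_indep r : indep P <<s dyad_gen r >> <<s increment_events s t >>.
Proof.
(* [g] follows the dyadic grid up to [s], reached at index [2 ^ r], and then jumps to [t]. Row
   [2 ^ r] of [Y] is thus the increment over [[s, t]], and the rows below it tile [[0, s]]. *)
pose g a := if (a <= 2 ^ r)%N then dyad r a else t.
have g0 : 0 <= g 0%N by rewrite /g leq0n.
have gmono : {homo g : a b / (a <= b)%N >-> a <= b}.
  move=> a b ab; rewrite /g; case: ifP => ha; case: ifP => hb //.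
  - exact: dyad_mono.
  - by rewrite (le_trans _ st)// -(dyad_end r) dyad_mono.
  - by move: ha; rewrite (leq_trans ab hb).
pose m := (2 ^ r).+1.
case: (bW) => _ _ _ _ /(_ m g g0 gmono) iY.
set Y := (fun (ai : 'I_m * 'I_n) w => _) in iY.
have mW a i : measurable_fun setT (fun w => W (g a) w i 0).
  by apply: brownian_measurable; rewrite (le_trans g0)// gmono.
have mY ai : measurable_fun setT (Y ai) by exact: measurable_funB.
pose J : {set 'I_m * 'I_n} := [set ai : 'I_m * 'I_n | (ai.1 < 2 ^ r)%N]%SET.
pose K : {set 'I_m * 'I_n} := [set ai : 'I_m * 'I_n | ai.1 == (2 ^ r)%N :> nat]%SET.
have JK : {in J, forall ai, ai \notin K}.
  by move=> ai; rewrite !inE => /ltn_eqF ->.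
have GJ : <<s dyad_gen r >> `<=` <<s preimages_of Y J >>.
  apply: sub_sigma => _ [a [i [B [ar mB ->]]]].
  suff: measurable_wrt <<s preimages_of Y J>>
      (fun w => W (dyad r a) w i 0 - W 0 w i 0) by exact.
  (* The increment from 0 to a dyadic point is the sum of the increments over the cells before
     it. *)
  elim: a ar {B mB} => [_|a IH ar].
    rewrite dyad0 (_ : (fun _ => _) = fun=> 0); first exact: measurable_wrt_cst.
    by apply/funext => w; rewrite subrr.
  have am : (a < m)%N by rewrite ltnS ltnW.
  rewrite (_ : (fun _ => _) = (fun w => W (dyad r a) w i 0 - W 0 w i 0) \+
      Y (Ordinal am, i)); last first.
    by apply/funext => w; rewrite /Y /= /g ar (ltnW ar); ring.
  apply: measurable_wrtD; first by apply: IH; exact: ltnW.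
  move=> B mB; apply: mem_sigma.
  by exists (Ordinal am, i), B; rewrite inE.
have GK : <<s increment_events s t >> `<=` <<s preimages_of Y K >>.
  apply: sub_sigma => _ [i [B [mB ->]]]; apply: mem_sigma.
  exists (@Ordinal m (2 ^ r) (ltnSn _), i), B; split=> //; first by rewrite inE.
  by rewrite /Y /= /g leqnn ltnn dyad_end.
by move=> A B /GJ sA /GK sB; exact: (mutually_independent_sigma mY iY JK).
Qed.

Let dyad_sub r r' : (r <= r')%N -> <<s dyad_gen r >> `<=` <<s dyad_gen r' >>.
Proof.
move=> rr'; apply: sub_sigma => _ [a [i [B [ar mB ->]]]]; apply: mem_sigma.
exists (a * 2 ^ (r' - r))%N, i, B; split=> //.
  by rewrite -{2}(subnKC rr') expnD leq_mul2r ar orbT.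
suff -> : dyad r' (a * 2 ^ (r' - r)) = dyad r a by [].
by rewrite /dyad -{2}(subnKC rr') exprD natrM natrX -mulf_div divff ?mulr1.
Qed.

Let dyad_genm r : <<s dyad_gen r >> `<=` measurable.
Proof.
apply: smallest_sub; first exact: sigma_algebra_measurable.
move=> _ [a [i [B [ar mB ->]]]]; rewrite -[X in measurable X]setTI.
by apply: (measurable_funB _ _ measurableT mB); exact: brownian_measurable.
Qed.

(* The filtration contains the null sets, which no grid sees. *)
Let almost_dyad : set (set T) := [set A | measurable A /\
  exists r N A', [/\ <<s dyad_gen r >> A', measurable N, P N = 0%E &
    A `\` N = A' `\` N]].

Let almost_dyadI : setI_closed almost_dyad.
Proof.
move=> A B [mA [r [N [A' [GA mN N0 AN]]]]] [mB [r' [M [B' [GB mM M0 BM]]]]].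
split; first exact: measurableI.
exists (maxn r r'), (N `|` M), (A' `&` B'); split.
- apply: sigma_setI.
    by apply: (dyad_sub _ GA); rewrite leq_maxl.
  by apply: (dyad_sub _ GB); rewrite leq_maxr.
- exact: measurableU.
- exact: null_set_setU.
- rewrite -!setDDl; apply/seteqP; split=> w [[[Aw Bw] Nw] Mw].
    have : (A `\` N) w by []. have : (B `\` M) w by [].
    by rewrite AN BM => -[? ?] [? ?].
  have : (A' `\` N) w by []. have : (B' `\` M) w by [].
  by rewrite -AN -BM => -[? ?] [? ?].
Qed.

Let almost_dyadT : almost_dyad setT.
Proof.
split; first exact: measurableT.
exists 0%N, set0, setT; split=> //; exact: sigma_setT.
Qed.

(** The exceptional null set changes neither the probability of [A] nor that of its intersection
    with [B], so [A] may be exchanged for the event [A'] of a finite grid. *)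
Let almost_dyad_indep : indep P <<s almost_dyad >> <<s increment_events s t >>.
Proof.
have mI B : <<s increment_events s t >> B -> measurable B.
  apply: smallest_sub; first exact: sigma_algebra_measurable.
  move=> _ [i [C [mC ->]]]; rewrite -[X in measurable X]setTI.
  apply: (measurable_funB _ _ measurableT mC); apply: brownian_measurable => //.
  exact: le_trans st.
move=> A B sA sB; apply: (@indep_generated _ _ _ P almost_dyad) => //.
- by move=> C [].
- exact: mI.
move=> {sA}{}A [mA [r [N [A' [GA mN N0 AN]]]]].
have null C : measurable C -> P C = P (C `\` N).
  move=> mC; rewrite (measureDI _ mC mN) [X in _ + X = _](_ : _ = 0)%E ?adde0//.
  by apply: (subset_measure0 _ mN) => //; exact: measurableI.
have mB := mI _ sB; have mA' := dyad_genm GA.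
rewrite [LHS]null ?[P A]null//; last exact: measurableI.
rewrite setDE setIAC -setDE AN setDE setIAC -setDE -null//; last first.
  exact: measurableI.
by rewrite -null// (dyad_indep GA).
Qed.

Let dyad_approx u : 0 <= u <= s -> exists a : nat -> nat,
  (forall r, (a r <= 2 ^ r)%N) /\ (dyad r (a r) @[r --> \oo] --> u).
Proof.
have [->|sn0 /andP[u0 us]] := eqVneq s 0.
  rewrite -eq_le => /eqP <-; exists (fun=> 0%N); split=> //.
  by under eq_fun do rewrite dyad0; exact: cvg_cst.
have {sn0}sp : 0 < s by rewrite lt_neqAle eq_sym sn0.
pose a r := Num.truncn (u / s * 2 ^+ r).
have pge0 r : 0 <= u / s * 2 ^+ r by rewrite mulr_ge0 ?divr_ge0 ?exprn_ge0.
exists a; split=> [r|].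
  have /andP[ar _] := truncn_itv (pge0 r).
  rewrite -(ler_nat R) (le_trans ar)// natrX.
  by rewrite ler_piMl ?exprn_ge0// ler_pdivrMr// mul1r.
apply/cvgrPdist_le => e e0.
have : (s * (1 / 2) ^+ r) @[r --> \oo] --> (0 : R).
  rewrite -(mulr0 s); apply: cvgMr; apply: cvg_expr.
  by rewrite ger0_norm//; lra.
move=> /cvgrPdist_le/(_ e e0); apply: filterS => r.
rewrite sub0r normrN ger0_norm; last by rewrite mulr_ge0 ?exprn_ge0// ltW.
apply: le_trans.
have /andP[h1 h2] := truncn_itv (pge0 r).
have p2 : 0 < (2 ^+ r : R) by rewrite exprn_gt0.
have -> : u - dyad r (a r) = s / 2 ^+ r * (u / s * 2 ^+ r - (a r)%:R).
  by rewrite /dyad; field; rewrite !gt_eqF.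
have q0 : 0 <= s / 2 ^+ r by rewrite divr_ge0// ltW.
rewrite normrM (ger0_norm q0) expr_div_n expr1n mul1r ler_piMr//.
by rewrite ger0_norm ?subr_ge0// lerBlDl natr1 ltW.
Qed.

(** By continuity of paths [W u] is a limit of values at dyadic points. Each such value agrees with
    the increment from time 0 except where [W 0] is not 0, and this is the null set to be
    removed. *)
Let W_almost_dyad u i : 0 <= u <= s ->
  measurable_wrt <<s almost_dyad >> (fun w => W u w i 0).
Proof.
move=> us; have [a [ar au]] := dyad_approx us.
apply: (@measurable_wrt_cvg _ _ _ _ (fun r w => W (dyad r (a r)) w i 0)).
  move=> r B mB; apply: mem_sigma; split.
    rewrite -[X in measurable X]setTI.
    exact: (brownian_measurable _ _ _ mB).
  case: (bW) => _ [N [mN N0 W0N]] _ _ _.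
  exists r, N, ((fun w => W (dyad r (a r)) w i 0 - W 0 w i 0) @^-1` B).
  split=> //; first by apply: mem_sigma; exists (a r), i, B.
  apply/seteqP; split=> w /= [Bw Nw]; split => //; move: Bw.
    suff -> : W 0 w = 0 by rewrite mxE subr0.
    by apply: contrapT => W0; apply: Nw; exact: W0N.
  suff -> : W 0 w = 0 by rewrite mxE subr0.
  by apply: contrapT => W0; apply: Nw; exact: W0N.
move=> w.
have := @brownian_continuous w i u.
rewrite /continuous_at max_r; last by case/andP: us.
move=> cu; have := cvg_comp _ _ au cu.
by apply: cvg_trans; apply: near_eq_cvg; near=> r; rewrite /= max_r.
Unshelve. all: by end_near.
Qed.

Lemma filtration_indep : indep P (F s) <<s increment_events s t >>.
Proof.
suff FA : F s `<=` <<s almost_dyad >>.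
  by move=> A B /FA sA sB; exact: almost_dyad_indep.
apply: sub_sigma => E [[u [i [B [us mB ->]]]]|[mE E0]].
  exact: W_almost_dyad.
(* Off itself, a null event agrees with the empty one. *)
apply: mem_sigma; split=> //; exists 0%N, E, set0; split=> //.
- exact: sigma_set0.
- by rewrite setDv set0D.
Qed.

End indep.
End BrownianFiltration.

(** * Square-integrable variables and Gaussian moments *)

Section SquareIntegrable.
Context {d : measure_display} {T : measurableType d} {R : realType}.
Variable P : probability T R.
Implicit Types f g h : T -> R.

Definition L1 f : Prop := P.-integrable setT (EFin \o f).
Definition L2 f : Prop := measurable_fun setT f /\ L1 (fun w => f w ^+ 2).
Definition mean f : R := (\int[P]_w f w)%R.

Lemma L1_measurable f : L1 f -> measurable_fun setT f.
Proof. by move=> /measurable_int /measurable_EFinP. Qed.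

Lemma L1_le f g : measurable_fun setT f -> (forall w, `|f w| <= g w) ->
  L1 g -> L1 f.
Proof.
move=> mf fg; apply: le_integrable => //; first exact/measurable_EFinP.
by move=> w _; rewrite /= lee_fin (le_trans (fg w))// ler_norm.
Qed.

Lemma L1D f g : L1 f -> L1 g -> L1 (fun w => f w + g w).
Proof. by move=> /integrableD H /H; exact. Qed.

Lemma L1Z c f : L1 f -> L1 (fun w => c * f w).
Proof. by move=> /(integrableZl measurableT c); exact. Qed.

Lemma L1B f g : L1 f -> L1 g -> L1 (fun w => f w - g w).
Proof. by move=> /integrableB H /H; exact. Qed.

Lemma L1_cst c : L1 (fun=> c).
Proof. exact: finite_measure_integrable_cst. Qed.

Lemma L1_sum (I : Type) (r : seq I) (f : I -> T -> R) :
  (forall i, L1 (f i)) -> L1 (fun w => \sum_(i <- r) f i w).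
Proof.
move=> Lf; elim: r => [|i r IH].
  by under [X in L1 X]eq_fun do rewrite big_nil; exact: L1_cst.
by under [X in L1 X]eq_fun do rewrite big_cons; exact: L1D.
Qed.

Lemma L1_bounded f K : measurable_fun setT f -> (forall w, `|f w| <= K) -> L1 f.
Proof. by move=> mf fK; apply: (L1_le mf fK); exact: L1_cst. Qed.

Lemma L2M f g : L2 f -> L2 g -> L1 (fun w => f w * g w).
Proof.
move=> [mf Lf] [mg Lg].
apply: (@L1_le _ (fun w => f w ^+ 2 + g w ^+ 2)); last exact: L1D.
  exact: measurable_funM.
move=> w; rewrite normrM -(real_normK (num_real (f w))).
rewrite -(real_normK (num_real (g w))).
have := sqr_ge0 (`|f w| - `|g w|).
have := normr_ge0 (f w); have := normr_ge0 (g w); nra.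
Qed.

Lemma L2D f g : L2 f -> L2 g -> L2 (fun w => f w + g w).
Proof.
move=> Lf Lg; have [mf Lf2] := Lf; have [mg Lg2] := Lg.
split; first exact: measurable_funD.
under [X in L1 X]eq_fun do rewrite sqrrD.
apply: L1D => //; apply: L1D => //.
under [X in L1 X]eq_fun do rewrite -mulr_natl.
exact/L1Z/L2M.
Qed.

Lemma L2_cst c : L2 (fun=> c).
Proof. by split; [exact: measurable_cst|exact: L1_cst]. Qed.

Lemma L2_L1 f : L2 f -> L1 f.
Proof.
by move=> /L2M /(_ (L2_cst 1)); under [X in L1 X]eq_fun do rewrite mulr1.
Qed.

Lemma L2_bddM f g K : measurable_fun setT f -> (forall w, `|f w| <= K) ->
  L2 g -> L2 (fun w => f w * g w).
Proof.
move=> mf fK [mg Lg]; split; first exact: measurable_funM.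
apply: (@L1_le _ (fun w => K ^+ 2 * g w ^+ 2)); last exact: L1Z.
  by apply: measurable_funX; exact: measurable_funM.
move=> w; rewrite exprMn normrM !normrX !real_normK ?num_real//.
rewrite ler_wpM2r ?sqr_ge0// -real_normK ?num_real//.
by rewrite lerXn2r ?nnegrE// (le_trans _ (fK w)).
Qed.

Lemma L2_sum (I : Type) (r : seq I) (f : I -> T -> R) :
  (forall i, L2 (f i)) -> L2 (fun w => \sum_(i <- r) f i w).
Proof.
move=> Lf; elim: r => [|i r IH].
  by under [X in L2 X]eq_fun do rewrite big_nil; exact: L2_cst.
by under [X in L2 X]eq_fun do rewrite big_cons; exact: L2D.
Qed.

Lemma meanE f : L1 f -> ((mean f)%:E = \int[P]_w (f w)%:E)%E.
Proof. by move=> Lf; rewrite fineK//; exact: integrable_fin_num. Qed.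

Lemma meanD f g : L1 f -> L1 g -> mean (fun w => f w + g w) = mean f + mean g.
Proof. by move=> Lf Lg; exact: RintegralD. Qed.

Lemma meanB f g : L1 f -> L1 g -> mean (fun w => f w - g w) = mean f - mean g.
Proof. by move=> Lf Lg; exact: RintegralB. Qed.

Lemma meanZ c f : L1 f -> mean (fun w => c * f w) = c * mean f.
Proof. by move=> Lf; exact: RintegralZl. Qed.

Lemma mean_cst c : mean (fun=> c) = c.
Proof.
by rewrite /mean /Rintegral integral_cst//= probability_setT mule1.
Qed.

Lemma mean_sum (I : Type) (r : seq I) (f : I -> T -> R) :
  (forall i, L1 (f i)) -> mean (fun w => \sum_(i <- r) f i w) =
  \sum_(i <- r) mean (f i).
Proof.
move=> Lf; elim: r => [|i r IH].
  by under [X in mean X]eq_fun do rewrite big_nil; rewrite mean_cst big_nil.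
under [X in mean X]eq_fun do rewrite big_cons.
by rewrite meanD ?IH ?big_cons//; exact: L1_sum.
Qed.

Lemma le_mean f g : L1 f -> L1 g -> (forall w, f w <= g w) -> mean f <= mean g.
Proof. by move=> Lf Lg fg; apply: le_Rintegral. Qed.

Section independent_product.
Variables (V Y : T -> R).
Hypotheses (LV : L1 V) (LY : L1 Y).
Hypothesis iVY : forall A B : set R, measurable A -> measurable B ->
  P (V @^-1` A `&` Y @^-1` B) = (P (V @^-1` A) * P (Y @^-1` B))%E.

Let V' : {mfun T >-> R} := mfun_Sub (mem_set (L1_measurable LV)).
Let Y' : {mfun T >-> R} := mfun_Sub (mem_set (L1_measurable LY)).
Let mVY : measurable_fun setT (fun w => (V w, Y w)).
Proof. by apply: measurable_fun_pair; exact: L1_measurable. Qed.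

Let mu1 := distribution P V'.
Let mu2 := distribution P Y'.
Let prodf (z : R * R) : \bar R := (z.1 * z.2)%:E.

Let mprodf : measurable_fun setT prodf.
Proof. by apply/measurable_EFinP; apply: measurable_funM. Qed.

Let law (A : set (R * R)) : measurable A ->
  (mu1 \x mu2)%E A = pushforward P (fun w => (V w, Y w)) A.
Proof. by apply: product_measure_unique => B C mB mC; exact: iVY. Qed.

Let integral_law (f : R * R -> \bar R) :
  (\int[mu1 \x mu2]_z f z = \int[pushforward P (fun w => (V w, Y w))]_z f z)%E.
Proof. by apply: eq_measure_integral => A mA _; exact: law. Qed.

Let int1 : mu1.-integrable setT EFin.
Proof.
apply/integrableP; split; first exact/measurable_EFinP.
rewrite ge0_integral_distribution//; last first.
  by apply/measurableT_comp => //; exact/measurable_EFinP.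
by case/integrableP : LV.
Qed.

Let int2 : mu2.-integrable setT EFin.
Proof.
apply/integrableP; split; first exact/measurable_EFinP.
rewrite ge0_integral_distribution//; last first.
  by apply/measurableT_comp => //; exact/measurable_EFinP.
by case/integrableP : LY.
Qed.

Let int_prodf : (mu1 \x mu2)%E.-integrable setT prodf.
Proof.
apply/integrable12ltyP => //.
under eq_integral => x _.
  under eq_integral => y _ do rewrite /prodf /= normrM EFinM.
  rewrite ge0_integralZl//; last first.
    by apply/measurableT_comp => //; exact/measurableT_comp.
  over.
rewrite /= ge0_integralZr//.
- case/integrableP: int1 => _ i1; case/integrableP: int2 => _ i2.
  have i10 : (0 <= \int[mu1]_x `|x%:E|)%E by exact: integral_ge0.
  by apply: lte_mul_pinfty => //; rewrite ge0_fin_numE.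
- by apply/measurableT_comp => //; exact/measurableT_comp.
- exact: integral_ge0.
Qed.

(** A product of two integrable variables need not be integrable. Here independence makes the joint
    law a product measure, and Tonelli's theorem turns the absolute moment of the product into the
    product of the absolute moments. *)
Lemma L1_indepM : L1 (fun w => V w * Y w).
Proof.
apply/integrableP; split.
  by apply/measurable_EFinP; apply: measurable_funM; exact: L1_measurable.
have /integrableP[_] := int_prodf.
rewrite integral_law ge0_integral_pushforward//.
exact: measurableT_comp.
Qed.

Lemma mean_indepM : mean (fun w => V w * Y w) = mean V * mean Y.
Proof.
have := integral_pushforward mVY mprodf L1_indepM measurableT.
rewrite -integral_law -integral12_prod_meas1//= preimage_setT => H.
have EY : (\int[mu2]_y y%:E = (mean Y)%:E)%E.
  by rewrite (integral_distribution _ LY)// meanE.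
have EV : (\int[mu1]_y y%:E = (mean V)%:E)%E.
  by rewrite (integral_distribution _ LV)// meanE.
apply: EFin_inj; rewrite meanE//; last exact: L1_indepM.
rewrite -[LHS]H EFinM -EV muleC -integralZl//; apply: eq_integral => x _.
rewrite /fubini_F /prodf /=; under eq_integral do rewrite EFinM.
by rewrite integralZl// EY muleC.
Qed.
End independent_product.
End SquareIntegrable.

Section GaussianMoments.
Context {R : realType}.

(** The general change of variables has the Radon-Nikodym derivative as weight; it coincides almost
    everywhere with the Gaussian density because both have the same integral over every measurable
    set. *)
Lemma integral_normal_prob (m s : R) (f : R -> \bar R) :
  measurable_fun setT f -> (forall x, (0 <= f x)%E) ->
  (\int[normal_prob m s]_x f x =
   \int[lebesgue_measure]_x (f x * (normal_pdf m s x)%:E))%E.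
Proof.
move=> mf f0; have dom := normal_prob_dominates m s.
rewrite -(Radon_Nikodym_SigmaFinite.change_of_variables dom)//.
apply: ae_eq_integral => //.
- apply: emeasurable_funM => //; apply: measurable_int.
  exact: Radon_Nikodym_SigmaFinite.f_integrable.
- apply: emeasurable_funM => //; apply/measurable_EFinP.
  exact: measurable_normal_pdf.
- apply: ae_eqe_mul2l; apply: integral_ae_eq => //.
  + exact: Radon_Nikodym_SigmaFinite.f_integrable.
  + by apply/measurable_EFinP; exact: measurable_normal_pdf.
  + by move=> E _ mE; rewrite -Radon_Nikodym_SigmaFinite.f_integral.
Qed.

(** With [p] and [q] the exponentials of y / 2 and - y / 2, the left side is half of
    [(p - q) ^+ 2 - y ^+ 2], and [y * q <= p - q <= y * p] follows from 1 + x <= exp x alone. *)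
Lemma expR_cosh_bounds (y : R) :
  `|(expR y + expR (- y)) / 2 - 1 - y ^+ 2 / 2| <= `|y| ^+ 3 * expR `|y| / 2.
Proof.
wlog y0 : y / 0 <= y => [H|].
  have [/H//|/ltW y0] := leP 0 y; have := H (- y).
  by rewrite oppr_ge0 opprK sqrrN normrN (addrC (expR (- y))); exact.
set p := expR (y / 2); set q := expR (- (y / 2)).
have pq : p * q = 1 by rewrite /p /q expRxMexpNx_1.
have ey : expR y = p ^+ 2 by rewrite -expRM_natl; congr expR; field.
have eNy : expR (- y) = q ^+ 2 by rewrite -expRM_natl; congr expR; field.
have p0 : 0 < p by exact: expR_gt0.
have q0 : 0 < q by exact: expR_gt0.
have hq : 1 - y <= q ^+ 2 by rewrite -eNy; exact: expR_ge1Dx.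
have hp : 1 + y <= p ^+ 2 by rewrite -ey; exact: expR_ge1Dx.
rewrite (ger0_norm y0) ey eNy.
have up : p - q <= y * p.
  have : p * (1 - q ^+ 2) <= p * y by rewrite ler_pM2l//; lra.
  by rewrite mulrBr mulr1 expr2 mulrA pq mul1r (mulrC p y).
have lo : y * q <= p - q.
  have : q * y <= q * (p ^+ 2 - 1) by rewrite ler_pM2l//; lra.
  by rewrite mulrBr mulr1 expr2 mulrA (mulrC q p) pq mul1r (mulrC q y).
have -> : (p ^+ 2 + q ^+ 2) / 2 - 1 - y ^+ 2 / 2 =
    ((p - q) ^+ 2 - y ^+ 2) / 2 by rewrite sqrrB pq; field.
rewrite ler_norml; apply/andP; split.
  have : (y * q) ^+ 2 <= (p - q) ^+ 2.
    by rewrite lerXn2r ?nnegrE ?mulr_ge0 ?(ltW q0)// (le_trans _ lo)// mulr_ge0 ?(ltW q0).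
  rewrite exprMn; have : y ^+ 2 * (1 - y) <= y ^+ 2 * q ^+ 2.
    by rewrite ler_wpM2l ?sqr_ge0.
  have : y ^+ 3 <= y ^+ 3 * p ^+ 2.
    by rewrite ler_peMr ?exprn_ge0// (le_trans _ hp)// lerDl.
  have -> : y ^+ 2 * (1 - y) = y ^+ 2 - y ^+ 3 by ring.
  lra.
have h1 : (p - q) ^+ 2 <= (y * p) ^+ 2.
  rewrite lerXn2r ?nnegrE ?mulr_ge0 ?(ltW p0)//.
  by rewrite (le_trans _ lo)// mulr_ge0 ?(ltW q0).
have h2 : p ^+ 2 - 1 <= y * p ^+ 2.
  have : p ^+ 2 * (1 - y) <= p ^+ 2 * q ^+ 2 by rewrite ler_wpM2l ?sqr_ge0.
  rewrite -exprMn pq expr1n; lra.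
have h3 : y ^+ 2 * (p ^+ 2 - 1) <= y ^+ 2 * (y * p ^+ 2).
  by rewrite ler_wpM2l ?sqr_ge0.
rewrite exprMn in h1.
have -> : y ^+ 3 * p ^+ 2 = y ^+ 2 * (y * p ^+ 2) by ring.
have : y ^+ 2 * (p ^+ 2 - 1) = y ^+ 2 * p ^+ 2 - y ^+ 2 by ring.
lra.
Qed.

Lemma expR_norm_le (x : R) : expR `|x| <= expR x + expR (- x).
Proof.
have [x0|x0] := leP 0 x; first by rewrite ger0_norm// lerDl expR_ge0.
by rewrite ltr0_norm// lerDr expR_ge0.
Qed.

Lemma exprn_le_expR (x : R) (k : nat) :
  `|x| ^+ k.+1 <= (k.+1)`!%:R * (expR x + expR (- x)).
Proof.
have := expR_ge1Dxn k (normr_ge0 x).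
have k0 : 0 < ((k.+1)`!%:R : R) by rewrite ltr0n fact_gt0.
move=> h; rewrite mulrC -ler_pdivrMr//.
apply: le_trans (expR_norm_le x); apply: le_trans h.
by rewrite lerDr.
Qed.

(** Takes the place of a limit [e] to 0 in the two moment computations below: an error linear in [e]
    forces equality. *)
Lemma le_scale_eq0 (x C : R) :
  (forall e : R, 0 < e -> e <= 1 -> `|x| <= e * C) -> x = 0.
Proof.
move=> H; apply/eqP; rewrite -normr_le0; apply/ler_addgt0Pr => e e0.
rewrite add0r.
have C0 : 0 <= C by have := H 1 ltr01 (lexx _); rewrite mul1r; exact: le_trans.
have d0 : 0 < e / (e + C + 1) by rewrite divr_gt0//; lra.
have d1 : e / (e + C + 1) <= 1 by rewrite ler_pdivrMr; lra.
apply: (le_trans (H _ d0 d1)).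
rewrite mulrAC ler_pdivrMr ?ler_wpM2l//; lra.
Qed.

Context {d : measure_display} {T : measurableType d} (P : probability T R).
Variables (D : T -> R) (v : R).
Hypotheses (v0 : 0 < v) (mD : measurable_fun setT D).
Hypothesis lawD : forall B : set R, measurable B ->
  P (D @^-1` B) = normal_prob 0 (Num.sqrt v) B.

Lemma integral_gaussian (f : R -> \bar R) :
  measurable_fun setT f -> (forall x, (0 <= f x)%E) ->
  (\int[P]_w f (D w) =
   \int[lebesgue_measure]_x (f x * (normal_pdf 0 (Num.sqrt v) x)%:E))%E.
Proof.
move=> mf f0; rewrite -integral_normal_prob//.
have mD' : @measurable_fun _ _ T (measurableTypeR R) setT D by exact: mD.
have := @ge0_integral_pushforward _ _ T (measurableTypeR R) R D mD' P setT f
  measurableT mf (fun y _ => f0 y).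
rewrite preimage_setT => <-.
by apply: eq_measure_integral => A mA _; exact: lawD.
Qed.

(** Completing the square: exp (l x) times the density of N(0, v) is exp (l^2 v / 2) times the
    density of N(l v, v). *)
Lemma gaussian_mgf (l : R) : L1 P (fun w => expR (l * D w)) /\
  mean P (fun w => expR (l * D w)) = expR (l ^+ 2 * v / 2).
Proof.
have s0 : Num.sqrt v != 0 by rewrite gt_eqF// sqrtr_gt0.
have mE : measurable_fun setT (fun x : R => expR (l * x)).
  by apply: measurableT_comp => //; exact: measurable_funM.
have E : (\int[P]_w (expR (l * D w))%:E = (expR (l ^+ 2 * v / 2))%:E)%E.
  rewrite (integral_gaussian (f := fun x => (expR (l * x))%:E)); first last.
  - by move=> x; rewrite lee_fin expR_ge0.
  - exact/measurable_EFinP.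
  transitivity (\int[lebesgue_measure]_x ((expR (l ^+ 2 * v / 2))%:E *
      (normal_pdf (l * v) (Num.sqrt v) x)%:E))%E.
    apply: eq_integral => x _; rewrite -!EFinM; congr (_%:E).
    rewrite !normal_pdfE// /normal_fun mulrCA [RHS]mulrCA; congr (_ * _).
    rewrite -!expRD sqr_sqrtr ?(ltW v0)//; congr expR.
    by field; rewrite gt_eqF.
  rewrite integralZl//; last exact: integrable_normal_pdf.
  by rewrite integral_normal_pdf mule1.
split; last by rewrite /mean /Rintegral E.
apply/integrableP; split.
  by apply/measurable_EFinP; exact: measurableT_comp mE mD.
under eq_integral do rewrite /= ger0_norm ?expR_ge0//.
by rewrite E ltry.
Qed.

Let mgf2 (l : R) : L1 P (fun w => expR (l * D w) + expR (- (l * D w))) /\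
  mean P (fun w => expR (l * D w) + expR (- (l * D w))) =
  2 * expR (l ^+ 2 * v / 2).
Proof.
have [L1l El] := gaussian_mgf l; have [L1l' El'] := gaussian_mgf (- l).
have e w : expR (- (l * D w)) = expR ((- l) * D w) by rewrite mulNr.
under [X in L1 _ X]eq_fun do rewrite e.
under [X in mean _ X]eq_fun do rewrite e.
split; first exact: L1D.
by rewrite meanD// El El' sqrrN; ring.
Qed.

Lemma gaussian_L1_exprn k : L1 P (fun w => `|D w| ^+ k.+1).
Proof.
apply: L1_le (L1Z _ (proj1 (mgf2 1))) => [|w].
  by apply: measurable_funX; exact: measurableT_comp.
rewrite ger0_norm ?exprn_ge0//; apply: (le_trans (exprn_le_expR (D w) k)).
by rewrite mul1r.
Qed.

Lemma gaussian_L2 : L2 P D.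
Proof.
split=> //; have := gaussian_L1_exprn 1.
by under eq_fun do rewrite -normrX ger0_norm ?sqr_ge0//.
Qed.

Lemma gaussian_L2_sqr : L2 P (fun w => D w ^+ 2).
Proof.
split; first exact: measurable_funX.
have := gaussian_L1_exprn 3.
by under eq_fun do rewrite -normrX ger0_norm ?exprn_even_ge0// (exprM _ 2 2).
Qed.

(** Integrating 1 + l D <= exp (l D) bounds l times the mean by exp (l^2 v / 2) - 1, which is of
    second order in l; the choices l = e and l = - e then squeeze the mean. *)
Lemma gaussian_mean : mean P D = 0.
Proof.
apply: (@le_scale_eq0 _ (v / 2 * expR (v / 2))) => e e0 e1.
have H l : 0 < `|l| <= 1 -> l * mean P D <= `|l| * (`|l| * (v / 2 * expR (v / 2))).
  move=> /andP[l0 l1]; have [Ll El] := gaussian_mgf l.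
  have : mean P (fun w => 1 + l * D w) <= mean P (fun w => expR (l * D w)).
    apply: le_mean => // [|w]; last exact: expR_ge1Dx.
    by apply: L1D; [exact: L1_cst|apply/L1Z/L2_L1; exact: gaussian_L2].
  have LD := L2_L1 gaussian_L2.
  rewrite meanD ?mean_cst ?meanZ ?El//; [|exact: L1_cst|exact: L1Z].
  set a := l ^+ 2 * v / 2 => h.
  have a0 : 0 <= a by rewrite /a divr_ge0// mulr_ge0 ?sqr_ge0// ltW.
  have av : a <= v / 2.
    rewrite /a ler_pM2r// ler_piMl ?(ltW v0)// -real_normK ?num_real//.
    by rewrite exprn_ile1.
  have : expR a * (1 - a) <= expR a * expR (- a).
    by rewrite ler_wpM2l ?expR_ge0// expR_ge1Dx.
  rewrite expRxMexpNx_1 => h2.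
  have : a * expR a <= a * expR (v / 2) by rewrite ler_wpM2l// ler_expR.
  have -> : `|l| * (`|l| * (v / 2 * expR (v / 2))) = a * expR (v / 2).
    by rewrite /a -(real_normK (num_real l)); field.
  rewrite mulrBr mulr1 mulrC in h2; lra.
have He : 0 < `|e| <= 1 by rewrite gtr0_norm// e0.
have := H e He; have := H (- e); rewrite normrN => /(_ He).
rewrite (gtr0_norm e0) mulNr -mulrN !ler_pM2l//.
by rewrite ler_norml lerNl => -> ->.
Qed.

(** The mean of cosh (e D) is exp (e^2 v / 2). Both sides are expanded to second order in [e], with
    remainders of order [e ^+ 3], and the coefficients of e^2 / 2 are compared. *)
Lemma gaussian_second_moment : mean P (fun w => D w ^+ 2) = v.
Proof.
have LD2 : L1 P (fun w => D w ^+ 2) by case: gaussian_L2.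
set m := mean P _; apply/eqP; rewrite -subr_eq0; apply/eqP.
apply: (@le_scale_eq0 _ (24 * expR (2 * v) + v ^+ 2 / 2 * expR (v / 2))).
move=> e e0 e1.
have [Le Ee] := mgf2 e; have [L2' E2] := mgf2 2.
pose h w := (expR (e * D w) + expR (- (e * D w))) / 2 - 1 - (e * D w) ^+ 2 / 2.
have hE : h = fun w => (2^-1 * (expR (e * D w) + expR (- (e * D w))) - 1) -
    e ^+ 2 / 2 * D w ^+ 2.
  by apply/funext => w; rewrite /h; ring.
have Lh1 : L1 P (fun w => 2^-1 * (expR (e * D w) + expR (- (e * D w))) - 1).
  by apply: L1B; [exact: L1Z|exact: L1_cst].
have Lh : L1 P h by rewrite hE; apply: L1B => //; exact: L1Z.
have Eh : mean P h = expR (e ^+ 2 * v / 2) - 1 - e ^+ 2 / 2 * m.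
  rewrite hE meanB//; last exact: L1Z.
  rewrite meanB; [|exact: L1Z|exact: L1_cst].
  by rewrite (meanZ _ LD2) -/m (meanZ _ Le) mean_cst Ee; field.
(* The bound [|e D| ^+ 3 * expR |e D| / 2] is simplified by |D|^3 <= 6 exp |D| and, as e <= 1, exp
   (e |D|) <= exp |D|; whence 6 / 2 = 3 and the doubled exponent. *)
pose g w := e ^+ 3 * 3 * (expR (2 * D w) + expR (- (2 * D w))).
have Lg : L1 P g by exact: L1Z.
have Eg : mean P g = e ^+ 3 * 6 * expR (2 * v).
  rewrite meanZ// E2 (_ : 2 ^+ 2 * v / 2 = 2 * v); last by field.
  by ring.
have hg w : `|h w| <= g w.
  apply: le_trans (expR_cosh_bounds (e * D w)) _.
  rewrite /g normrM (gtr0_norm e0) exprMn.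
  have h1 : `|D w| ^+ 3 <= 6 * expR `|D w|.
    have := expR_ge1Dxn 2 (normr_ge0 (D w)).
    rewrite (_ : (3`!)%:R = 6 :> R)// => ?.
    have : `|D w| ^+ 3 / 6 <= expR `|D w| by lra.
    by rewrite ler_pdivrMr// mulrC.
  have h2 : expR (e * `|D w|) <= expR `|D w|.
    by rewrite ler_expR ler_piMl.
  have h3 : expR `|D w| * expR `|D w| <= expR (2 * D w) + expR (- (2 * D w)).
    rewrite -expRD; apply: le_trans (expR_norm_le _).
    by rewrite ler_expR normrM ger0_norm// mulr_natl.
  have : `|D w| ^+ 3 * expR (e * `|D w|) <= 6 * expR `|D w| * expR `|D w|.
    by apply: ler_pM => //; rewrite ?exprn_ge0 ?expR_ge0.
  rewrite -(mulrA 6) => h4.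
  rewrite -(mulrA (e ^+ 3)) -!(mulrA (e ^+ 3)) ler_pM2l ?exprn_gt0//.
  rewrite ler_pdivrMr//; apply: (le_trans h4); lra.
have up : mean P h <= mean P g.
  by apply: le_mean => // w; exact: le_trans (ler_norm _) (hg w).
have lo : - mean P g <= mean P h.
  rewrite -mulN1r -meanZ//; apply: le_mean => //; first exact: L1Z.
  by move=> w; rewrite mulN1r lerNl (le_trans _ (hg w))// ler_normr lexx orbT.
rewrite Eh Eg in up lo.
set a := e ^+ 2 * v / 2 in up lo.
have a0 : 0 <= a by rewrite /a divr_ge0// mulr_ge0 ?sqr_ge0// ltW.
have av : a <= v / 2.
  by rewrite /a ler_pM2r// ler_piMl ?(ltW v0)// exprn_ile1// ltW.
have h1 : 1 + a <= expR a by exact: expR_ge1Dx.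
have h2 : expR a - 1 <= a * expR a.
  have : expR a * (1 - a) <= expR a * expR (- a).
    by rewrite ler_wpM2l ?expR_ge0// expR_ge1Dx.
  rewrite expRxMexpNx_1 mulrBr mulr1 (mulrC a); lra.
have h3 : expR a - 1 - a <= a ^+ 2 * expR (v / 2).
  have : a * (expR a - 1) <= a * (a * expR a) by rewrite ler_wpM2l.
  have : a ^+ 2 * expR a <= a ^+ 2 * expR (v / 2).
    by rewrite ler_wpM2l ?sqr_ge0// ler_expR.
  have -> : a * (a * expR a) = a ^+ 2 * expR a by ring.
  have : a * expR a >= 0 by rewrite mulr_ge0 ?expR_ge0.
  move=> *; lra.
have e2 : 0 < e ^+ 2 / 2 by rewrite divr_gt0// exprn_gt0.
have key : `|e ^+ 2 / 2 * (v - m)| <= e ^+ 3 * 6 * expR (2 * v) + a ^+ 2 * expR (v / 2).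
  rewrite mulrBr (_ : e ^+ 2 / 2 * v = a); last by rewrite /a; ring.
  have : 0 <= a ^+ 2 * expR (v / 2) by rewrite mulr_ge0 ?sqr_ge0 ?expR_ge0.
  by rewrite ler_norml => ?; apply/andP; split; lra.
rewrite normrM (gtr0_norm e2) in key.
rewrite distrC -(ler_pM2l e2); apply: le_trans key _.
have -> : e ^+ 2 / 2 * (e * (24 * expR (2 * v) + v ^+ 2 / 2 * expR (v / 2))) =
  e ^+ 3 * 12 * expR (2 * v) + e ^+ 3 * (v ^+ 2 / 4) * expR (v / 2) by field.
apply: lerD.
  rewrite ler_wpM2r ?expR_ge0// ler_wpM2l ?exprn_ge0 ?(ltW e0)//; lra.
rewrite ler_wpM2r ?expR_ge0//.
have -> : a ^+ 2 = e ^+ 3 * (v ^+ 2 / 4) * e by rewrite /a; field.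
rewrite ler_piMr// mulr_ge0 ?exprn_ge0 ?(ltW e0)// divr_ge0 ?sqr_ge0//.
Qed.

(** The sharp constant is 3, but only the order [v ^+ 2] matters. From x^4 <= 4! (exp x + exp (- x))
    at x = D / sqrt v, the factors are 24, then 2 for the two exponentials, then 2 as a bound of exp
    (1 / 2). *)
Lemma gaussian_fourth_moment : mean P (fun w => D w ^+ 4) <= 96 * v ^+ 2.
Proof.
have s0 : 0 < Num.sqrt v by rewrite sqrtr_gt0.
have [Ls Es] := mgf2 (Num.sqrt v)^-1.
have sE : (Num.sqrt v)^-1 ^+ 2 * v / 2 = 2^-1.
  by rewrite exprVn sqr_sqrtr ?(ltW v0)// mulVf ?gt_eqF// mul1r.
rewrite sE in Es.
have e2 : expR (2^-1 : R) <= 2.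
  have : expR (2^-1 : R) * (1 - 2^-1) <= expR 2^-1 * expR (- 2^-1).
    by rewrite ler_wpM2l ?expR_ge0// expR_ge1Dx.
  rewrite expRxMexpNx_1; lra.
apply: (@le_trans _ _ (24 * v ^+ 2 * (2 * expR 2^-1))).
  rewrite -Es -meanZ//; apply: le_mean; last 1 first.
  - move=> w; have := exprn_le_expR ((Num.sqrt v)^-1 * D w) 3.
    rewrite (_ : (4`!)%:R = 24 :> R)// => h.
    have : D w ^+ 4 = v ^+ 2 * `|(Num.sqrt v)^-1 * D w| ^+ 4.
      rewrite -normrX (ger0_norm (exprn_even_ge0 _ (n := 4) isT)) exprMn.
      rewrite mulrA exprVn (exprM (Num.sqrt v) 2 2) sqr_sqrtr ?(ltW v0)//.
      by rewrite mulfV ?mul1r// expf_neq0// gt_eqF.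
    by move=> ->; rewrite -[leRHS]mulrA [leRHS]mulrCA ler_wpM2l ?sqr_ge0.
  - have := gaussian_L1_exprn 3; under eq_fun do rewrite -normrX.
    by under eq_fun do rewrite (ger0_norm (exprn_even_ge0 _ (n := 4) isT)).
  - exact: L1Z.
have := sqr_ge0 v; nra.
Qed.
End GaussianMoments.

(** * Moments and orthogonality of Brownian increments *)

Section BrownianIncrements.
Context {d : measure_display} {T : measurableType d} {R : realType}.
Variables (P : probability T R) (n : nat) (W : R -> T -> 'cV[R]_n).
Hypothesis bW : brownian_motion P W.
Local Notation F := (brownian_filtration P W).

Definition increment (j : 'I_n) (s t : R) (w : T) : R := W t w j 0 - W s w j 0.

Lemma increment_measurable j s t : 0 <= s -> 0 <= t ->
  measurable_fun setT (increment j s t).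
Proof.
by move=> s0 t0; apply: measurable_funB; exact: (brownian_measurable bW).
Qed.

Lemma increment_refl j s w : increment j s s w = 0.
Proof. exact: subrr. Qed.

Section moments.
Variables (j : 'I_n) (s t : R).
Hypotheses (s0 : 0 <= s) (st : s <= t).
Let mD : measurable_fun setT (increment j s t).
Proof. by apply: increment_measurable => //; exact: le_trans st. Qed.

Let lawD : s < t -> forall B : set R, measurable B ->
  P (increment j s t @^-1` B) = normal_prob 0 (Num.sqrt (t - s)) B.
Proof. by move=> lt B mB; case: bW => _ _ _ + _; exact. Qed.

Let trivial : ~~ (s < t) -> increment j s t = fun=> 0.
Proof.
rewrite -leNgt => ts; have -> : t = s by apply/eqP; rewrite eq_le ts.
by apply/funext => w; exact: increment_refl.
Qed.

Lemma increment_L2 : L2 P (increment j s t).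
Proof.
have [lt|/trivial ->] := boolP (s < t); last exact: L2_cst.
by apply: gaussian_L2 mD (lawD lt); rewrite subr_gt0.
Qed.

Lemma increment_L2_sqr : L2 P (fun w => increment j s t w ^+ 2).
Proof.
have [lt|/trivial ->] := boolP (s < t); last exact: L2_cst.
by apply: gaussian_L2_sqr mD (lawD lt); rewrite subr_gt0.
Qed.

Lemma increment_mean : mean P (increment j s t) = 0.
Proof.
have [lt|/trivial ->] := boolP (s < t); last exact: mean_cst.
by apply: gaussian_mean mD (lawD lt); rewrite subr_gt0.
Qed.

Lemma increment_second_moment : mean P (fun w => increment j s t w ^+ 2) = t - s.
Proof.
have [lt|nlt] := boolP (s < t).
  by apply: gaussian_second_moment mD (lawD lt); rewrite subr_gt0.
rewrite (trivial nlt) mean_cst expr0n/=; apply/esym/eqP.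
by rewrite subr_eq0 eq_le st leNgt nlt.
Qed.

Lemma increment_fourth_moment :
  mean P (fun w => increment j s t w ^+ 4) <= 96 * (t - s) ^+ 2.
Proof.
have [lt|nlt] := boolP (s < t).
  by apply: gaussian_fourth_moment mD (lawD lt); rewrite subr_gt0.
by rewrite (trivial nlt) mean_cst expr0n/= mulr_ge0 ?sqr_ge0.
Qed.

Lemma increment_wrt : measurable_wrt <<s increment_events W s t >> (increment j s t).
Proof. by move=> B mB; apply: mem_sigma; exists j, B. Qed.

End moments.

Lemma increment_filtration j s t u : 0 <= s <= u -> 0 <= t <= u ->
  measurable_wrt (F u) (increment j s t).
Proof.
move=> su tu; apply: measurable_wrtB; exact: filtration_brownian.
Qed.

Lemma mean_increment_indep (s t : R) (V Y : T -> R) : 0 <= s -> s <= t ->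
  measurable_wrt (F s) V -> measurable_wrt <<s increment_events W s t >> Y ->
  L1 P V -> L1 P Y ->
  L1 P (fun w => V w * Y w) /\ mean P (fun w => V w * Y w) = mean P V * mean P Y.
Proof.
move=> s0 st mV mY LV LY.
have iVY A B : measurable A -> measurable B ->
    P (V @^-1` A `&` Y @^-1` B) = (P (V @^-1` A) * P (Y @^-1` B))%E.
  by move=> mA mB; apply: (filtration_indep bW s0 st); [exact: mV|exact: mY].
by split; [exact: L1_indepM|exact: mean_indepM].
Qed.

(** Mutual independence for a single time step, from [s] to [t], and the index set formed by the two
    coordinates. *)
Lemma increment_coordinate_indep j l s t (A B : set R) : 0 <= s -> s <= t ->
  j != l -> measurable A -> measurable B ->
  P (increment j s t @^-1` A `&` increment l s t @^-1` B) =
    (P (increment j s t @^-1` A) * P (increment l s t @^-1` B))%E.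
Proof.
move=> s0 st jl mA mB.
pose g a := if a is 0%N then s else t.
have gmono : {homo g : a b / (a <= b)%N >-> a <= b} by move=> [|a] [|b].
case: (bW) => _ _ _ _ /(_ 1%N g s0 gmono) iY.
pose C (ai : 'I_1 * 'I_n) : set R := if ai.2 == j then A else B.
have mC ai : measurable (C ai) by rewrite /C; case: ifP.
have := iY [set (ord0, j); (ord0, l)]%SET C mC.
rewrite big_setU1/=; last by rewrite inE xpair_eqE.
rewrite big_set1 /C /= eqxx eq_sym (negbTE jl) => <-; congr (P _).
apply/seteqP; split=> w /=.
  move=> [Aw Bw] ai /=; rewrite !inE => /orP[] /eqP -> /=; rewrite ?eqxx//.
  by rewrite eq_sym (negbTE jl).
move=> H; split.
  by have /= := H (ord0, j); rewrite !inE !eqxx/=; exact.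
have /= := H (ord0, l); rewrite !inE !eqxx orbT/= eq_sym (negbTE jl).
by exact.
Qed.

Lemma mean_increment_cross j l s t : 0 <= s -> s <= t -> j != l ->
  mean P (fun w => increment j s t w * increment l s t w) = 0.
Proof.
move=> s0 st jl.
rewrite (mean_indepM (L2_L1 (increment_L2 j s0 st)) (L2_L1 (increment_L2 l s0 st))).
  by rewrite increment_mean// mul0r.
by move=> A B; exact: increment_coordinate_indep.
Qed.

Definition bounded_adapted (s : R) (xi : T -> R) : Prop :=
  measurable_wrt (F s) xi /\ exists K, forall w, `|xi w| <= K.

Lemma bounded_adapted_mono s t xi : s <= t -> bounded_adapted s xi ->
  bounded_adapted t xi.
Proof.
move=> st [mxi bxi]; split=> //; apply: measurable_wrt_sub mxi.
exact: filtration_mono.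
Qed.

Lemma bounded_adaptedM s xi zeta : bounded_adapted s xi ->
  bounded_adapted s zeta -> bounded_adapted s (fun w => xi w * zeta w).
Proof.
move=> [mxi [K xiK]] [mz [M zM]]; split; first exact: measurable_wrtM.
by exists (K * M) => w; rewrite normrM ler_pM.
Qed.

Lemma bounded_adaptedN s xi : bounded_adapted s xi ->
  bounded_adapted s (fun w => - xi w).
Proof.
move=> [mxi [K xiK]]; split; last by exists K => w; rewrite normrN.
have := measurable_wrtB (@measurable_wrt_cst _ _ R _ 0) mxi.
by congr measurable_wrt; apply/funext => w /=; rewrite sub0r.
Qed.

Lemma measurable_wrt_measurable s (xi : T -> R) : measurable_wrt (F s) xi ->
  measurable_fun setT xi.
Proof.
by move=> mxi _ B mB; rewrite setTI; apply: (filtration_measurable bW); exact: mxi.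
Qed.

Lemma bounded_adapted_L2 s xi f : bounded_adapted s xi -> L2 P f ->
  L2 P (fun w => xi w * f w).
Proof.
by move=> [/measurable_wrt_measurable mxi [K xiK]]; exact: L2_bddM mxi xiK.
Qed.

Lemma mean_adapted_increment j s t V : 0 <= s -> s <= t ->
  measurable_wrt (F s) V -> L1 P V ->
  L1 P (fun w => V w * increment j s t w) /\
  mean P (fun w => V w * increment j s t w) = 0.
Proof.
move=> s0 st mV LV.
have LD := L2_L1 (increment_L2 j s0 st).
have [? ->] := mean_increment_indep s0 st mV (@increment_wrt j s t) LV LD.
by rewrite increment_mean// mulr0.
Qed.

(** Length of the intersection of the intervals from [a] to [b] and from [a'] to [b']. *)
Definition overlap (a b a' b' : R) : R :=
  Num.max 0 (Num.min b b' - Num.max a a').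

(** The polarised isometry for one pair of intervals in arbitrary position. If they are disjoint,
    the later increment is centred given everything else. Otherwise both are cut at the larger left
    end [a'] and the smaller right end [c]: [G] carries the mean, each of [X1], [X2], [X3] ends with
    an increment later than its other factors, and [X4] vanishes because [c] is [b] or [b']. *)
Lemma mean_increment_pair j a b a' b' xi xi' :
  0 <= a -> a <= b -> 0 <= a' -> a' <= b' ->
  bounded_adapted a xi -> bounded_adapted a' xi' ->
  mean P (fun w => (xi w * increment j a b w) * (xi' w * increment j a' b' w)) =
  mean P (fun w => xi w * xi' w) * overlap a b a' b'.
Proof.
wlog aa' : a b a' b' xi xi' / a <= a' => [H|].
  move=> a0 ab a0' ab' bxi bxi'.
  have [aa'|/ltW aa'] := leP a a'; first exact: H.
  under eq_fun do rewrite mulrC.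
  rewrite H//; congr (_ * _); first by under eq_fun do rewrite mulrC.
  by rewrite /overlap (minC b') (maxC a').
move=> a0 ab a0' ab' bxi bxi'.
have b0 : 0 <= b by exact: le_trans ab.
have b0' : 0 <= b' by exact: le_trans ab'.
have Dab := increment_L2 j a0 ab; have Dab' := increment_L2 j a0' ab'.
have bxi1 : bounded_adapted a' xi by exact: bounded_adapted_mono bxi.
have bxx := bounded_adaptedM bxi1 bxi'.
rewrite /overlap (max_r aa').
have [ba'|/ltW a'b] := leP b a'.
  rewrite max_l; last by rewrite subr_le0 ge_min ba'.
  rewrite mulr0; under eq_fun do rewrite mulrACA mulrA.
  apply: (proj2 (mean_adapted_increment _ _ _ _ _)) => //.
    apply: measurable_wrtM; first by case: bxx.
    by apply: increment_filtration; rewrite ?a0 ?b0 ?(le_trans ab).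
  by apply: L2_L1; exact: bounded_adapted_L2 bxx Dab.
pose c := Num.min b b'; have a'c : a' <= c by rewrite le_min a'b.
have c0 : 0 <= c by exact: le_trans a'c.
have cb : c <= b by rewrite ge_min lexx.
have cb' : c <= b' by rewrite ge_min lexx orbT.
have ac : a <= c by exact: le_trans a'c.
rewrite -/c max_r ?subr_ge0//.
have Dac := increment_L2 j a0 ac; have Da'c := increment_L2 j a0' a'c.
have Daa' := increment_L2 j a0 aa'.
pose G w := (xi w * xi' w) * increment j a' c w ^+ 2.
pose X1 w := (xi w * xi' w * increment j a a' w) * increment j a' c w.
pose X2 w := (xi w * xi' w * increment j a' c w) * increment j c b w.
pose X3 w := (xi w * xi' w * increment j a c w) * increment j c b' w.
pose X4 w := (xi w * xi' w) * (increment j c b w * increment j c b' w).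
have X1P : L1 P X1 /\ mean P X1 = 0.
  apply: mean_adapted_increment => //; last first.
    by apply: L2_L1; exact: bounded_adapted_L2 bxx Daa'.
  apply: measurable_wrtM; first by case: bxx.
  by apply: increment_filtration; rewrite ?a0 ?a0' ?lexx.
have bxc := bounded_adapted_mono a'c bxx.
have X2P : L1 P X2 /\ mean P X2 = 0.
  apply: mean_adapted_increment => //; last first.
    by apply: L2_L1; exact: bounded_adapted_L2 bxx Da'c.
  apply: measurable_wrtM; first by case: bxc.
  by apply: increment_filtration; rewrite ?c0 ?a0' ?lexx.
have X3P : L1 P X3 /\ mean P X3 = 0.
  apply: mean_adapted_increment => //; last first.
    by apply: L2_L1; exact: bounded_adapted_L2 bxx Dac.
  apply: measurable_wrtM; first by case: bxc.
  by apply: increment_filtration; rewrite ?c0 ?a0 ?lexx.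
have X4E : X4 = fun=> 0.
  apply/funext => w; rewrite /X4.
  have [bb'|/ltW b'b] := leP b b'.
    by rewrite {1}/c (min_l bb') increment_refl mul0r mulr0.
  by rewrite {2}/c (min_r b'b) increment_refl mulr0 mulr0.
have mxx : measurable_wrt (F a') (fun w => xi w * xi' w) by case: bxx.
have Lxx : L1 P (fun w => xi w * xi' w).
  case: bxx => /measurable_wrt_measurable mx [K xK]; exact: L1_bounded mx xK.
have GP : L1 P G /\ mean P G = mean P (fun w => xi w * xi' w) * (c - a').
  rewrite -(increment_second_moment j a0' a'c).
  apply: (@mean_increment_indep a' c) => //; last by case: Da'c.
  apply: (measurable_wrt_comp (h := fun x => x ^+ 2)); first exact: measurable_funX.
  exact: increment_wrt.
have -> : (fun w => (xi w * increment j a b w) * (xi' w * increment j a' b' w)) =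
    fun w => G w + X1 w + X2 w + X3 w.
  apply/funext => w.
  have : X4 w = 0 by rewrite X4E.
  rewrite /X4 /G /X1 /X2 /X3 /increment => X40; rewrite -[RHS]addr0 -X40.
  by ring.
case: GP X1P X2P X3P => [LG GE] [LX1 E1] [LX2 E2] [LX3 E3].
by rewrite !meanD// ?E1 ?E2 ?E3 ?addr0//; repeat apply: L1D.
Qed.

End BrownianIncrements.

(** * Elementary and Ito integrals *)

Section SquareNorm.
Context {d : measure_display} {S : measurableType d} {R : realType}.
Variable m : {measure set S -> \bar R}.
Implicit Types f g : S -> R.

(** Valued in the extended reals, so that estimates can be chained before finiteness is known. *)
Definition sqnorm f : \bar R := (\int[m]_z ((f z) ^+ 2)%:E)%E.

Lemma sqnorm_ge0 f : (0 <= sqnorm f)%E.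
Proof. by apply: integral_ge0 => z _; rewrite lee_fin sqr_ge0. Qed.

Lemma measurable_sqr f : measurable_fun setT f ->
  measurable_fun setT (fun z => ((f z) ^+ 2)%:E).
Proof. by move=> mf; apply/measurable_EFinP; exact: measurable_funX. Qed.

Lemma le_sqnorm f g : measurable_fun setT f -> measurable_fun setT g ->
  (forall z, `|f z| <= `|g z|) -> (sqnorm f <= sqnorm g)%E.
Proof.
move=> mf mg fg; apply: ge0_le_integral => //.
- by move=> z _; rewrite lee_fin sqr_ge0.
- exact: measurable_sqr.
- exact: measurable_sqr.
move=> z _; rewrite lee_fin -(real_normK (num_real (f z))).
by rewrite -(real_normK (num_real (g z))) lerXn2r ?nnegrE.
Qed.

Lemma sqnormZ c f : measurable_fun setT f ->
  sqnorm (fun z => c * f z) = ((c ^+ 2)%:E * sqnorm f)%E.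
Proof.
move=> mf; rewrite /sqnorm -ge0_integralZl//.
- by apply: eq_integral => z _; rewrite exprMn EFinM.
- exact: measurable_sqr.
- by move=> z _; rewrite lee_fin sqr_ge0.
- by rewrite lee_fin sqr_ge0.
Qed.

(** From (f + g)^2 <= 2 f^2 + 2 g^2. It stands in for Minkowski's inequality and is the source of
    the constants 4 and 6 in the Ito estimates. *)
Lemma sqnormD f g : measurable_fun setT f -> measurable_fun setT g ->
  (sqnorm (fun z => f z + g z)%R <= 2%:E * sqnorm f + 2%:E * sqnorm g)%E.
Proof.
move=> mf mg.
have f0 (h : S -> R) z : (0 <= ((h z) ^+ 2)%:E)%E by rewrite lee_fin sqr_ge0.
have mf2 := measurable_sqr mf; have mg2 := measurable_sqr mg.
rewrite -!ge0_integralZl// -ge0_integralD//; first last.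
- exact: emeasurable_funM.
- by move=> z _; rewrite mule_ge0.
- exact: emeasurable_funM.
- by move=> z _; rewrite mule_ge0.
apply: ge0_le_integral => //.
- by move=> z _; rewrite lee_fin sqr_ge0.
- by apply: measurable_sqr; exact: measurable_funD.
- by apply: emeasurable_funD; apply: emeasurable_funM => //; exact: measurable_sqr.
move=> z _; rewrite -!EFinM -EFinD lee_fin.
have := sqr_ge0 (f z - g z); rewrite sqrrB sqrrD; lra.
Qed.

Lemma sqnormN f : sqnorm (fun z => - f z) = sqnorm f.
Proof. by apply: eq_integral => z _; rewrite sqrrN. Qed.

Lemma sqnorm0 : sqnorm (fun=> 0) = 0%E.
Proof. by rewrite /sqnorm expr0n/= integral0. Qed.

Lemma sqnormB f g : measurable_fun setT f -> measurable_fun setT g ->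
  (sqnorm (fun z => f z - g z)%R <= 2%:E * sqnorm f + 2%:E * sqnorm g)%E.
Proof.
move=> mf mg; rewrite -(sqnormN g); apply: sqnormD => //.
exact: measurableT_comp.
Qed.

End SquareNorm.

Section ElementaryIntegral.
Context {d : measure_display} {T : measurableType d} {R : realType}.
Variables (P : probability T R) (n : nat) (W : R -> T -> 'cV[R]_n).
Hypothesis bW : brownian_motion P W.
Variable j : 'I_n.
Local Notation F := (brownian_filtration P W).
Local Notation leb := (@lebesgue_measure R).
Local Notation mu := (leb \x P)%E.

(** An arbitrary finite index type, with intervals that may overlap, be empty and come in any order:
    sums of elementary integrands and their restriction to a time interval need no common
    subdivision. *)
Definition elementary (I : finType) (a b : I -> R) (xi : I -> T -> R) : Prop :=
  forall i, [/\ 0 <= a i, a i <= b i & bounded_adapted P W (a i) (xi i)].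

Definition elementary_process (I : finType) (a b : I -> R) (xi : I -> T -> R)
    (z : R * T) : R :=
  \sum_i xi i z.2 * \1_(`]a i, b i]) z.1.

Definition elementary_integral (I : finType) (a b : I -> R) (xi : I -> T -> R)
    (w : T) : R :=
  \sum_i xi i w * increment W j (a i) (b i) w.

Lemma setI_itv_oc (a b a' b' : R) :
  `]a, b]%classic `&` `]a', b']%classic = `]Num.max a a', Num.min b b']%classic.
Proof.
apply/seteqP; split=> x /=; rewrite !in_itv/= gt_max le_min.
  by move=> [/andP[-> ->] /andP[-> ->]].
by move=> /andP[/andP[-> ->] /andP[-> ->]].
Qed.

Lemma integral_indic_overlap (a b a' b' c : R) :
  leb.-integrable setT (fun s => (c * (\1_(`]a, b]) s * \1_(`]a', b']) s))%:E) /\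
  (\int[leb]_s (c * (\1_(`]a, b]) s * \1_(`]a', b']) s))%:E =
   (c * overlap a b a' b')%:E)%E.
Proof.
set J := `]Num.max a a', Num.min b b'].
have E s : (\1_(`]a, b]) s * \1_(`]a', b']) s = \1_[set` J] s :> R)%R.
  by rewrite /J -setI_itv_oc indicI.
have lebJ : (leb [set` J] = (overlap a b a' b')%:E)%E.
  rewrite lebesgue_measure_itv/= lte_fin /overlap.
  set x := Num.max a a'; set y := Num.min b b'.
  have [lt|le] := ltP x y; first by rewrite max_r// subr_ge0 ltW.
  by rewrite max_l// subr_le0.
under [X in _.-integrable _ X]eq_fun do rewrite E EFinM.
under [X in (X = _)%E]eq_integral do rewrite E EFinM.
have iJ : leb.-integrable setT (fun s => (\1_[set` J] s)%:E).
  exact: integrable_indic_itv.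
split; first exact: integrableZl.
by rewrite integralZl// integral_indic// setIT EFinM -lebJ.
Qed.

Section isometry.
Variables (I : finType) (a b : I -> R) (xi : I -> T -> R).
Hypothesis H : elementary a b xi.

Lemma elementary_process_measurable :
  measurable_fun setT (elementary_process a b xi).
Proof.
apply: measurable_sum => i; apply: measurable_funM.
  apply: (measurableT_comp _ measurable_snd).
  by case: (H i) => _ _ [+ _]; exact: (measurable_wrt_measurable bW).
exact: (measurableT_comp _ measurable_fst).
Qed.

Lemma elementary_integral_L2 : L2 P (elementary_integral a b xi).
Proof.
apply: L2_sum => i; case: (H i) => a0 ab bxi.
by apply: (bounded_adapted_L2 bW bxi); exact: increment_L2.
Qed.

Let inner w : (\int[leb]_s ((elementary_process a b xi (s, w)) ^+ 2)%:E =
  (\sum_(p : I * I) (xi p.1 w * xi p.2 w) *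
     overlap (a p.1) (b p.1) (a p.2) (b p.2))%:E)%E.
Proof.
pose f (p : I * I) s : \bar R := ((xi p.1 w * xi p.2 w) *
   (\1_(`]a p.1, b p.1]) s * \1_(`]a p.2, b p.2]) s))%:E.
transitivity (\int[leb]_s (\sum_p f p s)%E)%E.
  apply: eq_integral => s _; rewrite /f sumEFin; congr (_%:E).
  rewrite expr2 big_distrlr/= pair_big/=; apply: eq_bigr => p _.
  by rewrite mulrACA.
rewrite integral_sum//=; last first.
  by move=> p; exact: (proj1 (integral_indic_overlap _ _ _ _ _)).
rewrite -sumEFin; apply: eq_bigr => p _.
exact: (proj2 (integral_indic_overlap _ _ _ _ _)).
Qed.

(** Both squares expand into sums over pairs of indices, which agree term by term: the time integral
    of a product of two interval indicators is the overlap that also appears in the mean of a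
    product of two increments. *)
Lemma elementary_isometry :
  (\int[P]_w ((elementary_integral a b xi w) ^+ 2)%:E =
   \int[mu]_z ((elementary_process a b xi z) ^+ 2)%:E)%E.
Proof.
rewrite fubini_tonelli2//=; last first.
- by move=> z; rewrite lee_fin sqr_ge0.
- apply/measurable_EFinP; apply: measurable_funX.
  exact: elementary_process_measurable.
rewrite /fubini_G /=.
under [in RHS]eq_integral => w _ do rewrite inner.
have Lp (p : I * I) : L1 P (fun w => xi p.1 w * xi p.2 w).
  have [_ _ [/(measurable_wrt_measurable bW) m1 [K1 xiK1]]] := H p.1.
  have [_ _ [/(measurable_wrt_measurable bW) m2 [K2 xiK2]]] := H p.2.
  apply: (@L1_bounded _ _ _ _ _ (K1 * K2)); first exact: measurable_funM.
  by move=> w; rewrite normrM ler_pM.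
have Lp' (p : I * I) : L1 P (fun w => xi p.1 w * xi p.2 w *
    overlap (a p.1) (b p.1) (a p.2) (b p.2)).
  by under [X in L1 _ X]eq_fun do rewrite mulrC; exact: L1Z.
rewrite -!meanE; last 2 first.
- exact: L1_sum.
- by case: elementary_integral_L2.
rewrite mean_sum//; congr (_%:E).
pose g (p : I * I) w := (xi p.1 w * increment W j (a p.1) (b p.1) w) *
  (xi p.2 w * increment W j (a p.2) (b p.2) w).
have Lg p : L1 P (g p).
  have [a10 ab1 bx1] := H p.1; have [a20 ab2 bx2] := H p.2.
  by apply: L2M; [apply: (bounded_adapted_L2 bW bx1)|
    apply: (bounded_adapted_L2 bW bx2)]; exact: increment_L2.
have -> : (fun w => elementary_integral a b xi w ^+ 2) = fun w => \sum_p g p w.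
  by apply/funext => w; rewrite expr2 big_distrlr/= pair_big/=.
rewrite mean_sum//; apply: eq_bigr => p _.
have [a10 ab1 bx1] := H p.1; have [a20 ab2 bx2] := H p.2.
rewrite (mean_increment_pair bW)//.
by under [in RHS]eq_fun do rewrite mulrC; rewrite meanZ// mulrC.
Qed.

End isometry.

(* Integrands live on the whole line, an integral over ]0, t] being that of
   [K * \1_(`]0, t])]; this makes integrals over subintervals additive. *)
Definition ito (K : R * T -> R) (J : T -> R) : Prop :=
  [/\ measurable_fun setT K, measurable_fun setT J & forall e : R, 0 < e ->
    exists (I : finType) (a b : I -> R) (xi : I -> T -> R),
    [/\ elementary a b xi,
      (sqnorm mu (fun z => elementary_process a b xi z - K z)%R <= e%:E)%E &
      (sqnorm P (fun w => elementary_integral a b xi w - J w)%R <= e%:E)%E]].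

Lemma elementary_isometry_sqnorm (I : finType) (a b : I -> R) (xi : I -> T -> R) :
  elementary a b xi ->
  sqnorm P (elementary_integral a b xi) = sqnorm mu (elementary_process a b xi).
Proof. exact: elementary_isometry. Qed.

Lemma elementary_integral_measurable (I : finType) (a b : I -> R)
    (xi : I -> T -> R) : elementary a b xi ->
  measurable_fun setT (elementary_integral a b xi).
Proof. by move=> /elementary_integral_L2[]. Qed.

(** An inequality with constant 4 in place of the exact isometry: [sqnormD] is applied on both sides
    of the elementary isometry. Only the smallness of integrals with small integrands is needed from
    it. *)
Lemma ito_isometry K J : ito K J -> (sqnorm P J <= 4%:E * sqnorm mu K)%E.
Proof.
move=> [mK mJ H]; apply/lee_addgt0Pr => e e0.
have [I [a [b [xi [Hel eK eJ]]]]] := H (e / 6) ltac:(by rewrite divr_gt0).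
have mS := elementary_integral_measurable Hel.
have mE := elementary_process_measurable Hel.
have h1 : (sqnorm P J <= 2%:E * (e / 6)%:E +
    2%:E * sqnorm P (elementary_integral a b xi))%E.
  have -> : J = fun w => elementary_integral a b xi w -
      (elementary_integral a b xi w - J w) by apply/funext => w; ring.
  apply: (le_trans (sqnormB _ _ _)) => //; first exact: measurable_funB.
  by rewrite addeC leeD2r// lee_wpmul2l.
have h2 : (sqnorm mu (elementary_process a b xi) <= 2%:E * (e / 6)%:E +
    2%:E * sqnorm mu K)%E.
  have -> : elementary_process a b xi = fun z =>
      (elementary_process a b xi z - K z) + K z by apply/funext => z; ring.
  apply: (le_trans (sqnormD _ _ _)) => //; first exact: measurable_funB.
  by rewrite leeD2r// lee_wpmul2l.
apply: (le_trans h1); rewrite elementary_isometry_sqnorm//.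
apply: (@le_trans _ _ (2%:E * (e / 6)%:E + 2%:E * (2%:E * (e / 6)%:E +
    2%:E * sqnorm mu K)))%E.
  by rewrite leeD2l// lee_wpmul2l.
rewrite muleDr// addeA [leRHS]addeC muleA -!EFinM -EFinD.
have -> : 2 * (e / 6) + 2 * 2 * (e / 6) = e by field.
by rewrite muleA -EFinM -natrM.
Qed.

Lemma ito_base s t xi : 0 <= s -> s <= t -> bounded_adapted P W s xi ->
  ito (fun z => xi z.2 * \1_(`]s, t]) z.1) (fun w => xi w * increment W j s t w).
Proof.
move=> s0 st bxi.
have Hel : elementary (fun _ : 'I_1 => s) (fun=> t) (fun=> xi) by [].
have EK : elementary_process (fun _ : 'I_1 => s) (fun=> t) (fun=> xi) =
    fun z => xi z.2 * \1_(`]s, t]) z.1.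
  by apply/funext => z; rewrite /elementary_process big_ord1.
have EJ : elementary_integral (fun _ : 'I_1 => s) (fun=> t) (fun=> xi) =
    fun w => xi w * increment W j s t w.
  by apply/funext => z; rewrite /elementary_integral big_ord1.
rewrite -EK -EJ; split.
- exact: elementary_process_measurable.
- exact: elementary_integral_measurable.
move=> e e0; exists 'I_1, (fun=> s), (fun=> t), (fun=> xi).
by split=> //; under eq_fun do rewrite subrr; rewrite sqnorm0 lee_fin ltW.
Qed.

Lemma itoD K1 J1 K2 J2 : ito K1 J1 -> ito K2 J2 ->
  ito (fun z => K1 z + K2 z) (fun w => J1 w + J2 w).
Proof.
move=> [mK1 mJ1 H1] [mK2 mJ2 H2]; split; [exact: measurable_funD..|].
move=> e e0; have e4 : 0 < e / 4 by rewrite divr_gt0.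
have [I1 [a1 [b1 [xi1 [Hel1 eK1 eJ1]]]]] := H1 _ e4.
have [I2 [a2 [b2 [xi2 [Hel2 eK2 eJ2]]]]] := H2 _ e4.
pose a (i : I1 + I2) := match i with inl i => a1 i | inr i => a2 i end.
pose b (i : I1 + I2) := match i with inl i => b1 i | inr i => b2 i end.
pose xi (i : I1 + I2) := match i with inl i => xi1 i | inr i => xi2 i end.
have eE : (e%:E = 2%:E * (e / 4)%:E + 2%:E * (e / 4)%:E)%E.
  by rewrite -!EFinM -EFinD; congr (_%:E); field.
exists (I1 + I2)%type, a, b, xi; split.
- by case=> i; [exact: Hel1|exact: Hel2].
- have -> : (fun z => elementary_process a b xi z - (K1 z + K2 z)) =
      fun z => (elementary_process a1 b1 xi1 z - K1 z) +
               (elementary_process a2 b2 xi2 z - K2 z).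
    by apply/funext => z; rewrite /elementary_process big_sumType /=; ring.
  apply: (le_trans (sqnormD _ _ _)).
  + by apply: measurable_funB => //; exact: elementary_process_measurable.
  + by apply: measurable_funB => //; exact: elementary_process_measurable.
  by rewrite eE; apply: leeD; exact: lee_wpmul2l.
- have -> : (fun w => elementary_integral a b xi w - (J1 w + J2 w)) =
      fun w => (elementary_integral a1 b1 xi1 w - J1 w) +
               (elementary_integral a2 b2 xi2 w - J2 w).
    by apply/funext => z; rewrite /elementary_integral big_sumType /=; ring.
  apply: (le_trans (sqnormD _ _ _)).
  + by apply: measurable_funB => //; exact: elementary_integral_measurable.
  + by apply: measurable_funB => //; exact: elementary_integral_measurable.
  by rewrite eE; apply: leeD; exact: lee_wpmul2l.
Qed.

Lemma itoN K J : ito K J -> ito (fun z => - K z) (fun w => - J w).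
Proof.
move=> [mK mJ H]; split; [exact: measurableT_comp..|].
move=> e /H[I [a [b [xi [Hel eK eJ]]]]].
exists I, a, b, (fun i w => - xi i w); split.
- by move=> i; have [? ? ?] := Hel i; split => //; exact: bounded_adaptedN.
- rewrite -sqnormN in eK; rewrite (_ : (fun _ => _) = fun z =>
      - (elementary_process a b xi z - K z))//.
  apply/funext => z; rewrite opprB addrC opprK /elementary_process -sumrN.
  by congr (_ + _); apply: eq_bigr => i _; rewrite mulNr.
- rewrite -sqnormN in eJ; rewrite (_ : (fun _ => _) = fun z =>
      - (elementary_integral a b xi z - J z))//.
  apply/funext => z; rewrite opprB addrC opprK /elementary_integral -sumrN.
  by congr (_ + _); apply: eq_bigr => i _; rewrite mulNr.
Qed.

Lemma ito0 : ito (fun=> 0) (fun=> 0).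
Proof.
have bz : bounded_adapted P W 0 (fun=> 0).
  by split; [exact: measurable_wrt_cst|exists 0 => w; rewrite normr0].
have := @ito_base 0 0 _ (lexx _) (lexx _) bz.
by under eq_fun do rewrite mul0r; under [X in ito _ X]eq_fun do rewrite mul0r.
Qed.

Lemma ito_sum (I : Type) (r : seq I) (K : I -> R * T -> R) (J : I -> T -> R) :
  (forall i, ito (K i) (J i)) ->
  ito (fun z => \sum_(i <- r) K i z) (fun w => \sum_(i <- r) J i w).
Proof.
move=> H; elim: r => [|i r IH].
  under eq_fun do rewrite big_nil; under [X in ito _ X]eq_fun do rewrite big_nil.
  exact: ito0.
under eq_fun do rewrite big_cons; under [X in ito _ X]eq_fun do rewrite big_cons.
exact: itoD.
Qed.

(* Restricting an elementary integrand to times after [s] only changes its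
   integral by that of the part before [s], which is small by the isometry. *)
Lemma ito_adaptedM s zeta K J : 0 <= s -> bounded_adapted P W s zeta ->
  (forall z, z.1 <= s -> K z = 0) -> ito K J ->
  ito (fun z => zeta z.2 * K z) (fun w => zeta w * J w).
Proof.
move=> s0 bz K0 [mK mJ H].
have mz := measurable_wrt_measurable bW (proj1 bz).
split; [apply: measurable_funM => //; exact: measurableT_comp|exact: measurable_funM|].
have [M M0 zM] : exists2 M, 0 < M & forall w, `|zeta w| <= M.
  case: bz => _ [M zM]; exists (`|M| + 1); first by rewrite ltr_pwDr.
  by move=> w; rewrite (le_trans (zM w))// (le_trans (ler_norm _))// lerDl.
(* The factor [zeta] costs [M ^+ 2]; the integral is in error both by the approximation and by the
   removed early part, and [sqnormB] turns the two errors [e'] into [4 * e']. *)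
move=> e e0; pose e' := e / (4 * M ^+ 2).
have e'0 : 0 < e' by rewrite divr_gt0// mulr_gt0// exprn_gt0.
have [I [a [b [xi [Hel eK eJ]]]]] := H _ e'0.
(* The part of each interval after [s], where multiplying the coefficient by [zeta] keeps it
   adapted. *)
pose ah i := Num.max s (a i); pose bh i := Num.max s (b i).
pose xih i w := zeta w * xi i w.
(* The part before [s]. If [s < a i] this part is the degenerate interval at [s], where [xi i] is
   not known to be adapted; the coefficient 0 is used instead. *)
pose al i := Num.min s (a i); pose bl i := Num.min s (b i).
pose xil i : T -> R := if a i <= s then xi i else fun=> 0.
have Hh : elementary ah bh xih.
  move=> i; have [a0 ab bxi] := Hel i; split.
  - by rewrite le_max s0.
  - by rewrite /ah /bh ge_max !le_max lexx ab orbT.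
  - apply: (bounded_adaptedM (xi := zeta)).
      by apply: bounded_adapted_mono bz; rewrite le_max lexx.
    by apply: bounded_adapted_mono bxi; rewrite le_max lexx orbT.
have Hl : elementary al bl xil.
  move=> i; have [a0 ab bxi] := Hel i; split.
  - by rewrite le_min s0.
  - by rewrite /al /bl le_min !ge_min lexx ab orbT.
  - rewrite /al /xil; case: ifPn => as_; first by rewrite min_r.
    by split; [exact: measurable_wrt_cst|exists 0 => w; rewrite normr0].
have Ph z : elementary_process ah bh xih z - zeta z.2 * K z =
    zeta z.2 * ((elementary_process a b xi z - K z) * (s < z.1)%R%:R).
  rewrite /elementary_process; case: ltP => [sz|zs].
    rewrite mulr1 mulrBr mulr_sumr; congr (_ - _); apply: eq_bigr => i _.
    rewrite /xih mulrA; congr (_ * _); rewrite !indicE; congr (nat_of_bool _)%:R.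
    by apply/idP/idP; rewrite !inE/= !in_itv/= gt_max le_max sz/= leNgt sz.
  rewrite mulr0 mulr0 K0// mulr0 subr0 big1// => i _.
  rewrite indicE memNset ?mulr0//= in_itv/= gt_max => /andP[/andP[sz _] _].
  by move: sz; rewrite ltNge zs.
have Pl z : elementary_process al bl xil z =
    (elementary_process a b xi z - K z) * (z.1 <= s)%R%:R.
  rewrite /elementary_process; case: leP => [zs|sz].
    rewrite mulr1 K0// subr0; apply: eq_bigr => i _.
    rewrite /xil !indicE; case: ifPn => as_.
      congr (_ * (nat_of_bool _)%:R); apply/idP/idP; rewrite !inE/= !in_itv/=.
        by rewrite /al /bl (min_r as_) le_min => /andP[-> /andP[_ ->]].
      by rewrite /al /bl (min_r as_) le_min zs.
    rewrite mul0r memNset ?mulr0//= in_itv/= => /andP[az _].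
    by move: as_; rewrite (le_trans (ltW az)).
  rewrite mulr0 big1// => i _; rewrite indicE memNset ?mulr0//= in_itv/=.
  by rewrite /bl le_min leNgt sz/= andbF.
have Jh w : elementary_integral ah bh xih w - zeta w * J w =
    zeta w * ((elementary_integral a b xi w - J w) - elementary_integral al bl xil w).
  rewrite /elementary_integral !mulrBr addrAC; congr (_ - _).
  rewrite -mulrBr -sumrB mulr_sumr; apply: eq_bigr => i _.
  rewrite /xih -mulrA; congr (_ * _); have [a0 ab _] := Hel i.
  rewrite /xil /ah /bh /al /bl; have [as_|sa] := leP (a i) s.
    rewrite -mulrBr; congr (_ * _); rewrite /increment.
    by case: (leP s (b i)) => _; ring.
  rewrite mul0r subr0; congr (_ * _).
  by rewrite (max_r (ltW (lt_le_trans sa ab))).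
have m1 := elementary_process_measurable Hel.
have m2 := elementary_process_measurable Hh.
have m3 := elementary_integral_measurable Hel.
have m4 := elementary_integral_measurable Hl.
have m5 := elementary_process_measurable Hl.
have mzK : measurable_fun setT (fun z : R * T => zeta z.2 * K z).
  by apply: measurable_funM => //; exact: measurableT_comp.
have M2 : (0 <= (M ^+ 2)%:E)%E by rewrite lee_fin sqr_ge0.
exists I, ah, bh, xih; split=> //.
  apply: (@le_trans _ _ (sqnorm mu (fun z => M * (elementary_process a b xi z - K z)))).
    apply: le_sqnorm; first exact: measurable_funB.
      by apply: measurable_funM => //; exact: measurable_funB.
    move=> z; rewrite Ph !normrM ler_pM// ?mulr_ge0//.
      by rewrite (gtr0_norm M0).
    by rewrite ler_piMr// normr_nat lern1 leq_b1.
  rewrite sqnormZ; last exact: measurable_funB.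
  apply: (@le_trans _ _ ((M ^+ 2)%:E * e'%:E)%E); first exact: lee_wpmul2l.
  rewrite -EFinM lee_fin /e' mulrA ler_pdivrMr ?mulr_gt0 ?exprn_gt0//.
  by rewrite mulrC ler_pM2l// ler_peMl ?sqr_ge0// ler1n.
apply: (@le_trans _ _ (sqnorm P (fun w => M * ((elementary_integral a b xi w - J w) - elementary_integral al bl xil w)))).
  apply: le_sqnorm.
  - apply: measurable_funB; first exact: (elementary_integral_measurable Hh).
    exact: measurable_funM.
  - by apply: measurable_funM => //; apply: measurable_funB => //; exact: measurable_funB.
  - by move=> w; rewrite Jh !normrM ler_wpM2r// (gtr0_norm M0).
rewrite sqnormZ; last by apply: measurable_funB => //; exact: measurable_funB.
apply: (@le_trans _ _ ((M ^+ 2)%:E * (4 * e')%:E)%E); last first.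
  by rewrite -EFinM lee_fin /e' le_eqVlt; apply/orP; left; apply/eqP; field; rewrite gt_eqF.
apply: lee_wpmul2l => //; apply: (le_trans (sqnormB _ _ _)) => //.
  exact: measurable_funB.
have -> : ((4 * e')%:E = 2%:E * e'%:E + 2%:E * e'%:E)%E.
  by rewrite -!EFinM -EFinD; congr (_%:E); ring.
apply: leeD; first exact: lee_wpmul2l.
apply: lee_wpmul2l => //; rewrite elementary_isometry_sqnorm//.
apply: le_trans eK; apply: le_sqnorm => //; first exact: measurable_funB.
by move=> z; rewrite Pl normrM ler_piMr// normr_nat lern1 leq_b1.
Qed.
End ElementaryIntegral.

(** * Uniform grids and discretization of continuous integrands *)

Section Grid.
Context {R : realType}.
Variable (u : R).
Hypothesis u0 : 0 <= u.

Definition grid (N m : nat) : R := u * (m%:R / N.+1%:R).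

Lemma grid0 N : grid N 0 = 0. Proof. by rewrite /grid mul0r mulr0. Qed.

Lemma grid_end N : grid N N.+1 = u.
Proof. by rewrite /grid divff ?mulr1// pnatr_eq0. Qed.

Lemma grid_mono N a b : (a <= b)%N -> grid N a <= grid N b.
Proof. by move=> ab; rewrite ler_wpM2l// ler_pM2r ?invr_gt0 ?ltr0n// ler_nat. Qed.

Lemma grid_ge0 N m : 0 <= grid N m.
Proof. by rewrite -(grid0 N) grid_mono. Qed.

Lemma grid_le N m : (m <= N.+1)%N -> grid N m <= u.
Proof. by move=> mN; rewrite -[leRHS](grid_end N) grid_mono. Qed.

Lemma grid_step N m : grid N m.+1 - grid N m = u / N.+1%:R.
Proof. by rewrite /grid -mulrBr -mulrBl -natrB// subSnn mul1r. Qed.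

(** Left-open like the intervals of simple processes; time 0 thus lies in no cell. *)
Definition cell (N m : nat) (s : R) : R := \1_(`]grid N m, grid N m.+1]) s.

(** Formulated so as to cover times that lie in no cell, for which any [m0] will do. *)
Lemma cell_unique N s : exists m0, forall m, m != m0 -> cell N m s = 0.
Proof.
have [[m0 hm0]|H] := pselect (exists m0, `]grid N m0, grid N m0.+1]%classic s).
  exists m0 => m mm0; rewrite /cell indicE memNset//= in_itv/= => /andP[gs sg].
  move: hm0; rewrite /= in_itv/= => /andP[gs0 sg0].
  move: mm0; rewrite neq_ltn => /orP[lt|lt].
    have := lt_le_trans gs0 (le_trans sg (grid_mono N lt)); by rewrite ltxx.
  have := lt_le_trans gs (le_trans sg0 (grid_mono N lt)); by rewrite ltxx.
exists 0%N => m _; rewrite /cell indicE memNset// => Hm; apply: H; by exists m.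
Qed.

Lemma cell_sum N m s : \sum_(i < m) cell N i s = \1_(`]0, grid N m]) s.
Proof.
elim: m => [|m IH].
  rewrite big_ord0 grid0 indicE memNset//= in_itv/= => /andP[/lt_le_trans h /h].
  by rewrite ltxx.
rewrite big_ord_recr/= IH /cell !indicE -natrD; congr (_%:R).
have gm := grid_mono N (leqnSn m); have g0 := grid_ge0 N m.
rewrite !mem_setE !in_itv/=.
case: (ltP 0 s) => s0; case: (leP s (grid N m)) => sm;
  case: (leP s (grid N m.+1)) => sm1 //=.
- by have := lt_le_trans sm1 (le_trans sm gm); rewrite ltxx.
- by have := le_lt_trans s0 (le_lt_trans g0 sm); rewrite ltxx.
Qed.

Lemma cell_le1 N m s : 0 <= cell N m s <= 1.
Proof. by rewrite /cell indicE ler0n lern1 leq_b1. Qed.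

Lemma measurable_cell N m : measurable_fun setT (cell N m).
Proof. exact: measurable_indic. Qed.

Lemma cell_near N m s : cell N m s != 0 -> `|s - grid N m| <= u / N.+1%:R.
Proof.
rewrite /cell indicE pnatr_eq0 eqb0 negbK inE/= in_itv/= => /andP[h1 h2].
by rewrite ger0_norm ?subr_ge0 ?(ltW h1)// -(grid_step N m) lerB.
Qed.

Lemma grid_mesh (e : R) : 0 < e -> exists N0, forall N, (N0 <= N)%N ->
  u / N.+1%:R < e.
Proof.
move=> e0; exists (Num.truncn (u / e)) => N hN.
rewrite ltr_pdivrMr ?ltr0n// mulrC -ltr_pdivrMr//.
have /andP[_ /lt_le_trans] := truncn_itv (divr_ge0 u0 (ltW e0)); apply.
by rewrite ler_nat.
Qed.

End Grid.

Section ProcessMeasurability.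
Context {d : measure_display} {T : measurableType d} {R : realType}.

(** A process with continuous paths is the pointwise limit of the processes frozen at the last
    multiple of 1 / (r + 1); preimages under the latter are countable unions of measurable
    rectangles. *)
Lemma measurable_process (G : R -> T -> R) :
  (forall w, continuous (G^~ w)) -> (forall s w, G s w = G (Num.max 0 s) w) ->
  (forall s, 0 <= s -> measurable_fun setT (G s)) ->
  measurable_fun setT (fun z : R * T => G z.1 z.2).
Proof.
move=> cG G0 mG.
pose p s : R := Num.max 0 s.
pose k (r : nat) s := Num.truncn (p s * r.+1%:R).
have p0 s : 0 <= p s by rewrite le_max lexx.
have pr r s : 0 <= p s * r.+1%:R by rewrite mulr_ge0.
have mp r : measurable_fun setT (fun s => p s * r.+1%:R).
  apply: measurable_funM => //; apply: measurable_maxr => //.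
apply: (@measurable_fun_cvg _ _ _ _ (fun r z => G ((k r z.1)%:R / r.+1%:R) z.2)).
  move=> r _ B mB; rewrite setTI.
  have -> : (fun z : R * T => G ((k r z.1)%:R / r.+1%:R) z.2) @^-1` B =
      \bigcup_a (((fun s => p s * r.+1%:R) @^-1` `[a%:R, a.+1%:R[%classic) `*`
                 (G (a%:R / r.+1%:R) @^-1` B)).
    apply/seteqP; split=> [z Bz|z [a _ [/= ha Bz]]] /=.
      by exists (k r z.1) => //; split => //=; rewrite in_itv/= truncn_itv.
    by rewrite /k (truncn_def (n := a)).
  apply: bigcupT_measurable => a; apply: measurableX.
    by rewrite -[X in measurable X]setTI; exact: mp.
  by rewrite -[X in measurable X]setTI; apply: mG => //; rewrite divr_ge0.
move=> z _ /=; rewrite (G0 z.1).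
have : (k r z.1)%:R / r.+1%:R @[r --> \oo] --> p z.1.
  apply/cvgrPdist_lt => e e0.
  have [N0 hN0] := grid_mesh (@ler01 R) e0.
  exists N0 => // r /= hr; apply: le_lt_trans (hN0 r hr).
  have /andP[h1 h2] := truncn_itv (pr r z.1).
  have -> : p z.1 - (k r z.1)%:R / r.+1%:R =
     (p z.1 * r.+1%:R - (k r z.1)%:R) / r.+1%:R by rewrite mulrBl mulfK// pnatr_eq0.
  rewrite normrM (ger0_norm (x := _^-1)) ?invr_ge0// ler_pM2r ?invr_gt0 ?ltr0n//.
  by rewrite ger0_norm ?subr_ge0// lerBlDl natr1 ltW.
by move=> H; exact: (cvg_comp _ _ H (cG _ _)).
Qed.
End ProcessMeasurability.

Section ItoProcess.
Context {d : measure_display} {T : measurableType d} {R : realType}.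
Variables (P : probability T R) (n : nat) (W : R -> T -> 'cV[R]_n).
Hypothesis bW : brownian_motion P W.
Local Notation F := (brownian_filtration P W).
Local Notation leb := (@lebesgue_measure R).
Local Notation mu := (leb \x P)%E.

(* Processes are extended to negative times by their value at time 0. *)
Definition regular_process (c : R -> T -> R) : Prop :=
  [/\ forall w, continuous (c^~ w), forall s w, c s w = c (Num.max 0 s) w,
      forall t, 0 <= t -> measurable_wrt (F t) (c t) &
      exists K, forall s w, `|c s w| <= K].

Lemma regular_process_measurable c : regular_process c ->
  measurable_fun setT (fun z : R * T => c z.1 z.2).
Proof.
move=> [cc c0 mc _]; apply: measurable_process => // s s0.
exact: (measurable_wrt_measurable bW (mc _ s0)).
Qed.

Lemma regular_process_adapted c t : regular_process c -> 0 <= t ->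
  bounded_adapted P W t (c t).
Proof. by move=> [_ _ mc [K cK]] t0; split; [exact: mc|exists K]. Qed.

Lemma sqnorm_product (K : R * T -> R) : measurable_fun setT K ->
  sqnorm mu K = (\int[P]_w \int[leb]_s (K (s, w) ^+ 2)%:E)%E.
Proof.
move=> mK; rewrite /sqnorm fubini_tonelli2//; first exact: measurable_sqr.
by move=> z; rewrite lee_fin sqr_ge0.
Qed.

(** The approximating simple processes vanish off []0, u]], so they approximate the integrand cut to
    that interval on the whole line. The jointly measurable [c] replaces [H], about which nothing is
    known at negative times. *)
Lemma ito_of_is_ito_integral (j : 'I_n) (H c : R -> T -> R) (u : R) (J : T -> R) :
  0 <= u -> measurable_fun setT (fun z : R * T => c z.1 z.2) ->
  (forall s w, 0 <= s -> c s w = H s w) ->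
  is_ito_integral P F (fun s w => W s w j 0) H u J ->
  ito P W j (fun z => c z.1 z.2 * \1_(`]0, u]) z.1) J.
Proof.
move=> u0 mc cH [mJ [m [t [xi [sd cvK cvJ]]]]].
have m0 : measurable_fun setT (fun z : R * T => (\1_(`]0, u]) z.1 : R)).
  by apply: measurableT_comp.
split=> //; first exact: measurable_funM.
move=> e e0; have e0' : (0%:E < e%:E :> \bar R)%E by rewrite lte_fin.
have [r [h1 h2]] : exists r,
  ((\int[P]_w \int[leb]_(s in `[0%R, u])
     ((simple_process (m r) (t r) (xi r) s w - H s w) ^+ 2)%:E)%E < e%:E)%E /\
  ((\int[P]_w ((simple_integral (m r) (t r) (xi r) (fun s w => W s w j 0) w
     - J w) ^+ 2)%:E)%E < e%:E)%E.
  have H1 := cvK _ (open_ereal_lt' e0').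
  have H2 := cvJ _ (open_ereal_lt' e0').
  case: H1 H2 => [r1 _ h1] [r2 _ h2]; exists (maxn r1 r2).
  by split; [apply: h1; exact: leq_maxl|apply: h2; exact: leq_maxr].
have [t0 tm tmono sadapt] := sd r.
have tu i : (i <= m r)%N -> t r i <= u by move=> im; rewrite -tm tmono.
have tge0 i : 0 <= t r i by rewrite -t0 tmono.
exists 'I_(m r), (fun i : 'I_(m r) => t r i), (fun i : 'I_(m r) => t r i.+1),
  (fun i : 'I_(m r) => xi r i).
have Hel : elementary P W (fun i : 'I_(m r) => t r i) (fun i => t r i.+1)
    (fun i => xi r i).
  by move=> i; split => //; [exact: tmono|exact: sadapt].
split=> //; last first.
  by apply: le_trans (ltW h2).
apply: le_trans (ltW h1).
have mE := elementary_process_measurable bW Hel.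
set E := elementary_process _ _ _ in mE *.
pose D (z : R * T) := E z - c z.1 z.2.
have mD : measurable_fun setT D by exact: measurable_funB.
have mI : measurable_fun setT (fun z : R * T => (\1_(`[0, u]) z.1 : R)).
  by apply: measurableT_comp.
have hD w : (\int[leb]_(s in `[0%R, u])
    ((simple_process (m r) (t r) (xi r) s w - H s w) ^+ 2)%:E =
    \int[leb]_s ((D (s, w) * \1_(`[0, u]) s) ^+ 2)%:E)%E.
  rewrite integral_mkcond; apply: eq_integral => s _; rewrite patchE.
  case: ifPn => [su|/negbTE su]; rewrite indicE su ?mulr0 ?expr0n//= mulr1.
  by rewrite /D /= cH//; move: su; rewrite inE/= in_itv/= => /andP[].
under [leRHS]eq_integral do rewrite hD.
rewrite -(sqnorm_product (K := fun z => D z * \1_(`[0, u]) z.1)); last first.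
  exact: measurable_funM.
apply: le_sqnorm.
- by apply: measurable_funB => //; exact: measurable_funM.
- exact: measurable_funM.
move=> z; rewrite /D !indicE.
have [zu|zu] := boolP (z.1 \in `]0, u]%classic).
  have zu' : z.1 \in `[0, u]%classic.
    by move: zu; rewrite !inE/= !in_itv/= => /andP[/ltW -> ->].
  by rewrite zu' !mulr1.
rewrite mulr0 subr0 (_ : E z = 0) ?normr0// /E /elementary_process big1// => i _.
rewrite indicE memNset ?mulr0//= in_itv/= => /andP[h3 h4].
move: zu; rewrite notin_setE/= in_itv/=; apply/negP/negPn.
by rewrite (le_lt_trans _ h3)//= (le_trans h4)// tu.
Qed.

Section discretization.
Variables (u : R) (c : R -> T -> R).
Hypotheses (u0 : 0 <= u) (rc : regular_process c).

(** The difference between [c] and its left-endpoint step function, written cell by cell so as to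
    vanish off []0, u]]. *)
Definition discretization_error (N : nat) (z : R * T) : R :=
  \sum_(m < N.+1) (c z.1 z.2 - c (grid u N m) z.2) * cell u N m z.1.

Lemma discretization_error_measurable N :
  measurable_fun setT (discretization_error N).
Proof.
apply: measurable_sum => m; apply: measurable_funM; last first.
  by apply: measurableT_comp; [exact: measurable_cell|].
apply: measurable_funB; first exact: regular_process_measurable.
apply: measurableT_comp => //; apply: (measurable_wrt_measurable bW).
by case: rc => _ _ mc _; apply: mc; exact: grid_ge0.
Qed.

(** Dominated convergence: the error tends to 0 pointwise by continuity of the paths, and its square
    is at most [(2 * K) ^+ 2] on []0, u]]. *)
Lemma discretization_error_cvg e : 0 < e -> exists N0, forall N, (N0 <= N)%N ->
  (sqnorm mu (discretization_error N) <= e%:E)%E.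
Proof.
move=> e0; case: (rc) => cc _ _ [K cK].
have K0 : 0 <= K.
  apply: contrapT => /negP; rewrite -ltNge => K0.
  have [w _] : [set: T] !=set0.
    by exists point.
  by have := le_lt_trans (le_trans (normr_ge0 _) (cK 0 w)) K0; rewrite ltxx.
pose f N z := ((discretization_error N z) ^+ 2)%:E.
(* The indicator is squared to match [integral_indic_overlap], which computes its integral. *)
pose g (z : R * T) : \bar R := ((2 * K) ^+ 2 * (\1_(`]0, u]) z.1 * \1_(`]0, u]) z.1))%:E.
have sumE N z m0 : (forall m, m != m0 -> cell u N m z.1 = 0) ->
    discretization_error N z = 0 \/
    [/\ cell u N m0 z.1 != 0, (m0 < N.+1)%N &
      discretization_error N z = c z.1 z.2 - c (grid u N m0) z.2].
  move=> H; rewrite /discretization_error.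
  have [m0N|Nm0] := ltnP m0 N.+1; last first.
    left; rewrite big1// => m _; rewrite H ?mulr0//.
    by rewrite neq_ltn (leq_trans (ltn_ord m)).
  rewrite (bigD1 (Ordinal m0N))//= big1 ?addr0; last first.
    by move=> m mm0; rewrite H ?mulr0.
  have [->|c1] := eqVneq (cell u N m0 z.1) 0; first by left; rewrite mulr0.
  right; split => //; rewrite (_ : cell _ _ _ _ = 1) ?mulr1//.
  by move: c1; rewrite /cell indicE pnatr_eq0; case: (_ \in _).
have mf N : measurable_fun setT (f N).
  by apply: measurable_sqr; exact: discretization_error_measurable.
have mg : measurable_fun setT g.
  apply/measurable_EFinP; apply: measurable_funM => //.
  by apply: measurable_funM; apply: measurableT_comp.
have ff z : f^~ z @ \oo --> 0%E.
  apply/fine_cvgP; split; first by near=> N.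
  apply/cvgrPdist_lt => r r0.
  (* A difference below both 1 and [r] has its square below [r]. *)
  have /cvgrPdist_lt/(_ (Num.min 1 r)) := cc z.2 z.1.
  rewrite lt_min ltr01 r0 => /(_ isT)/nbhs_ballP[del /= del0 Hdel].
  have [N0 HN0] := grid_mesh u0 del0.
  exists N0 => // N /= /HN0 hN; rewrite sub0r normrN ger0_norm ?sqr_ge0//.
  have [m0 Hm0] := cell_unique u0 N z.1.
  case: (sumE N z m0 Hm0) => [->|[c1 _ ->]]; first by rewrite expr0n.
  have := Hdel (grid u N m0); rewrite /ball /= => /(_ _) h.
  have {h} : `|c z.1 z.2 - c (grid u N m0) z.2| < Num.min 1 r.
    by apply: h; exact: le_lt_trans (cell_near c1) hN.
  rewrite lt_min => /andP[h1 h2]; rewrite -real_normK ?num_real//.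
  by apply: le_lt_trans h2; rewrite expr2 ler_piMl// ltW.
have fg N z : (`|f N z| <= g z)%E.
  rewrite gee0_abs ?lee_fin ?sqr_ge0//.
  have g0 : 0 <= (2 * K) ^+ 2 * (\1_(`]0, u]) z.1 * \1_(`]0, u]) z.1).
    by rewrite mulr_ge0 ?sqr_ge0// mulr_ge0// indicE.
  have [m0 Hm0] := cell_unique u0 N z.1.
  case: (sumE N z m0 Hm0) => [->|[c1 m0N ->]]; first by rewrite expr0n.
  have -> : \1_(`]0, u]) z.1 = 1 :> R.
    rewrite indicE mem_set//=; move: c1; rewrite /cell indicE pnatr_eq0 eqb0 negbK.
    rewrite inE/= !in_itv/= => /andP[h1 h2].
    by rewrite (le_lt_trans (grid_ge0 u0 N m0) h1) (le_trans h2)// grid_le.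
  rewrite !mulr1 -real_normK ?num_real// lerXn2r ?nnegrE ?mulr_ge0//.
  by rewrite (le_trans (ler_normB _ _))// mulr_natl mulr2n lerD.
have ig : mu.-integrable setT g.
  apply/integrableP; split => //; rewrite fubini_tonelli2//; last first.
    exact: measurableT_comp.
  rewrite /fubini_G /g /=.
  under eq_integral => w _.
    under eq_integral => s _.
      rewrite ger0_norm; last by rewrite mulr_ge0 ?sqr_ge0// mulr_ge0// indicE.
      over.
    rewrite (proj2 (integral_indic_overlap _ _ _ _ _)).
    over.
  by rewrite integral_cst//= probability_setT mule1 ltry.
have [_ _] := @dominated_convergence _ _ R mu setT measurableT f (cst 0%E) g mf
  (measurable_cst 0%E) (aeW mu (fun z _ => ff z)) ig (aeW mu (fun z N _ => fg N z)).
rewrite integral0 => H.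
have e0' : (0%:E < e%:E :> \bar R)%E by rewrite lte_fin.
have [N0 _ HN0] := H _ (open_ereal_lt' e0').
by exists N0 => N NN; apply: ltW; exact: HN0.
Unshelve. all: by end_near.
Qed.
End discretization.
End ItoProcess.

(** * Quadratic variation along grids *)

Section Vanishing.
Context {R : realType}.
Implicit Types a b : nat -> \bar R.

(** Convergence to 0 for sequences that are nonnegative wherever this is applied; the one-sided form
    avoids limits in the extended reals. *)
Definition vanishing a : Prop := forall e : R, 0 < e ->
  exists N0, forall N, (N0 <= N)%N -> (a N <= e%:E)%E.

Lemma vanishing_le a b : (forall N, (a N <= b N)%E) -> vanishing b -> vanishing a.
Proof.
move=> ab vb e e0; have [N0 H] := vb e e0.
by exists N0 => N /H; exact: le_trans.
Qed.

Lemma vanishingD a b : vanishing a -> vanishing b ->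
  vanishing (fun N => a N + b N)%E.
Proof.
move=> va vb e e0; have e2 : 0 < e / 2 by rewrite divr_gt0.
have [N1 H1] := va _ e2; have [N2 H2] := vb _ e2.
exists (maxn N1 N2) => N; rewrite geq_max => /andP[/H1 h1 /H2 h2].
by rewrite (splitr e) EFinD leeD.
Qed.

Lemma vanishingZ (C : R) a : 0 <= C -> vanishing a ->
  vanishing (fun N => C%:E * a N)%E.
Proof.
move=> C0 va e e0; have d0 : 0 < e / (C + 1) by rewrite divr_gt0// ltr_wpDl.
have [N0 H] := va _ d0; exists N0 => N /H h.
apply: (@le_trans _ _ (C%:E * (e / (C + 1))%:E)%E); first by rewrite lee_wpmul2l.
rewrite -EFinM lee_fin mulrA ler_pdivrMr ?ltr_wpDl// mulrC ler_pM2l// lerDl.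
by [].
Qed.

Lemma vanishing0 : vanishing (fun=> 0%E).
Proof. by move=> e e0; exists 0%N => N _; rewrite lee_fin ltW. Qed.

Lemma vanishing_sum (I : Type) (r : seq I) (a : I -> nat -> \bar R) :
  (forall i, vanishing (a i)) -> vanishing (fun N => \sum_(i <- r) a i N)%E.
Proof.
move=> va; elim: r => [|i r IH].
  by under eq_fun do rewrite big_nil; exact: vanishing0.
by under eq_fun do rewrite big_cons; exact: vanishingD.
Qed.

Lemma vanishing_harmonic (C : R) : 0 <= C ->
  vanishing (fun N => (C / N.+1%:R)%:E).
Proof.
move=> C0 e e0; have [N0 H] := grid_mesh C0 e0.
by exists N0 => N /H h; rewrite lee_fin ltW.
Qed.

End Vanishing.

(** The Cauchy-Schwarz inequality for a finite sum, obtained from 2 a b <= a^2 + b^2. *)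
Lemma sqnorm_sum {d : measure_display} {S : measurableType d} {R : realType}
    (m : {measure set S -> \bar R}) (I : finType) (f : I -> S -> R) :
  (forall i, measurable_fun setT (f i)) ->
  (sqnorm m (fun z => \sum_i f i z)%R <=
   #|I|%:R%:E * \sum_i sqnorm m (f i))%E.
Proof.
move=> mf; rewrite -ge0_integral_sum//; last 2 first.
- by move=> i; exact: measurable_sqr.
- by move=> i z _; rewrite lee_fin sqr_ge0.
rewrite -ge0_integralZl//; last 2 first.
- by apply: emeasurable_sum => i; exact: measurable_sqr.
- by move=> z _; apply: sume_ge0 => i _; rewrite lee_fin sqr_ge0.
apply: ge0_le_integral => //.
- by move=> z _; rewrite lee_fin sqr_ge0.
- by apply: measurable_sqr; exact: measurable_sum.
- apply: emeasurable_funM => //.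
  by apply: emeasurable_sum => i; exact: measurable_sqr.
move=> z _; rewrite sumEFin -EFinM lee_fin.
rewrite expr2 big_distrlr/=.
have h i j : f i z * f j z <= (f i z ^+ 2 + f j z ^+ 2) / 2.
  by have := sqr_ge0 (f i z - f j z); rewrite sqrrB; lra.
apply: (@le_trans _ _ (\sum_i \sum_j (f i z ^+ 2 + f j z ^+ 2) / 2)).
  by apply: ler_sum => i _; apply: ler_sum => j _.
rewrite (eq_bigr (fun i => (#|I|%:R * f i z ^+ 2 + \sum_j f j z ^+ 2) / 2)).
  rewrite -mulr_suml big_split/= -mulr_sumr sumr_const.
  by rewrite -[X in _ + X]mulr_natl ler_pdivrMr// mulr_natr mulr2n.
by move=> i _; rewrite -mulr_suml big_split/= sumr_const mulr_natl.
Qed.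

Section GridSingle.
Context {R : realType}.
Variable (u : R).
Hypothesis u0 : 0 <= u.

(** A sum over cells has at most one non-zero term, and the same [m0] serves every [f]; sums with
    different weights can thus be compared or squared at a fixed time. *)
Lemma cell_sum_single N s : (forall f : nat -> R,
    \sum_(m < N.+1) f m * cell u N m s = 0) \/
  exists2 m0, (m0 < N.+1)%N &
    forall f : nat -> R, \sum_(m < N.+1) f m * cell u N m s = f m0.
Proof.
have [m0 H] := cell_unique u0 N s.
have [m0N|Nm0] := ltnP m0 N.+1; last first.
  left => f; rewrite big1// => m _; rewrite H ?mulr0//.
  by rewrite neq_ltn (leq_trans (ltn_ord m)).
have E (f : nat -> R) : \sum_(m < N.+1) f m * cell u N m s = f m0 * cell u N m0 s.
  rewrite (bigD1 (Ordinal m0N))//= big1 ?addr0// => m mm0.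
  by rewrite H ?mulr0.
have [c0|c1] := eqVneq (cell u N m0 s) 0; [left|right; exists m0] => // f.
  by rewrite E c0 mulr0.
rewrite E (_ : cell _ _ _ _ = 1) ?mulr1//.
by move: c1; rewrite /cell indicE pnatr_eq0; case: (_ \in _).
Qed.
End GridSingle.

(** * Residuals of the Euler scheme and of quadratic covariation *)

Section StochasticErrors.
Context {d : measure_display} {T : measurableType d} {R : realType}.
Variables (P : probability T R) (n : nat) (W : R -> T -> 'cV[R]_n).
Hypothesis bW : brownian_motion P W.
Local Notation F := (brownian_filtration P W).
Local Notation leb := (@lebesgue_measure R).
Local Notation mu := (leb \x P)%E.
Variable u : R.
Hypothesis u0 : 0 <= u.
Local Notation grid := (grid u).

Section one_integral.
Variables (l : 'I_n) (c M : R -> T -> R).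
Hypothesis rc : regular_process P W c.
Hypothesis HM : forall t, 0 <= t <= u ->
  ito P W l (fun z => c z.1 z.2 * \1_(`]0, t]) z.1) (M t).

Definition euler_residual (N m : nat) (w : T) : R :=
  M (grid N m.+1) w - M (grid N m) w -
  c (grid N m) w * increment W l (grid N m) (grid N m.+1) w.

(** By linearity: the increment of [M] over a cell is the integral of [c] against the difference of
    two indicators [\1_(]0, t])], which is the indicator of the cell. *)
Lemma ito_euler_residual N m : (m < N.+1)%N ->
  ito P W l (fun z => (c z.1 z.2 - c (grid N m) z.2) * cell u N m z.1)
    (euler_residual N m).
Proof.
move=> mN.
have h1 : 0 <= grid N m.+1 <= u by rewrite grid_ge0// grid_le.
have h2 : 0 <= grid N m <= u by rewrite grid_ge0// grid_le// ltnW.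
have bc : bounded_adapted P W (grid N m) (c (grid N m)).
  by apply: regular_process_adapted => //; exact: grid_ge0.
have := itoD bW (itoD bW (HM h1) (itoN (HM h2)))
  (itoN (ito_base bW l (grid_ge0 u0 N m) (grid_mono u0 N (leqnSn m)) bc)).
congr ito; apply/funext => z.
by rewrite -!(cell_sum u0) big_ord_recr/= /cell; ring.
Qed.

(** Each weight is known at the left end of its cell, so the whole weighted sum is a single Ito
    integral, and the isometry is used once. Bounding the terms separately would lose a factor
    [N.+1]. *)
Lemma euler_residual_weighted N (phi : nat -> T -> R) (B : R) : 0 <= B ->
  (forall m, (m < N.+1)%N -> bounded_adapted P W (grid N m) (phi m)) ->
  (forall m w, `|phi m w| <= B) ->
  (sqnorm P (fun w => \sum_(m < N.+1) phi m w * euler_residual N m w)%R <=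
   (4 * B ^+ 2)%:E * sqnorm mu (discretization_error u c N))%E.
Proof.
move=> B0 bphi phiB.
have It : ito P W l (fun z => \sum_(m < N.+1) phi m z.2 *
    ((c z.1 z.2 - c (grid N m) z.2) * cell u N m z.1))
    (fun w => \sum_(m < N.+1) phi m w * euler_residual N m w).
  apply: ito_sum => // m.
  apply: (ito_adaptedM bW (grid_ge0 u0 N m)) => //; first exact: bphi.
    move=> z zm; rewrite /cell indicE memNset ?mulr0//= in_itv/=.
    by move=> /andP[/lt_le_trans/(_ zm)]; rewrite ltxx.
  exact: ito_euler_residual.
apply: (le_trans (ito_isometry bW It)).
rewrite EFinM -muleA lee_wpmul2l// -sqnormZ; last first.
  exact: (discretization_error_measurable bW u0 rc).
case: It => mK _ _; apply: le_sqnorm => //.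
  by apply: measurable_funM => //; exact: (discretization_error_measurable bW u0 rc).
move=> z; rewrite /discretization_error.
have [H|[m0 m0N H]] := cell_sum_single u0 N z.1.
  under eq_bigr do rewrite mulrA.
  by rewrite (H (fun m => phi m z.2 * (c z.1 z.2 - c (grid N m) z.2))) normr0.
under eq_bigr do rewrite mulrA.
rewrite (H (fun m => phi m z.2 * (c z.1 z.2 - c (grid N m) z.2))).
rewrite (H (fun m => c z.1 z.2 - c (grid N m) z.2)) !normrM ler_wpM2r//.
by rewrite (ger0_norm B0).
Qed.

Lemma euler_residual_measurable N m : (m < N.+1)%N ->
  measurable_fun setT (euler_residual N m).
Proof. by move=> /ito_euler_residual[]. Qed.

(** The cells are disjoint, so the squares of the integrands on the cells add up to the square of
    the discretization error. *)
Lemma euler_residual_square_sum N :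
  (\sum_(m < N.+1) sqnorm P (euler_residual N m) <=
   4%:E * sqnorm mu (discretization_error u c N))%E.
Proof.
apply: (@le_trans _ _ (\sum_(m < N.+1) 4%:E * sqnorm mu (fun z =>
    (c z.1 z.2 - c (grid N m) z.2) * cell u N m z.1)%R)%E).
  by apply: lee_sum => m _; apply: (ito_isometry bW); exact: ito_euler_residual.
have mK (m : 'I_N.+1) : measurable_fun setT (fun z : R * T =>
    (c z.1 z.2 - c (grid N m) z.2) * cell u N m z.1).
  by case: (ito_euler_residual (ltn_ord m)).
rewrite -ge0_sume_distrr//; last by move=> m _; exact: sqnorm_ge0.
rewrite lee_wpmul2l// -ge0_integral_sum//; last 2 first.
- by move=> m; exact: (measurable_sqr (mK m)).
- by move=> m z _; rewrite lee_fin sqr_ge0.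
apply: ge0_le_integral => //.
- by move=> z _; apply: sume_ge0 => m _; rewrite lee_fin sqr_ge0.
- by apply: emeasurable_sum => m; exact: (measurable_sqr (mK m)).
- by apply: measurable_sqr; exact: (discretization_error_measurable bW u0 rc).
move=> z _; rewrite sumEFin lee_fin /discretization_error.
have E (m : 'I_N.+1) : ((c z.1 z.2 - c (grid N m) z.2) * cell u N m z.1) ^+ 2 =
    (c z.1 z.2 - c (grid N m) z.2) ^+ 2 * cell u N m z.1.
  rewrite exprMn; congr (_ * _); rewrite /cell indicE.
  by case: (_ \in _); rewrite ?expr1n ?expr0n.
under eq_bigr do rewrite E.
have [H|[m0 m0N H]] := cell_sum_single u0 N z.1.
  by rewrite (H (fun m => (c z.1 z.2 - c (grid N m) z.2) ^+ 2)) sqr_ge0.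
rewrite (H (fun m => (c z.1 z.2 - c (grid N m) z.2) ^+ 2)).
by rewrite (H (fun m => c z.1 z.2 - c (grid N m) z.2)).
Qed.

End one_integral.

Section quadratic_variation.
Variables (l p : 'I_n) (N : nat) (phi : nat -> T -> R) (B : R).
Hypothesis B0 : 0 <= B.
Hypothesis bphi : forall m, bounded_adapted P W (grid N m) (phi m).
Hypothesis phiB : forall m w, `|phi m w| <= B.
Let h := u / N.+1%:R.
Let h0 : 0 <= h. Proof. by rewrite divr_ge0. Qed.
Let g0 m : 0 <= grid N m := grid_ge0 u0 N m.
Let gS m : grid N m <= grid N m.+1 := grid_mono u0 N (leqnSn m).

(** Centred: [(l == p)%:R * h] is the mean of the product of the two increments. *)
Definition covariation_residual (m : nat) (w : T) : R :=
  increment W l (grid N m) (grid N m.+1) w *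
  increment W p (grid N m) (grid N m.+1) w - (l == p)%:R * h.

Let Y := covariation_residual.

Let Yadapted m :
  measurable_wrt <<s increment_events W (grid N m) (grid N m.+1) >> (Y m).
Proof.
apply: measurable_wrtB; last exact: measurable_wrt_cst.
by apply: measurable_wrtM; exact: increment_wrt.
Qed.

Let mY m : measurable_fun setT (Y m).
Proof.
by apply: measurable_funB => //; apply: measurable_funM;
  apply: (increment_measurable bW).
Qed.

Let Ybound m w : Y m w ^+ 2 <=
  (increment W l (grid N m) (grid N m.+1) w ^+ 4 +
   increment W p (grid N m) (grid N m.+1) w ^+ 4) + 2 * h ^+ 2.
Proof.
rewrite /Y /covariation_residual.
set x := increment _ _ _ _ _; set y := increment _ _ _ _ _.
have xy : 2 * (x * y) ^+ 2 <= x ^+ 4 + y ^+ 4.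
  have := sqr_ge0 (x ^+ 2 - y ^+ 2); rewrite sqrrB -!exprM exprMn; lra.
have hh : ((l == p)%:R * h) ^+ 2 <= h ^+ 2.
  by case: (l == p); rewrite ?mul1r// mul0r expr0n sqr_ge0.
have := sqr_ge0 (x * y + (l == p)%:R * h).
rewrite sqrrD sqrrB; lra.
Qed.

Let L4 j m : L1 P (fun w => increment W j (grid N m) (grid N m.+1) w ^+ 4).
Proof.
have [_] := increment_L2_sqr bW j (g0 m) (gS m).
by under eq_fun do rewrite -exprM.
Qed.

Let LB m : L1 P (fun w =>
  (increment W l (grid N m) (grid N m.+1) w ^+ 4 +
   increment W p (grid N m) (grid N m.+1) w ^+ 4) + 2 * h ^+ 2).
Proof. by apply: L1D; [exact: L1D|exact: L1_cst]. Qed.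

Let LY m : L2 P (Y m).
Proof.
split=> //; apply: L1_le (LB m) => [|w]; first exact: measurable_funX.
by rewrite ger0_norm ?sqr_ge0.
Qed.

Let EY2 m : mean P (fun w => Y m w ^+ 2) <= 194 * h ^+ 2.
Proof.
apply: (le_trans (le_mean _ (LB m) (Ybound m))); first by case: (LY m).
rewrite !meanD ?mean_cst//; [|exact: L1D|exact: L1_cst].
have := increment_fourth_moment bW l (g0 m) (gS m).
have := increment_fourth_moment bW p (g0 m) (gS m).
rewrite grid_step -/h => *; lra.
Qed.

Let EY m : mean P (Y m) = 0.
Proof.
have LD : L1 P (fun w => increment W l (grid N m) (grid N m.+1) w *
    increment W p (grid N m) (grid N m.+1) w).
  by apply: L2M; exact: increment_L2.
rewrite /Y /covariation_residual meanB//; last exact: L1_cst.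
rewrite mean_cst; have [<-|lp] := eqVneq l p.
  under eq_fun do rewrite -expr2.
  by rewrite increment_second_moment// grid_step mul1r subrr.
by rewrite mean_increment_cross// mul0r subrr.
Qed.

(** The partial sums are a martingale: each new residual is centred and independent of the past, so
    second moments add. Each step contributes at most [194 * B ^+ 2 * h ^+ 2], where 194 is 96 + 96
    from the fourth moments plus 2 from the centring. Over [N.+1] steps of length u / (N + 1) the
    total is of order 1 / (N + 1). *)
Lemma covariation_vanish M :
  L2 P (fun w => \sum_(m < M) phi m w * Y m w) /\
  mean P (fun w => (\sum_(m < M) phi m w * Y m w) ^+ 2) <=
  M%:R * (194 * B ^+ 2 * h ^+ 2).
Proof.
elim: M => [|M [LQ EQ]].
  under eq_fun do rewrite big_ord0.
  under [X in _ /\ mean _ X <= _]eq_fun do rewrite big_ord0 expr0n/=.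
  by rewrite mean_cst mul0r lexx; split => //; exact: L2_cst.
pose Q w := \sum_(m < M) phi m w * Y m w.
have mQ : measurable_wrt (F (grid N M)) Q.
  apply: measurable_wrt_sum => m; apply: measurable_wrtM.
    by apply: (measurable_wrt_sub (filtration_mono _)) (proj1 (bphi m)); apply: grid_mono => //; exact: ltnW.
  apply: measurable_wrtB; last exact: measurable_wrt_cst.
  have gm : grid N m <= grid N M by apply: grid_mono => //; exact: ltnW.
  have gm1 : grid N m.+1 <= grid N M by exact: grid_mono.
  by apply: measurable_wrtM; apply: increment_filtration; rewrite ?g0.
have LfY := bounded_adapted_L2 bW (bphi M) (LY M).
have E : (fun w => (\sum_(m < M.+1) phi m w * Y m w) ^+ 2) =
    fun w => Q w ^+ 2 + 2 * ((Q w * phi M w) * Y M w) + (phi M w * Y M w) ^+ 2.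
  by apply/funext => w; rewrite big_ord_recr/= /Q; ring.
have EL : (fun w => \sum_(m < M.+1) phi m w * Y m w) =
    fun w => Q w + phi M w * Y M w.
  by apply/funext => w; rewrite big_ord_recr.
rewrite E EL; split; first exact: L2D.
have [mphi [K phiK]] := bphi M.
have LQf : L1 P (fun w => Q w * phi M w).
  have := L2_L1 (bounded_adapted_L2 bW (bphi M) LQ).
  by under eq_fun do rewrite mulrC.
have mQf : measurable_wrt (F (grid N M)) (fun w => Q w * phi M w).
  exact: measurable_wrtM.
have [Lcr Ecr] := mean_increment_indep bW (g0 M) (gS M) mQf (@Yadapted M) LQf (L2_L1 (LY M)).
have LQ2 : L1 P (fun w => Q w ^+ 2) by case: LQ.
have Lf2 : L1 P (fun w => (phi M w * Y M w) ^+ 2) by case: LfY.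
rewrite !meanD//; [|exact: L1Z|by apply: L1D => //; exact: L1Z].
rewrite meanZ// Ecr EY mulr0 mulr0 addr0 -natr1 mulrDl mul1r lerD//.
apply: (@le_trans _ _ (B ^+ 2 * mean P (fun w => Y M w ^+ 2))).
  have LY2 : L1 P (fun w => Y M w ^+ 2) by case: (LY M).
  rewrite -meanZ//; apply: le_mean => //; first exact: L1Z.
  move=> w; rewrite exprMn ler_wpM2r ?sqr_ge0// -real_normK ?num_real//.
  by rewrite lerXn2r ?nnegrE.
rewrite (_ : 194 * B ^+ 2 * h ^+ 2 = B ^+ 2 * (194 * h ^+ 2)); last by ring.
by rewrite ler_wpM2l ?sqr_ge0.
Qed.

End quadratic_variation.

Section log_errors.
Variables (c M : 'I_n -> R -> T -> R) (g : R -> T -> R).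
Hypothesis rc : forall l, regular_process P W (c l).
Hypothesis HM : forall l t, 0 <= t <= u ->
  ito P W l (fun z => c l z.1 z.2 * \1_(`]0, t]) z.1) (M l t).
Hypothesis rg : regular_process P W g.

Definition noise_increment (N m : nat) (w : T) : R :=
  \sum_l c l (grid N m) w * increment W l (grid N m) (grid N m.+1) w.

Definition total_residual (N m : nat) (w : T) : R :=
  \sum_l euler_residual l (c l) (M l) N m w.

(** The density in time of the quadratic variation of the martingale part. *)
Definition energy (s : R) (w : T) : R := \sum_l c l s w ^+ 2.

Definition weighted_residual (N : nat) (w : T) : R :=
  \sum_(m < N.+1) g (grid N m) w * total_residual N m w.

Definition residual_energy (N : nat) (w : T) : R :=
  \sum_(m < N.+1) total_residual N m w ^+ 2.

Definition quadratic_residual (N : nat) (w : T) : R :=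
  \sum_(m < N.+1) g (grid N m) w ^+ 2 *
    (noise_increment N m w ^+ 2 - energy (grid N m) w * (u / N.+1%:R)).

(** Gathers in one nonnegative variable the three remainders of the expansion of the logarithm, so
    that a single subsequence of grids controls them all. The outer two are squared to be estimated
    in L^2; the middle one is already quadratic. *)
Definition log_error (N : nat) (w : T) : R :=
  weighted_residual N w ^+ 2 + residual_energy N w + quadratic_residual N w ^+ 2.

Lemma residual_energy_ge0 N w : 0 <= residual_energy N w.
Proof. by apply: sumr_ge0 => m _; exact: sqr_ge0. Qed.

Lemma log_error_ge0 N w : 0 <= log_error N w.
Proof. by rewrite !addr_ge0 ?sqr_ge0 ?residual_energy_ge0. Qed.

Let gridm (f : R -> T -> R) N m : regular_process P W f ->
  measurable_fun setT (f (grid N m)).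
Proof.
move=> rf; have [mf _] := regular_process_adapted rf (grid_ge0 u0 N m).
exact: (measurable_wrt_measurable bW mf).
Qed.

Let total_residual_measurable N (m : 'I_N.+1) :
  measurable_fun setT (total_residual N m).
Proof.
apply: measurable_sum => l.
exact: (euler_residual_measurable (rc l) (HM l)).
Qed.

Let weighted_measurable N : measurable_fun setT (weighted_residual N).
Proof. by apply: measurable_sum => m; apply: measurable_funM => //; exact: gridm. Qed.

Let energy_measurable N : measurable_fun setT (residual_energy N).
Proof. by apply: measurable_sum => m; exact: measurable_funX. Qed.

Let quadratic_measurable N : measurable_fun setT (quadratic_residual N).
Proof.
apply: measurable_sum => m; apply: measurable_funM.
  by apply: measurable_funX; exact: gridm.
apply: measurable_funB.
  apply: measurable_funX; apply: measurable_sum => l; apply: measurable_funM.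
    exact: gridm.
  by apply: (increment_measurable bW); exact: grid_ge0.
apply: measurable_funM => //; apply: measurable_sum => l.
by apply: measurable_funX; exact: gridm.
Qed.

Lemma log_error_measurable N : measurable_fun setT (log_error N).
Proof.
apply: measurable_funD; last exact: measurable_funX.
by apply: measurable_funD => //; exact: measurable_funX.
Qed.

Let disc_vanishing l :
  vanishing (fun N => sqnorm mu (discretization_error u (c l) N)).
Proof. by move=> e; exact: (discretization_error_cvg bW u0 (rc l)). Qed.

Let weighted_vanishing : vanishing (fun N => sqnorm P (weighted_residual N)).
Proof.
have [_ _ _ [B gB]] := rg.
have B0 : 0 <= `|B| by [].
have gB' m N w : `|g (grid N m) w| <= `|B| by exact: le_trans (gB _ _) (ler_norm _).
apply: (@vanishing_le _ _ (fun N => #|'I_n|%:R%:E * \sum_l (4 * `|B| ^+ 2)%:E *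
    sqnorm mu (discretization_error u (c l) N))%E); last first.
  apply: vanishingZ => //; apply: vanishing_sum => l.
  by apply: vanishingZ => //; rewrite mulr_ge0 ?sqr_ge0.
move=> N; pose f l w := \sum_(m < N.+1) g (grid N m) w *
  euler_residual l (c l) (M l) N m w.
have -> : weighted_residual N = fun w => \sum_l f l w.
  apply/funext => w; rewrite /f exchange_big/=; apply: eq_bigr => m _.
  by rewrite /total_residual mulr_sumr.
apply: (le_trans (sqnorm_sum _ _)).
  move=> l; apply: measurable_sum => m; apply: measurable_funM; first exact: gridm.
  exact: (euler_residual_measurable (rc l) (HM l)).
rewrite lee_wpmul2l//; apply: lee_sum => l _.
apply: (euler_residual_weighted (rc l) (HM l) (phi := fun m => g (grid N m))) => //.
by move=> m _; apply: regular_process_adapted => //; exact: grid_ge0.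
Qed.

Let energy_vanishing :
  vanishing (fun N => \int[P]_w (residual_energy N w)%:E)%E.
Proof.
apply: (@vanishing_le _ _ (fun N => #|'I_n|%:R%:E * \sum_l 4%:E *
    sqnorm mu (discretization_error u (c l) N))%E); last first.
  apply: vanishingZ => //; apply: vanishing_sum => l.
  exact: vanishingZ.
move=> N; under eq_integral do rewrite -sumEFin.
rewrite ge0_integral_sum//; last 2 first.
- by move=> m; exact: measurable_sqr.
- by move=> m w _; rewrite lee_fin sqr_ge0.
apply: (@le_trans _ _ (\sum_(m < N.+1) #|'I_n|%:R%:E * \sum_l
    sqnorm P (euler_residual l (c l) (M l) N m))%E).
  apply: lee_sum => m _; apply: sqnorm_sum => l.
  exact: (euler_residual_measurable (rc l) (HM l)).
rewrite -ge0_sume_distrr//; last first.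
  by move=> m _; apply: sume_ge0 => l _; exact: sqnorm_ge0.
rewrite lee_wpmul2l// exchange_big/=; apply: lee_sum => l _.
exact: (euler_residual_square_sum (rc l) (HM l)).
Qed.

(** The square of a noise increment is a double sum over pairs of coordinates; subtracting the
    energy times the step centres its diagonal, and every pair falls under [covariation_vanish]. *)
Let quadratic_vanishing : vanishing (fun N => sqnorm P (quadratic_residual N)).
Proof.
have [_ _ _ [B gB]] := rg.
have [K cK] : exists K, forall l s w, `|c l s w| <= K.
  have /choice[K cK] : forall l, exists K, forall s w, `|c l s w| <= K.
    by move=> l; case: (rc l).
  exists (\sum_l `|K l|) => l s w; apply: (le_trans (cK l s w)).
  by rewrite (le_trans (ler_norm _))// (bigD1 l)//= lerDl sumr_ge0.
pose C := `|B| ^+ 2 * (`|K| * `|K|).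
have C0 : 0 <= C by rewrite mulr_ge0 ?exprn_ge0 ?mulr_ge0.
pose V := 194 * C ^+ 2 * u ^+ 2.
have V0 : 0 <= V by rewrite !mulr_ge0 ?sqr_ge0.
apply: (@vanishing_le _ _ (fun N => #|{: 'I_n * 'I_n}|%:R%:E *
    \sum_(lp : 'I_n * 'I_n) (V / N.+1%:R)%:E)%E); last first.
  apply: vanishingZ => //; apply: vanishing_sum => lp.
  exact: vanishing_harmonic.
move=> N; pose phi (lp : 'I_n * 'I_n) m w :=
  g (grid N m) w ^+ 2 * (c lp.1 (grid N m) w * c lp.2 (grid N m) w).
have bphi lp m : bounded_adapted P W (grid N m) (phi lp m).
  have b1 := regular_process_adapted rg (grid_ge0 u0 N m).
  have b2 := regular_process_adapted (rc lp.1) (grid_ge0 u0 N m).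
  have b3 := regular_process_adapted (rc lp.2) (grid_ge0 u0 N m).
  exact: (bounded_adaptedM (bounded_adaptedM b1 b1) (bounded_adaptedM b2 b3)).
have phiC lp m w : `|phi lp m w| <= C.
  have gB' := le_trans (gB (grid N m) w) (ler_norm B).
  have c1 := le_trans (cK lp.1 (grid N m) w) (ler_norm K).
  have c2 := le_trans (cK lp.2 (grid N m) w) (ler_norm K).
  have h1 : `|g (grid N m) w ^+ 2| <= `|B| ^+ 2 by rewrite normrX lerXn2r ?nnegrE.
  have h2 : `|c lp.1 (grid N m) w * c lp.2 (grid N m) w| <= `|K| * `|K|.
    by rewrite normrM ler_pM.
  by rewrite /phi normrM ler_pM.
pose f (lp : 'I_n * 'I_n) w := \sum_(m < N.+1) phi lp m w *
  covariation_residual lp.1 lp.2 N m w.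
have H lp := covariation_vanish lp.1 lp.2 C0 (bphi lp) (phiC lp) N.+1.
have -> : quadratic_residual N = fun w => \sum_lp f lp w.
  apply/funext => w; rewrite /f exchange_big/=; apply: eq_bigr => m _.
  rewrite /phi; under [RHS]eq_bigr do rewrite -mulrA.
  rewrite -mulr_sumr; congr (_ * _).
  rewrite -(pair_bigA _ (fun l p => c l (grid N m) w * c p (grid N m) w *
    covariation_residual l p N m w))/=.
  rewrite /noise_increment expr2 big_distrlr/= /energy mulr_suml -sumrB.
  apply: eq_bigr => l _; rewrite /covariation_residual.
  under [RHS]eq_bigr do rewrite mulrBr.
  rewrite sumrB; congr (_ - _).
    by apply: eq_bigr => p _; ring.
  rewrite (bigD1 l)//= eqxx mul1r big1 ?addr0 ?expr2//.
  by move=> p pl; rewrite eq_sym (negbTE pl) mul0r mulr0.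
apply: (le_trans (sqnorm_sum _ _)); first by move=> lp; case: (H lp) => -[].
rewrite lee_wpmul2l//; apply: lee_sum => lp _.
have [[_ Lf] Ef] := H lp.
rewrite /sqnorm -meanE// lee_fin; apply: (le_trans Ef).
rewrite /V le_eqVlt; apply/orP; left; apply/eqP.
have : (N.+1%:R : R) != 0 by rewrite pnatr_eq0.
by move: (N.+1%:R : R) => q q0; field.
Qed.

Lemma log_error_vanishing : vanishing (fun N => \int[P]_w (log_error N w)%:E)%E.
Proof.
have E N : (\int[P]_w (log_error N w)%:E = sqnorm P (weighted_residual N) +
    \int[P]_w (residual_energy N w)%:E + sqnorm P (quadratic_residual N))%E.
  have m1 := measurable_sqr (weighted_measurable N).
  have m2 : measurable_fun setT (fun w => (residual_energy N w)%:E).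
    exact/measurable_EFinP.
  have m3 := measurable_sqr (quadratic_measurable N).
  have p1 w : (0 <= ((weighted_residual N w) ^+ 2)%:E)%E by rewrite lee_fin sqr_ge0.
  have p2 w : (0 <= (residual_energy N w)%:E)%E by rewrite lee_fin residual_energy_ge0.
  have p3 w : (0 <= ((quadratic_residual N w) ^+ 2)%:E)%E by rewrite lee_fin sqr_ge0.
  rewrite /sqnorm -ge0_integralD// -ge0_integralD//; first by move=> w _; exact: adde_ge0.
  exact: emeasurable_funD.
under [X in vanishing X]eq_fun do rewrite E.
by apply: vanishingD => //; exact: vanishingD.
Qed.

End log_errors.
End StochasticErrors.

(** * Ito's formula for the logarithm *)

Section Calculus.
Context {R : realType}.
Implicit Types f F : R -> R.

Lemma mean_value_bound f (df : R -> R) (a b K : R) : a <= b ->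
  (forall s, a <= s <= b -> is_derive s 1 f (df s)) ->
  (forall s, a <= s <= b -> `|df s| <= K) ->
  `|f b - f a| <= K * (b - a).
Proof.
move=> ab fd dfK.
have [||c cab ->] := @MVT_segment R f df a b ab.
- by move=> x; rewrite in_itv/= => /andP[/ltW h1 /ltW h2]; apply: fd; rewrite h1.
- apply: derivable_within_continuous => x; rewrite in_itv/= => hx.
  by have [] := fd x hx.
rewrite normrM (ger0_norm (x := b - a)) ?subr_ge0// ler_wpM2r ?subr_ge0//.
by apply: dfK; move: cab; rewrite in_itv.
Qed.

(** Heine-Cantor in a form where only [s] has to lie in [[0, u]]. *)
Lemma uniformly_continuous_on f (u e : R) : continuous f -> 0 < e ->
  exists2 eta, 0 < eta & forall s t, 0 <= s <= u -> `|s - t| < eta ->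
    `|f s - f t| < e.
Proof.
move=> cf e0.
have /compact_near_coveringP/(_ R (0^'+)
  (fun eta s => forall t, `|s - t| < eta -> `|f s - f t| < e)) := @segment_compact R 0 u.
move=> /(_ _) H.
have {}H : \forall eta \near 0^'+, `[0, u] `<=`
    (fun s => forall t, `|s - t| < eta -> `|f s - f t| < e).
  apply: H => s _.
  have e2 : 0 < e / 2 by rewrite divr_gt0.
  have /cvgrPdist_lt/(_ _ e2)/nbhs_ballP[r /= r0 Hr] := cf s.
  have r2 : 0 < r / 2 by rewrite divr_gt0.
  exists (ball s (r / 2), [set eta | eta < r / 2]).
    split; first exact: nbhsx_ballx.
    by near=> eta; rewrite /=; near: eta; exact: nbhs_right_lt.
  move=> [s' eta] /= [ss' etar] t s't.
  have h1 := Hr s' (le_ball _ ss').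
  have h2 : ball s r t.
    rewrite /ball/= (splitr r) -(subrK s' s) -addrA.
    by rewrite (le_lt_trans (ler_normD _ _))// ltrD// (lt_trans s't).
  have {}h1 := h1 ltac:(by rewrite ler_pdivrMr// mulrDr mulr1 lerDl ltW).
  have h3 := Hr t h2.
  rewrite (splitr e) -(subrK (f s) (f s')) -addrA.
  by rewrite (le_lt_trans (ler_normD _ _))// ltrD// distrC.
have [eta [eta0 Heta]] : exists eta, 0 < eta /\ `[0, u] `<=`
    (fun s => forall t, `|s - t| < eta -> `|f s - f t| < e).
  near (0 : R)^'+ => eta.
  exists eta; split; first by near: eta; exact: nbhs_right_gt.
  by near: eta.
by exists eta => // s t su; apply: Heta; rewrite /= in_itv.
Unshelve. all: by end_near.
Qed.

Lemma bounded_on f (u : R) : continuous f ->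
  exists2 K, 0 < K & forall s, 0 <= s <= u -> `|f s| <= K.
Proof.
move=> cf; have [u0|u0] := leP 0 u; last first.
  exists 1 => // s /andP[s0 su]; have := le_lt_trans (le_trans s0 su) u0.
  by rewrite ltxx.
have cg : continuous (fun s => `|f s|).
  by move=> s; apply: continuous_comp; [exact: cf|exact: norm_continuous].
have [c _ Hc] := EVT_max u0 (continuous_subspaceT cg).
exists (`|f c| + 1); first by rewrite ltr_pwDr.
by move=> s su; rewrite (le_trans (Hc s _))// ?lerDl// in_itv.
Qed.

(** Allows time integrals to be handled through antiderivatives, which are compared by their
    derivatives only. *)
Lemma antiderivative f : continuous f -> exists2 F : R -> R,
  forall t : R, 0 <= t -> is_derive t 1 F (f t) &
  forall t : R, 0 <= t -> (\int[lebesgue_measure]_(s in `[0, t]) f s)%R = F t - F 0.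
Proof.
(* Starting the integral at -1 makes 0 an interior point, so that [F] has a two-sided derivative
   there. *)
move=> cf; pose F (t : R) := (\int[lebesgue_measure]_(s in `[(-1)%R, t]) f s)%R.
have intf a b : lebesgue_measure.-integrable `[a, b] (EFin \o f).
  by apply: continuous_compact_integrable; [exact: segment_compact|
    exact: continuous_subspaceT].
have Fd (t : R) : 0 <= t -> is_derive t 1 F (f t).
  move=> t0; have t1 : t < t + 1 by rewrite ltrDl.
  have [D E] := continuous_FTC1_closed t1 (intf (-1) _)
    (lt_le_trans (ltrN10 R) t0) (cf t).
  by apply: DeriveDef; [exact: D|rewrite -derive1E].
exists F => // t; rewrite le_eqVlt => /orP[/eqP <-|t0].
  by rewrite subrr set_itv1 Rintegral_set1.
have cF : {within `[0, t], continuous F}.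
  apply: derivable_within_continuous => x; rewrite in_itv/= => /andP[x0 _].
  by case: (Fd x x0).
rewrite /Rintegral (@continuous_FTC2 _ f F 0 t)//.
- exact: continuous_subspaceT.
- split.
  + by move=> x; rewrite in_itv/= => /andP[/ltW x0 _]; case: (Fd x x0).
  + have := (continuous_within_itvP F t0).1 cF; by case.
  + have := (continuous_within_itvP F t0).1 cF; by case.
- move=> x; rewrite in_itv/= => /andP[/ltW x0 _]; rewrite derive1E.
  by case: (Fd x x0).
Qed.

(** The function [f], which interpolates between 0 and the remainder for s in [0, 1], has derivative
    x (x s)^2 / (1 + x s), and the denominator is at least 1 / 2. *)
Lemma ln_second_order (x : R) : `|x| <= 1 / 2 ->
  `|ln (1 + x) - x + x ^+ 2 / 2| <= 2 * `|x| ^+ 3.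
Proof.
move=> x2.
pose f (s : R) := ln (1 + x * s) - x * s + 2^-1 * (x * s) ^+ 2.
have sx (s : R) : 0 <= s <= 1 -> `|x * s| <= `|x| /\ 1 / 2 <= 1 + x * s.
  move=> /andP[s0 s1].
  have h : `|x * s| <= `|x| by rewrite normrM (ger0_norm s0) ler_piMr.
  by split=> //; have := le_trans h x2; rewrite ler_norml => /andP[? _]; lra.
pose df (s : R) := (x * s) ^+ 2 / (1 + x * s) * x.
have Hd (s : R) : 0 <= s <= 1 -> is_derive s 1 f (df s).
  move=> hs; have p : 0 < 1 + x * s by case: (sx s hs) => _ h; lra.
  have dm : is_derive s 1 (fun s : R => x * s) x.
    have := is_deriveZ x (is_derive_id s 1); rewrite scaler1.
    by [].
  have dl : is_derive s 1 (fun s : R => 1 + x * s) x.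
    by have := is_deriveD (is_derive_cst (1:R) s 1) dm; rewrite add0r.
  have d1 := is_derive1_comp (g := fun s => 1 + x * s) (is_derive1_ln p) dl.
  have d2 := is_deriveX 2 dm.
  have := is_deriveD (is_deriveB d1 dm) (is_deriveZ (2^-1) d2).
  move=> H; apply: (is_derive_eq H) => /=.
  rewrite /df /GRing.scale/= expr1.
  by field; rewrite gt_eqF.
have f0 : f 0 = 0 by rewrite /f mulr0 addr0 ln1 expr0n/= mulr0 subr0 addr0.
have := mean_value_bound (K := 2 * `|x| ^+ 3) ler01 Hd.
rewrite f0 subr0 subr0 mulr1 /f mulr1 (mulrC 2^-1); apply => s hs.
have [h1 h2] := sx s hs; have p : 0 < 1 + x * s by lra.
have -> : `|df s| = `|x * s| ^+ 2 / (1 + x * s) * `|x|.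
  by rewrite /df normrM (normrM (_ ^+ 2)) normfV normrX (gtr0_norm p).
rewrite (exprSr _ 2) mulrA ler_wpM2r// ler_pdivrMr// -mulrA.
have h3 : `|x * s| ^+ 2 <= `|x| ^+ 2 by rewrite lerXn2r ?nnegrE.
apply: (le_trans h3); rewrite mulrC -mulrA ler_peMr ?exprn_ge0//; lra.
Qed.
End Calculus.

Lemma cvg_seq_eq {R : realType} (f h : nat -> R) (l l' : R) :
  f k @[k --> \oo] --> l -> l = l' -> (forall k, f k = h k) ->
  h k @[k --> \oo] --> l'.
Proof. by move=> fl <- /funext <-. Qed.

Section GridLimits.
Context {R : realType}.
Variable u : R.
Hypothesis u0 : 0 <= u.
Local Notation grid := (grid u).

Lemma grid_in N m : (m <= N.+1)%N -> 0 <= grid N m <= u.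
Proof. by move=> mN; rewrite grid_ge0// grid_le. Qed.

Lemma cell_in N m (s : R) : (m < N.+1)%N -> grid N m <= s <= grid N m.+1 ->
  0 <= s <= u.
Proof.
move=> mN /andP[s1 s2]; have /andP[g0 _] := grid_in (ltnW mN).
by have /andP[_ g1] := grid_in mN; rewrite (le_trans g0 s1) (le_trans s2 g1).
Qed.

Lemma telescope_grid (f : R -> R) N :
  \sum_(m < N.+1) (f (grid N m.+1) - f (grid N m)) = f u - f 0.
Proof.
rewrite -(big_mkord xpredT (fun m => f (grid N m.+1) - f (grid N m))).
by rewrite telescope_sumr// grid_end grid0.
Qed.

Lemma sum_grid_const (c : R) N : \sum_(m < N.+1) c * (u / N.+1%:R) = c * u.
Proof.
by rewrite -mulr_sumr sumr_const card_ord -[X in _ * X]mulr_natr divfK// pnatr_eq0.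
Qed.

Lemma stieltjes_limit (phi f F Phi : R -> R) : continuous phi -> continuous f ->
  (forall t : R, 0 <= t -> is_derive t 1 F (f t)) ->
  (forall t : R, 0 <= t -> is_derive t 1 Phi (phi t * f t)) ->
  (\sum_(m < N.+1) phi (grid N m) * (F (grid N m.+1) - F (grid N m)))
    @[N --> \oo] --> Phi u - Phi 0.
Proof.
move=> cphi cf dF dPhi; apply/cvgrPdist_le => e e0.
have [K K0 fK] := bounded_on u cf.
(* [u + 1] in place of [u], which may be 0. *)
pose e' := e / (K * (u + 1)).
have u1 : 0 < u + 1 by rewrite ltr_wpDl.
have e'0 : 0 < e' by rewrite divr_gt0// mulr_gt0.
have [eta eta0 Heta] := uniformly_continuous_on u cphi e'0.
have [N0 HN0] := grid_mesh u0 eta0.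
exists N0 => // N /= /HN0 hN; rewrite -(telescope_grid _ N) -sumrB.
apply: (@le_trans _ _ (\sum_(m < N.+1) (e' * K) * (u / N.+1%:R))); last first.
  rewrite sum_grid_const /e' (_ : _ * K * u = e * u / (u + 1)); last first.
    by field; rewrite !gt_eqF.
  by rewrite ler_pdivrMr// ler_pM2l// lerDl.
apply: (le_trans (ler_norm_sum _ _ _)); apply: ler_sum => m _.
have gm := grid_in (ltnW (ltn_ord m)); have gm1 := grid_in (ltn_ord m).
have gg := grid_mono u0 N (leqnSn m).
pose f1 s := Phi s - phi (grid N m) * F s.
have -> : Phi (grid N m.+1) - Phi (grid N m) -
    phi (grid N m) * (F (grid N m.+1) - F (grid N m)) =
    f1 (grid N m.+1) - f1 (grid N m) by rewrite /f1; ring.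
rewrite -(grid_step u N m).
apply: (mean_value_bound (df := fun s => phi s * f s - phi (grid N m) * f s)) => //.
  move=> s /andP[s1 _]; have s0 : 0 <= s by case/andP: gm => /le_trans/(_ s1).
  exact: is_deriveB (dPhi _ s0) (is_deriveZ (phi (grid N m)) (dF _ s0)).
move=> s s12; have su := cell_in (ltn_ord m) s12; have /andP[s1 s2] := s12.
rewrite -mulrBl normrM ler_pM ?fK// ltW// distrC Heta//.
rewrite distrC ger0_norm ?subr_ge0//; apply: le_lt_trans hN.
by rewrite -(grid_step u N m) lerB.
Qed.

(** Cauchy-Schwarz, in the form 2 |a r| <= th a^2 + r^2 / th with a fixed small [th]. *)
Lemma cross_term_limit (N : nat -> nat) (a r : nat -> nat -> R) (Q : R) :
  (\sum_(m < (N k).+1) a k m ^+ 2) @[k --> \oo] --> Q ->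
  (\sum_(m < (N k).+1) r k m ^+ 2) @[k --> \oo] --> (0 : R) ->
  (\sum_(m < (N k).+1) a k m * r k m) @[k --> \oo] --> (0 : R).
Proof.
move=> aQ r0; apply/cvgrPdist_le => e e0.
pose B := `|Q| + 1; have B0 : 0 < B by rewrite ltr_pwDr.
pose th := e / B; have th0 : 0 < th by rewrite divr_gt0.
have /cvgrPdist_le/(_ _ ltr01) H1 := aQ.
have /cvgrPdist_le/(_ _ (mulr_gt0 th0 e0)) H2 := r0.
near=> k.
have h1 : `|Q - \sum_(m < (N k).+1) a k m ^+ 2| <= 1 by near: k.
have h2 : `|0 - \sum_(m < (N k).+1) r k m ^+ 2| <= th * e by near: k.
rewrite sub0r normrN; apply: (le_trans (ler_norm_sum _ _ _)).
have h3 : \sum_(m < (N k).+1) a k m ^+ 2 <= B.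
  have := ler_norm Q; move: h1; rewrite ler_norml /B => /andP[? ?] ?; lra.
rewrite sub0r normrN in h2; have {}h2 := le_trans (ler_norm _) h2.
apply: (@le_trans _ _ (\sum_(m < (N k).+1) (th * a k m ^+ 2 + th^-1 * r k m ^+ 2) / 2)).
  apply: ler_sum => m _; rewrite normrM.
  have := sqr_ge0 (th * `|a k m| - `|r k m|); rewrite sqrrB exprMn !real_normK ?num_real// => h.
  have : 0 <= th^-1 * (th ^+ 2 * a k m ^+ 2 - th * `|a k m| * `|r k m| *+ 2 + r k m ^+ 2).
    by rewrite mulr_ge0// invr_ge0 ltW.
  have -> : th^-1 * (th ^+ 2 * a k m ^+ 2 - th * `|a k m| * `|r k m| *+ 2 + r k m ^+ 2) =
    th * a k m ^+ 2 + th^-1 * r k m ^+ 2 - 2 * (`|a k m| * `|r k m|).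
    by field; rewrite gt_eqF.
  lra.
rewrite -mulr_suml big_split/= -!mulr_sumr.
have h4 : th * \sum_(m < (N k).+1) a k m ^+ 2 <= e.
  by rewrite -(divfK (lt0r_neq0 B0) e) -/th ler_pM2l.
have h5 : th^-1 * \sum_(m < (N k).+1) r k m ^+ 2 <= e.
  by rewrite mulrC ler_pdivrMr// mulrC.
lra.
Unshelve. all: by end_near.
Qed.

Lemma harmonic_limit (C : R) (N : nat -> nat) : N k @[k --> \oo] --> \oo ->
  (C / (N k).+1%:R) @[k --> \oo] --> (0 : R).
Proof.
move=> Noo; have H : (C / N.+1%:R) @[N --> \oo] --> (0 : R).
  rewrite -[X in _ --> X](mulr0 C); apply: cvgMr; exact: cvg_harmonic.
exact: (cvg_comp _ _ Noo H).
Qed.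

(** * Expansion of the logarithm along a single path *)

Section log.
Variables (Y b kappa g F Om Psi : R -> R) (G D : nat -> nat -> R) (N : nat -> nat).
Variable delta : R.
Hypotheses (cY : continuous Y) (cb : continuous b) (ck : continuous kappa).
Hypotheses (cg : continuous g) (d0 : 0 < delta).
Hypothesis Yd : forall s, 0 <= s <= u -> delta <= Y s.
Hypothesis gY : forall s, 0 <= s <= u -> g s = (Y s)^-1.
Hypothesis dF : forall t : R, 0 <= t -> is_derive t 1 F (b t).
Hypothesis dOm : forall t : R, 0 <= t -> is_derive t 1 Om (g t * b t).
Hypothesis dPsi : forall t : R, 0 <= t -> is_derive t 1 Psi (g t ^+ 2 * kappa t).
Hypothesis Noo : N k @[k --> \oo] --> \oo.
Hypothesis dY : forall k m, (m < (N k).+1)%N ->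
  Y (grid (N k) m.+1) - Y (grid (N k) m) =
  F (grid (N k) m.+1) - F (grid (N k) m) + G k m + D k m.
Hypothesis H1 :
  (\sum_(m < (N k).+1) g (grid (N k) m) * D k m) @[k --> \oo] --> (0 : R).
Hypothesis H2 : (\sum_(m < (N k).+1) D k m ^+ 2) @[k --> \oo] --> (0 : R).
Hypothesis H3 : (\sum_(m < (N k).+1) g (grid (N k) m) ^+ 2 *
  (G k m ^+ 2 - kappa (grid (N k) m) * (u / (N k).+1%:R))) @[k --> \oo] --> (0 : R).

(** [x] is the relative increment of [Y] over a cell, split into its martingale part [a] and a rest
    [r] made of drift and residual. Squares of [a] add up to the quadratic variation [Q] in the
    limit, squares of [r] to 0. *)
Let Q := Psi u - Psi 0.
Let a k m := g (grid (N k) m) * G k m.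
Let r k m := g (grid (N k) m) * (F (grid (N k) m.+1) - F (grid (N k) m) + D k m).
Let x k m := g (grid (N k) m) * (Y (grid (N k) m.+1) - Y (grid (N k) m)).

Let cg2 : continuous (fun s => g s ^+ 2).
Proof. by move=> s; apply: (@continuous_comp _ _ _ g (fun y => y ^+ 2)); [exact: cg|exact: exprn_continuous]. Qed.

(** [H3] exchanges the squared martingale increments for [kappa] times the step; what remains is a
    Stieltjes sum against the identity. *)
Let a_limit : (\sum_(m < (N k).+1) a k m ^+ 2) @[k --> \oo] --> Q.
Proof.
have cphi : continuous (fun s => g s ^+ 2 * kappa s).
  by move=> s; apply: cvgM; [exact: cg2|exact: ck].
have did (t : R) : 0 <= t -> is_derive t 1 (@id R) 1 by move=> _; exact: is_derive_id.
have dPsi1 (t : R) : 0 <= t -> is_derive t 1 Psi (g t ^+ 2 * kappa t * 1).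
  by rewrite mulr1; exact: dPsi.
have c1 : continuous (cst 1 : R -> R) by move=> s; exact: cvg_cst.
have S := stieltjes_limit cphi c1 did dPsi1.
apply: cvg_seq_eq (cvgD H3 (cvg_comp _ _ Noo S)) (add0r _) _ => k /=.
rewrite -big_split/=; apply: eq_bigr => m _.
by rewrite grid_step /a exprMn; ring.
Qed.

(** Drift increments are bounded by a multiple of the step, so that their squares sum to O(1 / N);
    the residuals [D] are covered by [H2]. *)
Let r_limit : (\sum_(m < (N k).+1) r k m ^+ 2) @[k --> \oo] --> (0 : R).
Proof.
have [B B0 gB] := bounded_on u cg; have [K K0 bK] := bounded_on u cb.
have up : (2 * B ^+ 2 * ((K ^+ 2 * u ^+ 2) / (N k).+1%:R +
    \sum_(m < (N k).+1) D k m ^+ 2)) @[k --> \oo] --> (0 : R).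
  rewrite -[X in _ --> X](mulr0 (2 * B ^+ 2)); apply: cvgMr; rewrite -[X in _ --> X]addr0.
  by apply: cvgD => //; exact: harmonic_limit.
apply: (squeeze_cvgr _ (cvg_cst 0) up); apply: nearW => k.
rewrite sumr_ge0/=; last by move=> m _; exact: sqr_ge0.
have -> : K ^+ 2 * u ^+ 2 / (N k).+1%:R =
    \sum_(m < (N k).+1) (K * (u / (N k).+1%:R)) ^+ 2.
  rewrite sumr_const card_ord -[RHS]mulr_natr.
  have : ((N k).+1%:R : R) != 0 by rewrite pnatr_eq0.
  by move: ((N k).+1%:R : R) => q q0; field.
rewrite -big_split/= mulr_sumr; apply: ler_sum => m _.
have gm := grid_in (ltnW (ltn_ord m)); have gm1 := grid_in (ltn_ord m).
have gg := grid_mono u0 (N k) (leqnSn m).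
have hF : `|F (grid (N k) m.+1) - F (grid (N k) m)| <= K * (u / (N k).+1%:R).
  rewrite -(grid_step u (N k) m); apply: (mean_value_bound (df := b)) => //.
    by move=> s /andP[s1 _]; apply: dF; case/andP: gm => /le_trans/(_ s1).
  by move=> s s12; exact/bK/(cell_in (ltn_ord m) s12).
rewrite /r exprMn; set f := F _ - F _ in hF *.
have f2 : f ^+ 2 <= (K * (u / (N k).+1%:R)) ^+ 2.
  by rewrite -real_normK ?num_real// lerXn2r ?nnegrE// (le_trans _ hF).
have g2 : g (grid (N k) m) ^+ 2 <= B ^+ 2.
  by rewrite -real_normK ?num_real// lerXn2r ?nnegrE ?gB// ltW.
have fd (p q : R) : (p + q) ^+ 2 <= 2 * (p ^+ 2 + q ^+ 2).
  by have := sqr_ge0 (p - q); rewrite sqrrB sqrrD; lra.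
apply: (le_trans (ler_pM (sqr_ge0 _) (sqr_ge0 _) g2 (fd _ _))).
rewrite (mulrCA (B ^+ 2)) -(mulrA 2 (B ^+ 2)) ler_pM2l//.
by apply: ler_wpM2l; rewrite ?sqr_ge0// lerD2r.
Qed.

Let x_limit : (\sum_(m < (N k).+1) x k m ^+ 2) @[k --> \oo] --> Q.
Proof.
have cr := cross_term_limit a_limit r_limit.
apply: cvg_seq_eq (cvgD (cvgD a_limit (cvgMr (a := 2) cr)) r_limit) _ _ => [|k /=].
  by rewrite mulr0 !addr0.
rewrite addrfctE mulr_sumr -!big_split/=; apply: eq_bigr => m _.
have -> : x k m = a k m + r k m by rewrite /x /a /r dY//; ring.
by ring.
Qed.

(** The remainder 2 |x|^3 is at most 2 [eta] x^2, where [eta] bounds all relative increments on a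
    fine grid by uniform continuity of [Y], and the squares sum to at most [C]. *)
Let taylor_limit :
  (\sum_(m < (N k).+1) (ln (1 + x k m) - x k m + x k m ^+ 2 / 2))
    @[k --> \oo] --> (0 : R).
Proof.
have [B B0 gB] := bounded_on u cg.
apply/cvgrPdist_le => e e0.
pose C := `|Q| + 1; have C0 : 0 < C by rewrite ltr_pwDr.
pose eta := Num.min (1 / 2) (e / (2 * C)).
have eta0 : 0 < eta by rewrite lt_min !divr_gt0// mulr_gt0.
have [del del0 Hdel] := uniformly_continuous_on u cY (divr_gt0 eta0 B0).
have [N0 HN0] := grid_mesh u0 del0.
have /cvgrPdist_le/(_ _ ltr01) HQ := x_limit.
near=> k.
have hN : u / (N k).+1%:R < del by apply: HN0; near: k; exact: (Noo (nbhs_infty_ge N0)).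
have hQ : `|Q - \sum_(m < (N k).+1) x k m ^+ 2| <= 1 by near: k.
have hC : \sum_(m < (N k).+1) x k m ^+ 2 <= C.
  have := ler_norm Q; move: hQ; rewrite ler_norml /C => /andP[? ?] ?; lra.
have xe (m : 'I_(N k).+1) : `|x k m| <= eta.
  have gm := grid_in (ltnW (ltn_ord m)).
  rewrite /x normrM -(divfK (lt0r_neq0 B0) eta) mulrC ler_pM// ?gB//.
  rewrite distrC ltW// Hdel// distrC ger0_norm grid_step//.
  by rewrite divr_ge0.
rewrite sub0r normrN; apply: (le_trans (ler_norm_sum _ _ _)).
apply: (@le_trans _ _ (\sum_(m < (N k).+1) (2 * eta) * x k m ^+ 2)).
  apply: ler_sum => m _; apply: le_trans (ln_second_order _) _.
    by rewrite (le_trans (xe m))// ge_min lexx.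
  rewrite exprS real_normK ?num_real// mulrA ler_wpM2r ?sqr_ge0//.
  by rewrite ler_pM2l.
rewrite -mulr_sumr; apply: (@le_trans _ _ (2 * eta * C)).
  by rewrite ler_wpM2l// mulr_ge0// ltW.
have : eta <= e / (2 * C) by rewrite ge_min lexx orbT.
by rewrite ler_pdivlMr ?mulr_gt0// mulrA (mulrC eta).
Unshelve. all: by end_near.
Qed.

(** Ito's formula solved for the martingale sum: every other term of the expansion of ln Y is known
    to converge, so this sum does too. *)
Lemma log_limit : (\sum_(m < (N k).+1) g (grid (N k) m) * G k m) @[k --> \oo] -->
  ln (Y u) - ln (Y 0) - (Om u - Om 0) + (Psi u - Psi 0) / 2.
Proof.
have SO := cvg_comp _ _ Noo (stieltjes_limit cg cb dF dOm).
have lnY : (fun=> ln (Y u) - ln (Y 0)) k @[k --> \oo] --> ln (Y u) - ln (Y 0).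
  exact: cvg_cst.
have half : (\sum_(m < (N k).+1) x k m ^+ 2) / 2 @[k --> \oo] --> Q / 2.
  exact: cvgMl.
apply: cvg_seq_eq (cvgB (cvgB (cvgD (cvgB lnY taylor_limit) half) SO) H1) _ _.
  by rewrite /Q; ring.
move=> k /=; rewrite !(opprfctE, addrfctE).
(* An exact identity: [1 + x k m] is the quotient of two consecutive values of [Y], since [g] is the
   inverse of [Y]. *)
have -> : ln (Y u) - ln (Y 0) = \sum_(m < (N k).+1) ln (1 + x k m).
  rewrite -(telescope_grid (fun s => ln (Y s)) (N k)); apply: eq_bigr => m _.
  have gm := grid_in (ltnW (ltn_ord m)); have gm1 := grid_in (ltn_ord m).
  have y0 := lt_le_trans d0 (Yd gm); have y1 := lt_le_trans d0 (Yd gm1).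
  rewrite -ln_div ?posrE//; congr ln; rewrite /x gY//.
  by field; rewrite gt_eqF.
rewrite mulr_suml -!sumrB -big_split/= -!sumrB; apply: eq_bigr => m _.
have -> : G k m = (Y (grid (N k) m.+1) - Y (grid (N k) m)) -
  (F (grid (N k) m.+1) - F (grid (N k) m)) - D k m by rewrite dY//; ring.
by rewrite /x; field.
Qed.

End log.
End GridLimits.

(** * Log-ratios of the replicator process *)

Section AlmostEverywhere.
Context {d : measure_display} {T : measurableType d} {R : realType}.
Variable P : probability T R.

Lemma ae_all {I : countType} (Q : I -> T -> Prop) :
  (forall i, {ae P, forall w, Q i w}) -> {ae P, forall w, forall i, Q i w}.
Proof.
move=> H; pose Q' r w := if unpickle r is Some i then Q i w else True.
have : forall r, {ae P, forall w, Q' r w}.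
  by move=> r; rewrite /Q'; case: (unpickle r) => [i|]; [exact: H|exact: aeW].
move=> /ae_foralln; apply: filterS => w Hw i.
by have := Hw (pickle i); rewrite /Q' pickleK.
Qed.

Lemma markov_bound (f : T -> R) (c : R) : measurable_fun setT f ->
  (forall w, 0 <= f w) -> 0 < c ->
  (c%:E * P [set w | (c <= f w)%R] <= \int[P]_w (f w)%:E)%E.
Proof.
move=> mf f0 c0.
have mA : measurable [set w | c <= f w].
  rewrite (_ : [set w | _] = f @^-1` `[c, +oo[).
    by rewrite -[X in measurable X]setTI; exact: mf.
  by apply/seteqP; split => w /=; rewrite in_itv/= andbT.
rewrite -integral_cst//= (le_trans (y := (\int[P]_(w in [set w | (c <= f w)%R]) (f w)%:E)%E))//.
  apply: ge0_le_integral => //.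
  - by move=> w _; rewrite lee_fin ltW.
  - by apply: (measurable_funS measurableT) => //; exact/measurable_EFinP.
apply: ge0_subset_integral => //; first exact/measurable_EFinP.
by move=> w _; rewrite lee_fin.
Qed.

(** For fixed [r], failure means an error of at least 1 / (r + 1) on all grids beyond [r]. By
    Markov's inequality on one late grid the probability of this is below any given bound, hence
    0. *)
Lemma vanishing_subsequence (e : nat -> T -> R) :
  (forall N, measurable_fun setT (e N)) -> (forall N w, 0 <= e N w) ->
  vanishing (fun N => \int[P]_w (e N w)%:E)%E ->
  {ae P, forall w, forall r, exists2 N, (r <= N)%N & e N w <= r.+1%:R^-1}.
Proof.
move=> me e0 ve; apply: ae_all => r.
set c : R := r.+1%:R^-1; have c0 : 0 < c by rewrite invr_gt0.
pose A := \bigcap_(N in [set N | (r <= N)%N]) [set w | c <= e N w].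
have mA N : measurable [set w | c <= e N w].
  rewrite (_ : [set w | _] = e N @^-1` `[c, +oo[).
    by rewrite -[X in measurable X]setTI; exact: me.
  by apply/seteqP; split => w /=; rewrite in_itv/= andbT.
have mAA : measurable A by apply: bigcap_measurable => //; exists r => /=.
exists A; split => //; last first.
  move=> w /= H N /= rN; apply: contrapT => /negP; rewrite -ltNge => h.
  by apply: H; exists N => //; exact: ltW.
apply/eqP; rewrite eq_le measure_ge0 andbT.
apply/lee_addgt0Pr => eps eps0; rewrite add0e.
have [N0 HN0] := ve _ (mulr_gt0 eps0 c0).
pose N := maxn r N0.
have := le_trans (markov_bound (me N) (e0 N) c0) (HN0 N (leq_maxr _ _)).
rewrite muleC EFinM lee_pmul2r// => H; apply: le_trans H.
apply: le_measure; rewrite ?inE// => w; apply; exact: leq_maxl.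
Qed.
End AlmostEverywhere.

Section Coefficients.
Context {R : realType} {n : nat}.
Variables (A : 'M[R]_n) (sigma : 'rV[R]_n).
Implicit Type y : 'cV[R]_n.

Definition fitness y i : R := (A *m y) i 0 - sigma 0 i ^+ 2 * y i 0.
(** Drift of X_i and its diffusion coefficient against W_l are X_i times [relative_fitness] and X_i
    times [relative_diffusion]; these quotients remain defined where X_i vanishes. *)
Definition relative_fitness y i : R := fitness y i - \sum_l y l 0 * fitness y l.
Definition relative_diffusion y i l : R := ((i == l)%:R - y l 0) * sigma 0 l.

Lemma replicator_projE y i l : replicator_proj y i l = y i 0 * ((i == l)%:R - y l 0).
Proof.
by rewrite /replicator_proj !mxE big_ord1 !mxE mulrBr mulr_natr; congr (_ - _).
Qed.

Lemma replicator_diffusionE y i l :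
  replicator_diffusion sigma y i l = y i 0 * relative_diffusion y i l.
Proof.
rewrite /replicator_diffusion mxE (bigD1 l)//= big1 ?addr0 => [|p pl].
  by rewrite replicator_projE [diag_mx _ _ _]mxE eqxx mulrA.
by rewrite [diag_mx _ _ _]mxE (negbTE pl) mulr0n mulr0.
Qed.

Lemma replicator_driftE y i :
  replicator_drift A sigma y i 0 = y i 0 * relative_fitness y i.
Proof.
rewrite /replicator_drift -mulmxA mxE /relative_fitness.
have E l : ((A - diag_mx (\row_i sigma 0 i ^+ 2)) *m y) l 0 = fitness y l.
  by rewrite /fitness mulmxBl mul_diag_mx !mxE.
under eq_bigr => l _ do rewrite replicator_projE E -mulrA mulrBl.
rewrite -mulr_sumr sumrB; congr (_ * (_ - _)).
rewrite (bigD1 i)//= big1 ?addr0 ?eqxx ?mul1r// => p pi.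
by rewrite eq_sym (negbTE pi) mul0r.
Qed.

(** Up to a term independent of i, the sum of squares is s_i^2 (1 - 2 y_i). Half of it cancels the -
    s_i^2 y_i of the fitness and leaves - s_i^2 / 2, the correction in the modified matrix; terms
    common to i and k disappear in the difference. *)
Lemma log_ratio_drift y i k : \sum_l y l 0 = 1 ->
  (relative_fitness y i - 2^-1 * \sum_l relative_diffusion y i l ^+ 2) -
  (relative_fitness y k - 2^-1 * \sum_l relative_diffusion y k l ^+ 2) =
  (modified_payoff A sigma *m y) i 0 - (modified_payoff A sigma *m y) k 0.
Proof.
move=> y1.
have M l : (modified_payoff A sigma *m y) l 0 = (A *m y) l 0 - sigma 0 l ^+ 2 / 2.
  have -> : sigma 0 l ^+ 2 / 2 = \sum_p sigma 0 l ^+ 2 / 2 * y p 0.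
    by rewrite -mulr_sumr y1 mulr1.
  rewrite !mxE -sumrB; by apply: eq_bigr => p _; rewrite mxE mulrBl.
have Q j : \sum_l relative_diffusion y j l ^+ 2 =
    sigma 0 j ^+ 2 * (1 - 2 * y j 0) + \sum_l (y l 0 * sigma 0 l) ^+ 2.
  rewrite (bigD1 j)//= [in RHS](bigD1 j)//= /relative_diffusion eqxx mulr1n addrA.
  congr (_ + _); first by ring.
  by apply: eq_bigr => l lj; rewrite eq_sym (negbTE lj) sub0r mulNr sqrrN.
by rewrite !M !Q /relative_fitness /fitness; field.
Qed.

End Coefficients.

Lemma continuous_sum {R : realType} (I : Type) (r : seq I) (f : I -> R -> R) :
  (forall i, continuous (f i)) -> continuous (fun t => \sum_(i <- r) f i t).
Proof.
move=> cf; elim: r => [|i r IH].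
  by under eq_fun do rewrite big_nil; move=> t; exact: cvg_cst.
by under eq_fun do rewrite big_cons; move=> t; apply: cvgD; [exact: cf|exact: IH].
Qed.

Lemma antiderivative_unique {R : realType} (f F G : R -> R) (t : R) :
  (forall s : R, 0 <= s <= t -> is_derive s 1 F (f s)) ->
  (forall s : R, 0 <= s <= t -> is_derive s 1 G (f s)) -> 0 <= t ->
  F t - F 0 = G t - G 0.
Proof.
move=> dF dG t0.
have h0 (s : R) : 0 <= s <= t -> is_derive s 1 (fun s => F s - G s) 0.
  by move=> st; apply: is_derive_eq (is_deriveB (dF s st) (dG s st)) _; rewrite subrr.
have := @mean_value_bound R _ (fun=> 0) 0 t 0 t0 h0 (fun s _ => _).
rewrite normr0 mul0r => /(_ (fun _ => lexx _)); rewrite normr_le0 => /eqP h.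
by apply: subr0_eq; rewrite -[RHS]h; ring.
Qed.

Section RegularProcesses.
Context {d : measure_display} {T : measurableType d} {R : realType}.
Variables (P : probability T R) (n : nat) (W : R -> T -> 'cV[R]_n).
Implicit Type c : R -> T -> R.

Lemma regular_process_cst (a : R) : regular_process P W (fun _ _ => a).
Proof.
split=> //; first by move=> w s; exact: cvg_cst.
- by move=> t _; exact: measurable_wrt_cst.
- by exists `|a|.
Qed.

Lemma regular_processD c1 c2 : regular_process P W c1 -> regular_process P W c2 ->
  regular_process P W (fun s w => c1 s w + c2 s w).
Proof.
move=> [h1 e1 m1 [K1 b1]] [h2 e2 m2 [K2 b2]]; split.
- by move=> w s; apply: cvgD; [exact: h1|exact: h2].
- by move=> s w; rewrite e1 e2.
- by move=> t t0; apply: measurable_wrtD; [exact: m1|exact: m2].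
- by exists (K1 + K2) => s w; rewrite (le_trans (ler_normD _ _))// lerD.
Qed.

Lemma regular_processM c1 c2 : regular_process P W c1 -> regular_process P W c2 ->
  regular_process P W (fun s w => c1 s w * c2 s w).
Proof.
move=> [h1 e1 m1 [K1 b1]] [h2 e2 m2 [K2 b2]]; split.
- by move=> w s; apply: cvgM; [exact: h1|exact: h2].
- by move=> s w; rewrite e1 e2.
- by move=> t t0; apply: measurable_wrtM; [exact: m1|exact: m2].
- by exists (K1 * K2) => s w; rewrite normrM ler_pM.
Qed.

Lemma regular_process_comp c (h : R -> R) : regular_process P W c ->
  continuous h -> (exists K, forall y, `|h y| <= K) ->
  regular_process P W (fun s w => h (c s w)).
Proof.
move=> [h1 e1 m1 _] ch [K hK]; split.
- move=> w s; apply: (@continuous_comp _ _ _ (c^~ w) h); [exact: h1|exact: ch].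
- by move=> s w; rewrite e1.
- move=> t t0; apply: (@measurable_wrt_comp _ _ _ _ (c t) h); last exact: m1.
  exact: continuous_measurable_fun.
- by exists K.
Qed.

End RegularProcesses.

Section Solution.
Context {d : measure_display} {T : measurableType d} {R : realType}.
Variables (P : probability T R) (n : nat) (A : 'M[R]_n) (sigma : 'rV[R]_n).
Variables (W : R -> T -> 'cV[R]_n) (x : 'cV[R]_n) (X : R -> T -> 'cV[R]_n).
Hypothesis bW : brownian_motion P W.
Hypothesis hx : int_simplex x.
Hypothesis sol : stochastic_replicator P A sigma W x X.

Definition extended (t : R) (w : T) : 'cV[R]_n := X (Num.max 0 t) w.
Local Notation Z := extended.

Lemma extendedE t w : 0 <= t -> Z t w = X t w.
Proof. by move=> t0; rewrite /extended (max_idPr t0). Qed.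

Lemma extended_simplex t w : simplex (Z t w).
Proof. by case: sol => s _ _ _ _; apply: s; rewrite le_max lexx. Qed.

Lemma extended_itv t w i : 0 <= Z t w i 0 <= 1.
Proof. by case: (extended_simplex t w). Qed.

Lemma extended_sum t w : \sum_i Z t w i 0 = 1.
Proof. by case: (extended_simplex t w). Qed.

Lemma extended_continuous w i : continuous (fun t => Z t w i 0).
Proof.
case: sol => _ /(_ w) /continuous_comp_max0 cX _ _ _ t.
apply: (@continuous_comp _ _ _ (fun t : R => X (Num.max 0 t) w)
  (fun M : 'cV[R]_n => M i 0)); first exact: cX.
exact: coord_continuous.
Qed.

Lemma regular_coordinate i : regular_process P W (fun s w => Z s w i 0).
Proof.
split; first by move=> w; exact: extended_continuous.
- by move=> s w; rewrite /extended (max_idPr (_ : 0 <= Num.max 0 s))// le_max lexx.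
- move=> t t0; rewrite (_ : (fun w => _) = (fun w => X t w i 0)).
    by case: sol => _ _ m _ _; exact: m.
  by apply/funext => w; rewrite extendedE.
- by exists 1 => s w; have /andP[h1 h2] := extended_itv s w i; rewrite ger0_norm.
Qed.

Lemma regular_diffusion i l :
  regular_process P W (fun s w => replicator_diffusion sigma (Z s w) i l).
Proof.
under eq_fun do under eq_fun do rewrite replicator_diffusionE /relative_diffusion.
apply: regular_processM; first exact: regular_coordinate.
apply: regular_processM; last exact: regular_process_cst.
apply: regular_processD; first exact: regular_process_cst.
under eq_fun do under eq_fun do rewrite -mulN1r.
apply: regular_processM; first exact: regular_process_cst.
exact: regular_coordinate.
Qed.

Lemma linear_continuous (B : 'M[R]_n) w i : continuous (fun t => (B *m Z t w) i 0).
Proof.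
under eq_fun do rewrite mxE.
apply: continuous_sum => j t; apply: cvgM; first exact: cvg_cst.
exact: extended_continuous.
Qed.

Lemma relative_fitness_continuous w i :
  continuous (fun t => relative_fitness A sigma (Z t w) i).
Proof.
have cf l : continuous (fun t => fitness A sigma (Z t w) l).
  move=> t; apply: cvgB; first exact: linear_continuous.
  by apply: cvgM; [exact: cvg_cst|exact: extended_continuous].
move=> t; apply: cvgB; first exact: cf.
move: t; apply: continuous_sum => l t; apply: cvgM; [exact: extended_continuous|exact: cf].
Qed.

Lemma drift_continuous w i :
  continuous (fun t => replicator_drift A sigma (Z t w) i 0).
Proof.
under eq_fun do rewrite replicator_driftE.
move=> t; apply: cvgM; [exact: extended_continuous|exact: relative_fitness_continuous].
Qed.

(** The integrals are chosen time by time, and the null set depends on [t]. Quantifying over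
    antiderivatives inside the almost sure statement lets one path use the same [F] at all grid
    points. *)
Lemma noise_integrals : exists M : 'I_n -> 'I_n -> R -> T -> R,
  (forall i l t, 0 <= t ->
    ito P W l (fun z => replicator_diffusion sigma (Z z.1 z.2) i l *
      \1_(`]0, t]) z.1) (M i l t)) /\
  forall t, 0 <= t -> {ae P, forall w, forall i (F : R -> R),
    (forall s : R, 0 <= s -> is_derive s 1 F (replicator_drift A sigma (Z s w) i 0)) ->
    Z t w i 0 = x i 0 + (F t - F 0) + \sum_l M i l t w}.
Proof.
have /choice[I HI] : forall t, exists I : 'I_n -> 'I_n -> T -> R, 0 <= t ->
    (forall i j, is_ito_integral P (brownian_filtration P W)
       (fun s w => W s w j 0)
       (fun s w => replicator_diffusion sigma (X s w) i j) t (I i j)) /\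
    {ae P, forall w, forall i, X t w i 0 = x i 0
       + (\int[lebesgue_measure]_(s in `[0, t]) replicator_drift A sigma (X s w) i 0)
       + \sum_(j < n) I i j w}.
  (* At negative times 0 serves as default value. *)
  move=> t; have [t0|t0] := leP 0 t; last by exists (fun _ _ _ => 0).
  by case: sol => _ _ _ _ /(_ t t0)[I HI]; exists I.
exists (fun i l t => I t i l); split=> [i l t t0|t t0].
  have [HI1 _] := HI t t0.
  apply: (@ito_of_is_ito_integral _ _ _ _ _ _ bW l
    (fun s w => replicator_diffusion sigma (X s w) i l)
    (fun s w => replicator_diffusion sigma (Z s w) i l) t (I t i l) t0) => //.
    exact: (regular_process_measurable bW (regular_diffusion i l)).
  by move=> s w s0 /=; rewrite extendedE.
have [_] := HI t t0; apply: filterS => w Hw i F dF.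
rewrite extendedE// Hw; congr (_ + _ + _).
have [F' dF' F'E] := antiderivative (@drift_continuous w i).
transitivity (F' t - F' 0).
  rewrite -F'E//; apply: eq_Rintegral => s; rewrite inE/= in_itv/= => /andP[s0 _].
  by rewrite extendedE.
by apply: antiderivative_unique t0 => s /andP[s0 _]; [exact: dF'|exact: dF].
Qed.

End Solution.

Section LogRatio.
Context {d : measure_display} {T : measurableType d} {R : realType}.
Variables (P : probability T R) (n : nat) (A : 'M[R]_n) (sigma : 'rV[R]_n).
Variables (W : R -> T -> 'cV[R]_n) (x : 'cV[R]_n) (X : R -> T -> 'cV[R]_n).
Hypothesis bW : brownian_motion P W.
Hypothesis hx : int_simplex x.
Hypothesis sol : stochastic_replicator P A sigma W x X.
Local Notation Z := (extended X).

Section fixed_time.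
Variable M : 'I_n -> 'I_n -> R -> T -> R.
Hypothesis HM : forall i l t, 0 <= t ->
  ito P W l (fun z => replicator_diffusion sigma (Z z.1 z.2) i l *
    \1_(`]0, t]) z.1) (M i l t).
Variables (u delta : R).
Hypotheses (u0 : 0 <= u) (d0 : 0 < delta).
Local Notation grid := (grid u).

(* The cap keeps the integrands bounded without a stopping time, and has no
   effect on the paths that satisfy X_i >= delta on [0, u]. *)
Definition capped_inverse (i : 'I_n) (s : R) (w : T) : R :=
  (Num.max (Z s w i 0) delta)^-1.
Local Notation g := capped_inverse.

Let c (i l : 'I_n) (s : R) (w : T) := replicator_diffusion sigma (Z s w) i l.

Definition component_error (i : 'I_n) : nat -> T -> R :=
  log_error W u (c i) (M i) (g i).

Definition rescaled_noise (i : 'I_n) (N : nat) (w : T) : R :=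
  \sum_(m < N.+1) g i (grid N m) w * noise_increment W u (c i) N m w.

Lemma regular_capped_inverse i : regular_process P W (g i).
Proof.
have m0 (y : R) : 0 < Num.max y delta by rewrite lt_max d0 orbT.
apply: (regular_process_comp (h := fun y => (Num.max y delta)^-1)).
- exact: (regular_coordinate sol).
- move=> y; apply: cvgV; first by rewrite gt_eqF.
  by apply: (@continuous_max R R id (fun=> delta) y); [exact: cvg_id|exact: cvg_cst].
- exists delta^-1 => y; rewrite ger0_norm ?invr_ge0; last exact: ltW (m0 y).
  by rewrite lef_pV2 ?posrE// le_max lexx orbT.
Qed.

Let HM' i l t : 0 <= t <= u ->
  ito P W l (fun z => c i l z.1 z.2 * \1_(`]0, t]) z.1) (M i l t).
Proof. by case/andP => t0 _; exact: HM. Qed.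

Lemma component_error_measurable i N : measurable_fun setT (component_error i N).
Proof.
exact: (log_error_measurable bW u0 (regular_diffusion sol i) (HM' i)
  (regular_capped_inverse i)).
Qed.

Lemma component_error_vanishing i :
  vanishing (fun N => \int[P]_w (component_error i N w)%:E)%E.
Proof.
exact: (log_error_vanishing bW u0 (regular_diffusion sol i) (HM' i)
  (regular_capped_inverse i)).
Qed.

Lemma component_limit i w (N : nat -> nat) (F K : R -> R) :
  N r @[r --> \oo] --> \oo ->
  (forall r, component_error i (N r) w <= r.+1%:R^-1) ->
  (forall s : R, 0 <= s -> is_derive s 1 F (replicator_drift A sigma (Z s w) i 0)) ->
  (forall s : R, 0 <= s -> is_derive s 1 K (relative_fitness A sigma (Z s w) i -
    2^-1 * \sum_l relative_diffusion sigma (Z s w) i l ^+ 2)) ->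
  (forall r m, (m <= (N r).+1)%N -> Z (grid (N r) m) w i 0 =
    x i 0 + (F (grid (N r) m) - F 0) + \sum_l M i l (grid (N r) m) w) ->
  (forall s, 0 <= s <= u -> delta <= Z s w i 0) ->
  rescaled_noise i (N r) w @[r --> \oo] -->
    ln (Z u w i 0) - ln (Z 0 w i 0) - (K u - K 0).
Proof.
move=> Noo Ne dF dK sde Zd.
have cg : continuous (g i ^~ w) by case: (regular_capped_inverse i).
have cc l : continuous (c i l ^~ w).
  by have [h _ _ _] := regular_diffusion sol i l; exact: h.
have cY : continuous (fun s => Z s w i 0) by exact: (extended_continuous sol).
have cb : continuous (fun s => replicator_drift A sigma (Z s w) i 0).
  exact: (drift_continuous sol).
have ck : continuous (fun s => energy (c i) s w).
  apply: continuous_sum => l s.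
  by apply: (@continuous_comp _ _ _ (c i l ^~ w) (fun y => y ^+ 2));
    [exact: cc|exact: exprn_continuous].
have gY s : 0 <= s <= u -> g i s w = (Z s w i 0)^-1.
  by move=> /Zd h; rewrite /capped_inverse (max_idPl h).
have cOm : continuous (fun s => g i s w * replicator_drift A sigma (Z s w) i 0).
  by move=> s; apply: cvgM; [exact: cg|exact: cb].
have cPsi : continuous (fun s => g i s w ^+ 2 * energy (c i) s w).
  move=> s; apply: cvgM; last exact: ck.
  by apply: (@continuous_comp _ _ _ (g i ^~ w) (fun y => y ^+ 2));
    [exact: cg|exact: exprn_continuous].
have [Om dOm _] := antiderivative cOm.
have [Psi dPsi _] := antiderivative cPsi.
have inv0 : (r.+1%:R^-1 : R) @[r --> \oo] --> (0 : R) by exact: cvg_harmonic.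
have to0 (f : nat -> R) : (forall r, f r ^+ 2 <= component_error i (N r) w) ->
    f r @[r --> \oo] --> (0 : R).
  move=> fe; apply/cvgrPdist_le => e e0.
  have /cvgrPdist_le/(_ _ (exprn_gt0 2 e0)) := inv0.
  apply: filterS => r; rewrite !sub0r !normrN ger0_norm ?invr_ge0// => h.
  rewrite -(@ler_pXn2r _ 2)// ?nnegrE ?(ltW e0)// real_normK ?num_real//.
  exact: le_trans (fe r) (le_trans (Ne r) h).
have e1 N' : weighted_residual W u (c i) (M i) (g i) N' w ^+ 2 <= component_error i N' w.
  by rewrite /component_error /log_error -addrA lerDl addr_ge0 ?sqr_ge0 ?residual_energy_ge0.
have e2 N' : residual_energy W u (c i) (M i) N' w <= component_error i N' w.
  by rewrite /component_error /log_error addrAC lerDr addr_ge0 ?sqr_ge0.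
have e3 N' : quadratic_residual W u (c i) (g i) N' w ^+ 2 <= component_error i N' w.
  by rewrite /component_error /log_error lerDr addr_ge0 ?sqr_ge0 ?residual_energy_ge0.
have H2 : residual_energy W u (c i) (M i) (N r) w @[r --> \oo] --> (0 : R).
  apply: (squeeze_cvgr _ (cvg_cst 0) inv0); apply: nearW => r.
  by rewrite residual_energy_ge0/= (le_trans (e2 _)).
have dY r m : (m < (N r).+1)%N ->
    Z (grid (N r) m.+1) w i 0 - Z (grid (N r) m) w i 0 =
    F (grid (N r) m.+1) - F (grid (N r) m) + noise_increment W u (c i) (N r) m w +
    total_residual W u (c i) (M i) (N r) m w.
  move=> mN; rewrite !sde// ?(ltnW mN)//.
  have -> : total_residual W u (c i) (M i) (N r) m w =
      \sum_l M i l (grid (N r) m.+1) w - \sum_l M i l (grid (N r) m) w -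
      noise_increment W u (c i) (N r) m w by rewrite -!sumrB.
  ring.
have := log_limit u0 cY cb ck cg d0 Zd gY dF dOm dPsi Noo dY
  (to0 _ (fun r => e1 (N r))) H2 (to0 _ (fun r => e3 (N r))).
suff -> : ln (Z u w i 0) - ln (Z 0 w i 0) - (Om u - Om 0) + (Psi u - Psi 0) / 2 =
    ln (Z u w i 0) - ln (Z 0 w i 0) - (K u - K 0) by [].
(* [Om - Psi / 2] is another antiderivative of the Ito drift of log X_i: on this path [g] is the
   inverse of X_i, and the factors X_i in drift and diffusion cancel. *)
have -> : K u - K 0 = (Om u - 2^-1 * Psi u) - (Om 0 - 2^-1 * Psi 0); last by ring.
apply: (@antiderivative_unique R _ K (fun s => Om s - 2^-1 * Psi s) u
  (fun s su => dK s (proj1 (andP su))) _ u0) => s su.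
have /andP[s0 _] := su.
apply: is_derive_eq (is_deriveB (dOm s s0) (is_deriveZ 2^-1 (dPsi s s0))) _.
have Zs : Z s w i 0 != 0 by rewrite gt_eqF// (lt_le_trans d0)// Zd.
rewrite /GRing.scale/= gY// replicator_driftE mulKf//; congr (_ - _ * _).
rewrite /energy mulr_sumr; apply: eq_bigr => l _.
by rewrite /c replicator_diffusionE exprMn exprVn mulKf// expf_neq0.
Qed.

(** Divided by X_i, the noise increment is s_i dW_i minus the sum of the X_l s_l dW_l. The sum does
    not depend on i, so the difference telescopes exactly, for each [N]. *)
Lemma rescaled_noise_diff i k N w : W 0 w = 0 ->
  (forall s, 0 <= s <= u -> delta <= Z s w i 0) ->
  (forall s, 0 <= s <= u -> delta <= Z s w k 0) ->
  rescaled_noise i N w - rescaled_noise k N w =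
    sigma 0 i * W u w i 0 - sigma 0 k * W u w k 0.
Proof.
move=> W0 Zi Zk.
have E (j : 'I_n) (m : 'I_N.+1) : (forall s, 0 <= s <= u -> delta <= Z s w j 0) ->
    g j (grid N m) w * noise_increment W u (c j) N m w =
    sigma 0 j * increment W j (grid N m) (grid N m.+1) w -
    \sum_l Z (grid N m) w l 0 * sigma 0 l * increment W l (grid N m) (grid N m.+1) w.
  move=> Zj; have Zd := Zj _ (grid_in u0 (ltnW (ltn_ord m))).
  rewrite /capped_inverse (max_idPl Zd) /noise_increment mulr_sumr.
  have Z0 : Z (grid N m) w j 0 != 0 by rewrite gt_eqF// (lt_le_trans d0).
  rewrite (bigD1 j)//= [in RHS](bigD1 j)//= opprD addrA; congr (_ + _).
    by rewrite /c replicator_diffusionE -mulrA mulKf// /relative_diffusion eqxx mulr1n; ring.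
  rewrite -sumrN; apply: eq_bigr => l lj.
  rewrite /c replicator_diffusionE -mulrA mulKf// /relative_diffusion eq_sym (negbTE lj).
  by rewrite mulr0n; ring.
rewrite /rescaled_noise -sumrB.
rewrite (eq_bigr (fun m : 'I_N.+1 =>
  (sigma 0 i * W (grid N m.+1) w i 0 - sigma 0 k * W (grid N m.+1) w k 0) -
  (sigma 0 i * W (grid N m) w i 0 - sigma 0 k * W (grid N m) w k 0))); last first.
  by move=> m _; rewrite !E// /increment; ring.
rewrite (telescope_grid u (fun s => sigma 0 i * W s w i 0 - sigma 0 k * W s w k 0)).
by rewrite W0 !mxE !mulr0 !subr0.
Qed.
End fixed_time.
End LogRatio.

(** At the infimum of the times where [Q] fails, the first hypothesis gives [Q] there and the second
    gives it slightly beyond. *)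
Lemma continuity_induction {R : realType} (Q : R -> Prop) :
  (forall u, 0 <= u -> (forall s, 0 <= s < u -> Q s) -> Q u) ->
  (forall u, 0 <= u -> Q u -> nbhs u Q) -> forall u, 0 <= u -> Q u.
Proof.
move=> closedQ openQ u u0; apply: contrapT => Qu.
pose S := [set s | 0 <= s /\ ~ Q s].
have S0 : S !=set0 by exists u.
have hS : has_inf S by split => //; exists 0 => s [].
have before s : 0 <= s < inf S -> Q s.
  move=> /andP[s0 st]; apply: contrapT => Qs.
  have : inf S <= s by apply: ge_inf; [case: hS|].
  by rewrite leNgt st.
have i0 : 0 <= inf S by apply: lb_le_inf => // s [].
have /nbhs_ballP[r /= r0 Hr] := openQ _ i0 (closedQ _ i0 before).
have [s [s0 Qs] sr] := inf_adherent r0 hS.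
have ts : inf S <= s by apply: ge_inf; [case: hS|].
apply/Qs/Hr; by rewrite /ball/= distrC ger0_norm ?subr_ge0// ltrBlDl.
Qed.

(** * The ratio identity and positivity at all times *)

Section RatioIdentity.
Context {d : measure_display} {T : measurableType d} {R : realType}.
Variables (P : probability T R) (n : nat) (A : 'M[R]_n) (sigma : 'rV[R]_n).
Variables (W : R -> T -> 'cV[R]_n) (x : 'cV[R]_n) (X : R -> T -> 'cV[R]_n).
Hypothesis bW : brownian_motion P W.
Hypothesis hx : int_simplex x.
Hypothesis sol : stochastic_replicator P A sigma W x X.
Local Notation Z := (extended X).

Definition payoff_gap (i k : 'I_n) (w : T) (s : R) : R :=
  (modified_payoff A sigma *m Z s w) i 0 - (modified_payoff A sigma *m Z s w) k 0.

Definition noise_gap (i k : 'I_n) (w : T) (u : R) : R :=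
  sigma 0 i * W (Num.max 0 u) w i 0 - sigma 0 k * W (Num.max 0 u) w k 0.

(* In this form both sides are continuous in [u] even if X_k vanishes, so that
   the identity can be propagated before positivity is known. *)
Definition ratio_identity (w : T) (u : R) : Prop := forall i k (H : R -> R),
  (forall s : R, 0 <= s -> is_derive s 1 H (payoff_gap i k w s)) ->
  Z u w i 0 = Z u w k 0 * (x i 0 / x k 0) * expR (H u - H 0 + noise_gap i k w u).

Lemma payoff_gap_continuous i k w : continuous (payoff_gap i k w).
Proof. by move=> s; apply: cvgB; exact: (linear_continuous sol). Qed.

Lemma noise_gap_continuous i k w : continuous (noise_gap i k w).
Proof.
move=> s; apply: cvgB; (apply: cvgM; first exact: cvg_cst).
  exact: (brownian_continuous bW).
exact: (brownian_continuous bW).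
Qed.

Lemma ratio_identity_bounded_below (u delta : R) : 0 <= u -> 0 < delta ->
  {ae P, forall w, (forall i s, 0 <= s <= u -> delta <= Z s w i 0) ->
    ratio_identity w u}.
Proof.
move=> u0 d0; have [M [HM sde]] := noise_integrals bW sol.
suff : {ae P, forall w, forall ik : 'I_n * 'I_n,
    (forall i s, 0 <= s <= u -> delta <= Z s w i 0) -> forall H : R -> R,
    (forall s : R, 0 <= s -> is_derive s 1 H (payoff_gap ik.1 ik.2 w s)) ->
    Z u w ik.1 0 = Z u w ik.2 0 * (x ik.1 0 / x ik.2 0) *
      expR (H u - H 0 + noise_gap ik.1 ik.2 w u)}.
  by apply: filterS => w Hw Zd i k H dH; exact: (Hw (i, k)).
apply: ae_all => -[i k] /=.
pose e j := component_error sigma W X M u delta j.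
have me j N := component_error_measurable bW sol HM u0 d0 j N.
have e0 j N w : 0 <= e j N w by exact: log_error_ge0.
(* The two errors are added so that a single subsequence of grids serves both components. *)
have ve : vanishing (fun N => \int[P]_w (e i N w + e k N w)%:E)%E.
  apply: vanishing_le (vanishingD (component_error_vanishing bW sol HM u0 d0 i)
    (component_error_vanishing bW sol HM u0 d0 k)) => N.
  rewrite -ge0_integralD//; try by move=> w _; rewrite lee_fin; exact: e0.
  - exact/measurable_EFinP/me.
  - exact/measurable_EFinP/me.
have A1 := vanishing_subsequence (fun N => measurable_funD (me i N) (me k N))
  (fun N w => addr_ge0 (e0 i N w) (e0 k N w)) ve.
have A2 : {ae P, forall w, W 0 w = 0 /\ X 0 w = x}.
  by case: bW sol => _ W0 _ _ _ [_ _ _ X0 _]; apply: filterS2 W0 X0.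
(* The points of all grids are countable, so the equation holds at all of them off one null set. *)
have A3 := ae_all (fun Nm : nat * nat => sde _ (grid_ge0 u0 Nm.1 Nm.2)).
move: A1 A2 A3; apply: filterS3 => w subseq [W0 X0] Hsde Zd H dH.
have /choice[N HN] : forall r, exists N, (r <= N)%N /\ e i N w + e k N w <= r.+1%:R^-1.
  by move=> r; have [N rN eN] := subseq r; exists N.
have rN r : (r <= N r)%N by case: (HN r).
have Noo : N r @[r --> \oo] --> \oo.
  by move=> B [a _ aB]; exists a => // r /= ar; apply: aB => /=; exact: leq_trans (rN r).
have eN r : e i (N r) w + e k (N r) w <= r.+1%:R^-1 by case: (HN r).
have ei r : e i (N r) w <= r.+1%:R^-1 by rewrite (le_trans _ (eN r))// lerDl.
have ek r : e k (N r) w <= r.+1%:R^-1 by rewrite (le_trans _ (eN r))// lerDr.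
have ck j : continuous (fun s => relative_fitness A sigma (Z s w) j -
    2^-1 * \sum_l relative_diffusion sigma (Z s w) j l ^+ 2).
  move=> s; apply: cvgB; first exact: (relative_fitness_continuous sol).
  apply: cvgM; first exact: cvg_cst.
  move: s; apply: continuous_sum => l s.
  apply: (@continuous_comp _ _ _ (fun s => relative_diffusion sigma (Z s w) j l)
    (fun y => y ^+ 2)); last exact: exprn_continuous.
  apply: cvgM; last exact: cvg_cst.
  by apply: cvgB; [exact: cvg_cst|exact: (extended_continuous sol)].
have lim j (ej : forall r, e j (N r) w <= r.+1%:R^-1) : exists2 K : R -> R,
    forall s : R, 0 <= s -> is_derive s 1 K (relative_fitness A sigma (Z s w) j -
      2^-1 * \sum_l relative_diffusion sigma (Z s w) j l ^+ 2) &
    rescaled_noise sigma W X u delta j (N r) w @[r --> \oo] -->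
      ln (Z u w j 0) - ln (Z 0 w j 0) - (K u - K 0).
  have [F dF _] := antiderivative (@drift_continuous _ _ _ _ _ _ _ _ _ _ sol w j).
  have [K dK _] := antiderivative (ck j).
  have S r m (_ : (m <= (N r).+1)%N) := Hsde (N r, m) j F dF.
  by exists K => //; exact: (component_limit sol u0 d0 Noo ej dF dK S (Zd j)).
have [Ki dKi limi] := lim i ei; have [Kk dKk limk] := lim k ek.
have HK : H u - H 0 = (Ki u - Kk u) - (Ki 0 - Kk 0).
  apply: (@antiderivative_unique R _ H (fun s => Ki s - Kk s) u
    (fun s su => dH s (proj1 (andP su))) _ u0) => s /andP[s0 _].
  apply: is_derive_eq (is_deriveB (dKi s s0) (dKk s s0)) _.
  exact: (log_ratio_drift _ _ _ _ (extended_sum sol s w)).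
have := cvgB limi limk.
have -> : (fun r => rescaled_noise sigma W X u delta i (N r) w) -
    (fun r => rescaled_noise sigma W X u delta k (N r) w) =
    fun=> noise_gap i k w u.
  apply/funext => r /=; rewrite /noise_gap (max_idPr u0).
  by apply: rescaled_noise_diff u0 d0 _ _ _ _ W0 (Zd i) (Zd k).
(* The differences form a constant sequence with value [noise_gap], which therefore equals the
   limit. *)
move=> C; have E := cvg_lim (@Rhausdorff R) (C _); rewrite lim_cst// in E.
have Zp j : 0 < Z u w j 0 by rewrite (lt_le_trans d0)// Zd// u0 lexx.
have xp j : 0 < x j 0 by case: hx.
have Z0 : Z 0 w = x by rewrite extendedE.
rewrite Z0 in E; rewrite E HK.
have -> : Ki u - Kk u - (Ki 0 - Kk 0) + (ln (Z u w i 0) - ln (x i 0) - (Ki u - Ki 0) -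
  (ln (Z u w k 0) - ln (x k 0) - (Kk u - Kk 0))) =
  ln (Z u w i 0) - ln (x i 0) + (ln (x k 0) - ln (Z u w k 0)) by ring.
rewrite expRD !expRB !lnK ?posrE//.
have /lt0r_neq0 h1 := Zp k; have /lt0r_neq0 h2 := xp i; have /lt0r_neq0 h3 := xp k.
by field; rewrite h1 h2 h3.
Qed.

Lemma ratio_identity_rational : {ae P, forall w, forall (q : rat) (m : nat),
  0 <= ratr q :> R ->
  (forall i s, 0 <= s <= ratr q -> m.+1%:R^-1 <= Z s w i 0) ->
  ratio_identity w (ratr q)}.
Proof.
apply: ae_all => q; apply: ae_all => m.
have [q0|q0] := leP (0 : R) (ratr q); last by apply: aeW.
have m0 : 0 < m.+1%:R^-1 :> R by rewrite invr_gt0.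
by apply: filterS (ratio_identity_bounded_below q0 m0) => w Hw _.
Qed.

Lemma uniform_lower_bound (u : R) w : 0 <= u ->
  (forall i s, 0 <= s <= u -> 0 < Z s w i 0) ->
  exists m, forall i s, 0 <= s <= u -> m.+1%:R^-1 <= Z s w i 0.
Proof.
move=> u0 Zp.
have /choice[m Hm] : forall i, exists m, forall s, 0 <= s <= u ->
    m.+1%:R^-1 <= Z s w i 0.
  move=> i; have cZ : continuous (fun s => Z s w i 0) by exact: (extended_continuous sol).
  have [c cu Hc] := EVT_min u0 (continuous_subspaceT cZ).
  have zc : 0 < Z c w i 0 by apply: Zp; move: cu; rewrite in_itv.
  exists (Num.truncn (Z c w i 0)^-1) => s su.
  apply: (@le_trans _ _ (Z c w i 0)); last by apply: Hc; rewrite in_itv.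
  rewrite invf_ple ?posrE//; apply: ltW.
  have zi : 0 <= (Z c w i 0)^-1 by rewrite invr_ge0 ltW.
  by have /andP[] := truncn_itv zi.
exists (\max_i m i)%N => i s su; apply: le_trans (Hm i s su).
by rewrite lef_pV2 ?posrE// ler_nat ltnS leq_bigmax.
Qed.

(** Continuity induction on positivity. If all components are positive before [u], compactness
    bounds them below on each [[0, q]] with [q < u], the rational identity holds at [q], and
    continuity carries it to [u]. There some component is positive, the sum being 1, and the
    identity makes all the others positive. *)
Lemma ratio_identity_all : {ae P, forall w, forall u, 0 <= u ->
  (forall i, 0 < Z u w i 0) /\ ratio_identity w u}.
Proof.
have A2 : {ae P, forall w, W 0 w = 0 /\ X 0 w = x}.
  by case: bW sol => _ W0 _ _ _ [_ _ _ X0 _]; apply: filterS2 W0 X0.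
move: ratio_identity_rational A2; apply: filterS2 => w Hq [W0 X0].
have xp j : 0 < x j 0 by case: hx.
have closed u : 0 <= u -> (forall s, 0 <= s < u -> forall i, 0 < Z s w i 0) ->
    ratio_identity w u.
  rewrite le_eqVlt => /orP[/eqP <- _ i k H dH|u0 Zp i k H dH].
    rewrite /noise_gap maxxx W0 !mxE !mulr0 subrr subrr addr0 expR0 mulr1 extendedE//.
    by rewrite X0 mulrCA divff ?mulr1// gt_eqF.
  pose phi s := Z s w i 0 -
    Z s w k 0 * (x i 0 / x k 0) * expR (H s - H 0 + noise_gap i k w s).
  have cphi : {for u, continuous phi}.
    apply: cvgB; first exact: (extended_continuous sol).
    apply: cvgM.
      by apply: cvgM; [exact: (extended_continuous sol)|exact: cvg_cst].
    apply: (@continuous_comp _ _ _ (fun s => H s - H 0 + noise_gap i k w s) (@expR R));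
      last exact: continuous_expR.
    apply: cvgD; last exact: noise_gap_continuous.
    apply: cvgB; last exact: cvg_cst.
    by apply: differentiable_continuous; apply/derivable1_diffP; case: (dH u (ltW u0)).
  apply: subr0_eq; rewrite -/(phi u); apply/eqP/negP => /negP phi0.
  have pu : 0 < `|phi u| by rewrite normr_gt0.
  have /cvgrPdist_lt/(_ _ pu)/nbhs_ballP[r /= r0 Hr] := cphi.
  (* A rational time just before [u], where [phi] is 0 although by continuity it should be close to
     the non-zero [phi u]. *)
  have [q] : exists q, ratr q \in `]Num.max 0 (u - r), u[.
    by apply: rat_in_itvoo; rewrite gt_max u0 gtrBl.
  rewrite in_itv/= gt_max => /andP[/andP[q0 qr] qu].
  have : `|phi u - phi (ratr q)| < `|phi u|.
    by apply: Hr; rewrite /ball/= gtr0_norm ?subr_gt0// ltrBlDl -ltrBlDr.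
  suff -> : phi (ratr q) = 0 by rewrite subr0 ltxx.
  have Zq j s : 0 <= s <= ratr q -> 0 < Z s w j 0.
    by move=> /andP[s0 sq]; apply: Zp; rewrite s0 (le_lt_trans sq).
  have [m Hm] := uniform_lower_bound (ltW q0) Zq.
  by rewrite /phi (Hq q m (ltW q0) Hm i k H dH) subrr.
suff pos u : 0 <= u -> forall i, 0 < Z u w i 0.
  move=> u u0; split; first exact: pos.
  by apply: closed => // s /andP[s0 _]; exact: pos.
apply: (continuity_induction (Q := fun u => forall i, 0 < Z u w i 0)) => {}u u0.
  move=> before i; have [l Zl] : exists l, 0 < Z u w l 0.
    apply: contrapT => /forallNP Zl.
    have : \sum_l Z u w l 0 <= 0.
      by apply: sumr_le0 => l _; rewrite leNgt; apply/negP/Zl.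
    by rewrite (extended_sum sol) ler10.
  have [H dH _] := antiderivative (@payoff_gap_continuous i l w).
  by rewrite (closed u u0 before i l H dH) !mulr_gt0 ?expR_gt0 ?invr_gt0.
move=> Zu; apply: (@filter_forall R 'I_n (fun j s => 0 < Z s w j 0) _ (nbhs_filter u)) => j.
have cZ : continuous (fun s => Z s w j 0) by exact: (extended_continuous sol).
exact: (cvgr_gt _ (cZ u)).
Qed.

End RatioIdentity.

(** * Growth and recurrence of Brownian motion *)

Section BorelCantelli.
Context {d : measure_display} {T : measurableType d} {R : realType}.
Variable P : probability T R.

(** Borel-Cantelli for probabilities bounded by a geometric series of sum [C]. *)
Lemma ae_finitely_often (F : nat -> set T) (C : R) :
  (forall r, measurable (F r)) -> (forall r, (P (F r) <= (C / (2 ^ r.+1)%:R)%:E)%E) ->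
  {ae P, forall w, exists r0, forall r, (r0 <= r)%N -> ~ F r w}.
Proof.
move=> mF FC.
have C0 : 0 <= C.
  have := le_trans (measure_ge0 P (F 0%N)) (FC 0%N).
  by rewrite lee_fin pmulr_lge0// invr_gt0 ltr0n expn_gt0.
have : P (lim_sup_set F) = 0%E.
  apply: lim_sup_set_cvg0 => //.
  apply: (@le_lt_trans _ _ (\sum_(r <oo) (C / (2 ^ r.+1)%:R)%:E)%E).
    by apply: lee_nneseries => // r _; exact: FC.
  by apply: (le_lt_trans (epsilon_trick0 _ C0)); rewrite ltry.
move=> PF; exists (lim_sup_set F); split => //.
  rewrite /lim_sup_set; apply: bigcap_measurable => //.
  by move=> k _; exact: bigcup_measurable.
move=> w /= H r0 _; apply: contrapT => Fw; apply: H; exists r0 => r rr Fr.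
by apply: Fw; exists r.
Qed.

End BorelCantelli.

Section Growth.
Context {d : measure_display} {T : measurableType d} {R : realType}.
Variables (P : probability T R) (n : nat) (W : R -> T -> 'cV[R]_n).
Hypothesis bW : brownian_motion P W.
Variable j : 'I_n.
Local Notation leb := (@lebesgue_measure R).
Local Notation mu := (leb \x P)%E.

Section maximal_inequality.
Variables (u lam : R) (N : nat).
Hypotheses (u0 : 0 <= u) (l0 : 0 < lam).
Local Notation grid := (grid u N).
Let Y (m : nat) (w : T) : R := increment W j 0 (grid m) w.

Definition grid_excess : set T :=
  [set w | exists2 m, (m <= N.+1)%N & lam <= `|increment W j 0 (grid m) w|].

Let calm (y : R) : R := \1_(`]- lam, lam[) y.

(* Vanishes from the first grid time at which the walk exceeds [lam]: the
   corresponding elementary integral is the stopped walk. *)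
Definition not_yet (m : nat) (w : T) : R := \prod_(r < m.+1) calm (Y r w).

Let calm_adapted m : bounded_adapted P W (grid m) (fun w => calm (Y m w)).
Proof.
split; last first.
  by exists 1 => w; rewrite /calm indicE ger0_norm// lern1 leq_b1.
apply: (@measurable_wrt_comp _ _ _ _ (Y m) calm); first exact: measurable_indic.
by apply: increment_filtration; rewrite ?lexx ?grid_ge0.
Qed.

Let not_yet_adapted m : bounded_adapted P W (grid m) (not_yet m).
Proof.
elim: m => [|m IH].
  rewrite (_ : not_yet 0 = fun w => calm (Y 0 w)); first exact: calm_adapted.
  by apply/funext => w; rewrite /not_yet big_ord_recr big_ord0/= mul1r.
rewrite (_ : not_yet m.+1 = fun w => not_yet m w * calm (Y m.+1 w)).
  apply: bounded_adaptedM; last exact: calm_adapted.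
  exact: bounded_adapted_mono (grid_mono u0 N (leqnSn m)) IH.
by apply/funext => w; rewrite /not_yet big_ord_recr.
Qed.

Let not_yet_itv m w : 0 <= not_yet m w <= 1.
Proof.
rewrite /not_yet; elim: m.+1 => [|r /andP[h0 h1]]; first by rewrite big_ord0 ler01 lexx.
rewrite big_ord_recr/= /calm indicE.
by case: (_ \in _); rewrite ?mulr1 ?mulr0 ?h0 ?h1 ?lexx ?ler01.
Qed.

Let I := 'I_N.+1.
Let a (m : I) := grid m.
Let b (m : I) := grid m.+1.
Let xi (m : I) := not_yet m.

Let el : elementary P W a b xi.
Proof.
move=> m; split; [exact: grid_ge0|exact: grid_mono|exact: not_yet_adapted].
Qed.

Let stopped := elementary_integral W j a b xi.

(** By the isometry, since the integrand takes values in [[0, 1]] and vanishes off []0, u]]. *)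
Let stopped_bound : (sqnorm P stopped <= u%:E)%E.
Proof.
rewrite elementary_isometry_sqnorm//.
pose one (z : R * T) : R := \1_(`]0, u]) z.1.
have mone : measurable_fun setT one by apply: measurableT_comp.
have -> : u%:E = sqnorm mu one.
  rewrite (sqnorm_product P mone).
  have E w : (\int[leb]_s (one (s, w) ^+ 2)%:E = u%:E)%E.
    transitivity (\int[leb]_s (1 * (\1_(`]0, u]) s * \1_(`]0, u]) s))%:E)%E.
      by apply: eq_integral => s _; rewrite mul1r /one/= expr2.
    rewrite (proj2 (integral_indic_overlap _ _ _ _ _)) mul1r /overlap.
    by rewrite !maxxx !minxx subr0 max_r.
  by under eq_integral do rewrite E; rewrite integral_cst//= probability_setT mule1.
apply: le_sqnorm => //; first exact: (elementary_process_measurable bW).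
move=> z; rewrite [X in _ <= X]ger0_norm; last by rewrite /one indicE.
rewrite /one -[u in `]_, u]](grid_end u N) -(cell_sum u0).
apply: (le_trans (ler_norm_sum _ _ _)); apply: ler_sum => m _.
have /andP[c0 c1] := cell_le1 u N m z.1; have /andP[x0 x1] := not_yet_itv m z.2.
by rewrite normrM !ger0_norm// -[leRHS]mul1r ler_wpM2r.
Qed.

(** With [p] the first index of exceedance, the coefficients are 1 before [p] and 0 from [p] on, so
    the sum telescopes to the value at [p]. *)
Let stopped_excess w : grid_excess w -> lam <= `|stopped w|.
Proof.
move=> [m mN Ym].
have ex : exists m, (m <= N.+1)%N && (lam <= `|Y m w|) by exists m; rewrite mN.
have [p /andP[pN Yp] pmin] := ex_minnP ex => {m mN Ym ex}.
have before r : (r < p)%N -> calm (Y r w) = 1.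
  move=> rp; rewrite /calm indicE mem_set//= in_itv/= -ltr_norml ltNge.
  apply/negP => h; have := pmin r; rewrite (leq_trans (ltnW rp) pN) h => /(_ isT).
  by rewrite leqNgt rp.
have at_p : calm (Y p w) = 0.
  by rewrite /calm indicE memNset//= in_itv/= -ltr_norml ltNge Yp.
have E (r : nat) : (r < N.+1)%N -> not_yet r w = (r < p)%:R.
  move=> rN; case: ltnP => h; rewrite /not_yet.
    by rewrite big1// => q _; rewrite before// (leq_ltn_trans _ h)// -ltnS.
  have pr : (p < r.+1)%N by rewrite ltnS.
  by rewrite (bigD1 (Ordinal pr))//= at_p mul0r.
have -> : stopped w = Y p w; last by [].
rewrite /stopped /elementary_integral.
rewrite (eq_bigr (fun r : I => (r < p)%:R * (Y r.+1 w - Y r w))); last first.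
  move=> r _; rewrite /xi E//; congr (_ * _).
  by rewrite /Y /a /b /increment; ring.
rewrite -(big_mkord xpredT (fun r => (r < p)%:R * (Y r.+1 w - Y r w))).
rewrite (big_cat_nat (n := p))//= [X in _ + X]big1_seq ?addr0; last first.
  move=> r /andP[_]; rewrite mem_index_iota => /andP[pr _].
  by rewrite ltnNge pr mul0r.
rewrite (eq_big_nat _ _ (F2 := fun r => Y r.+1 w - Y r w)); last first.
  by move=> r /andP[_ rp]; rewrite rp mul1r.
by rewrite telescope_sumr// /Y grid0 increment_refl subr0.
Qed.

Lemma grid_excess_measurable : measurable grid_excess.
Proof.
rewrite (_ : grid_excess = \bigcup_(m in [set m | (m <= N.+1)%N])
  ((fun w => `|Y m w|) @^-1` `[lam, +oo[)); last first.
  apply/seteqP; split=> w [m mN].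
    by exists m => //=; rewrite in_itv/= andbT.
  by rewrite /= in_itv/= andbT; exists m.
apply: bigcup_measurable => m _; rewrite -[X in measurable X]setTI.
have mY : measurable_fun setT (fun w => `|Y m w|).
  by apply: measurableT_comp => //; apply: (increment_measurable bW) => //; exact: grid_ge0.
exact: mY.
Qed.

(** Kolmogorov's inequality: Chebyshev's inequality for the stopped walk, whose final value records
    the first exceedance. *)
Lemma maximal_inequality : ((lam ^+ 2)%:E * P grid_excess <= u%:E)%E.
Proof.
have mS : measurable_fun setT stopped by exact: (elementary_integral_measurable bW).
apply: le_trans stopped_bound.
apply: le_trans (markov_bound P (measurable_funX 2 mS) (fun w => sqr_ge0 _)
  (exprn_gt0 2 l0)).
rewrite lee_pmul2l ?lte_fin ?exprn_gt0//; apply: le_measure; rewrite ?inE.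
- exact: grid_excess_measurable.
- rewrite (_ : [set w | _] = (fun w => stopped w ^+ 2) @^-1` `[lam ^+ 2, +oo[).
    by rewrite -[X in measurable X]setTI; exact: measurable_funX.
  by apply/seteqP; split => w /=; rewrite in_itv/= andbT.
- move=> w /stopped_excess h /=; rewrite -[leRHS]real_normK ?num_real//.
  by rewrite lerXn2r ?nnegrE// ltW.
Qed.
End maximal_inequality.

(* An excursion at some time of [0, u] is seen by every fine enough grid. *)
Definition excess (u lam : R) : set T :=
  \bigcup_N \bigcap_(m in [set m | (N <= m)%N]) grid_excess u lam m.

Lemma excess_measurable u lam : 0 <= u -> measurable (excess u lam).
Proof.
move=> u0; apply: bigcup_measurable => N _; apply: bigcap_measurable.
  by exists N => /=.
by move=> m _; exact: grid_excess_measurable.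
Qed.

Lemma excess_prob u lam : 0 <= u -> 0 < lam ->
  (P (excess u lam) <= (u / lam ^+ 2)%:E)%E.
Proof.
move=> u0 l0.
pose B N := \bigcap_(m in [set m | (N <= m)%N]) grid_excess u lam m.
have mB N : measurable (B N).
  apply: bigcap_measurable; first by exists N => /=.
  by move=> m _; exact: grid_excess_measurable.
have ndB : nondecreasing_seq B.
  move=> N1 N2 N12; apply/subsetPset => w Bw m /= h; apply: Bw => /=.
  exact: leq_trans h.
have cB := nondecreasing_cvg_mu (mu := P) mB (excess_measurable _ u0) ndB.
rewrite -(cvg_lim (@ereal_hausdorff R) cB); apply: lime_le.
  by apply/cvg_ex; exists (P (excess u lam)).
apply: nearW => N /=.
have l2 : 0 < lam ^+ 2 by rewrite exprn_gt0.
rewrite -(@lee_pmul2l _ (lam ^+ 2)%:E)// -EFinM mulrCA divff ?gt_eqF// mulr1.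
apply: le_trans (maximal_inequality N u0 l0); rewrite lee_pmul2l//.
apply: le_measure; rewrite ?inE//; first exact: grid_excess_measurable.
by move=> w; apply => /=.
Qed.

Lemma excessP u lam w (t : R) : 0 <= t <= u -> lam < `|increment W j 0 t w| ->
  excess u lam w.
Proof.
move=> /andP[t0 tu] h; have u0 := le_trans t0 tu.
(* Time 0 lies in no cell. The increment is 0 there, so an exceedance forces [lam < 0], and then
   every grid exceeds at its index 0. *)
have tp : 0 < t \/ lam < 0.
  move: t0 h; rewrite le_eqVlt => /orP[/eqP <-|]; last by left.
  by rewrite increment_refl normr0; right.
have [l0|l0] := ltP lam 0.
  exists 0%N => // m _; exists 0%N => //; rewrite (le_trans (ltW l0))//.
have {}t0 : 0 < t by case: tp => // /lt_le_trans/(_ l0); rewrite ltxx.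
have cW : {for t, continuous (fun s : R => W (Num.max 0 s) w j 0)}.
  exact: (brownian_continuous bW).
have e0 : 0 < `|increment W j 0 t w| - lam by rewrite subr_gt0.
have /cvgrPdist_lt/(_ _ e0)/nbhs_ballP[r /= r0 Hr] := cW.
have [N0 HN0] := grid_mesh u0 r0.
exists N0 => // N /= /HN0 hN.
have [m cm] : exists m : 'I_N.+1, cell u N m t != 0.
  apply: contrapT => /forallNP H.
  have := cell_sum u0 N N.+1 t; rewrite grid_end indicE mem_set/=; last first.
    by rewrite in_itv/= t0.
  rewrite big1 => [/esym/eqP|m _]; first by rewrite oner_eq0.
  by apply/eqP; move: (H m) => /negP; rewrite negbK.
exists m; first exact: ltnW.
have g0 := grid_ge0 u0 N m.
have := Hr (grid u N m); rewrite /ball/= => /(_ (le_lt_trans (cell_near cm) hN)).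
rewrite (max_idPr g0) (max_idPr (ltW t0)) => h2.
rewrite /increment in h e0 h2 *.
have := ler_distD (W (grid u N m) w j 0) (W t w j 0) (W 0 w j 0); lra.
Qed.

Lemma dyadic_bracket (t : R) : 1 <= t -> exists k, 2 ^+ k <= t < 2 ^+ k.+1.
Proof.
move=> t1; have t0 : 0 <= t by rewrite (le_trans ler01).
have /andP[h1 h2] := truncn_itv t0.
have tp : (0 < Num.truncn t)%N by rewrite truncn_gt0.
have /andP[h3 h4] := trunc_log_bounds (ltnSn 1) tp.
exists (trunc_log 2 (Num.truncn t)); rewrite -!natrX; apply/andP; split.
  by rewrite (le_trans _ h1)// ler_nat.
by rewrite (lt_le_trans h2)// ler_nat.
Qed.

(** On [[0, 2 ^+ k.+1]] the level [e * 2 ^+ k] is exceeded with probability at most 2^(k+1) / (e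
    2^k)^2 = (4 / e^2) / 2^(k+1), which is summable; a time between 2^k and 2^(k+1) is then
    controlled by the level of its dyadic block. *)
Lemma sublinear_growth : {ae P, forall w, forall e : R, 0 < e ->
  exists t0, forall t, t0 <= t -> `|W t w j 0| <= e * t}.
Proof.
have H : {ae P, forall w, forall r : nat, exists k0, forall k, (k0 <= k)%N ->
    ~ excess (2 ^+ k.+1) (r.+1%:R^-1 * 2 ^+ k) w}.
  apply: ae_all => r; set e : R := r.+1%:R^-1; have e0 : 0 < e by rewrite invr_gt0.
  apply: (@ae_finitely_often _ _ _ P _ (4 / e ^+ 2)).
    by move=> k; apply: excess_measurable; rewrite exprn_ge0.
  move=> k; apply: (le_trans (excess_prob _ _)).
  - by rewrite exprn_ge0.
  - by rewrite mulr_gt0// exprn_gt0.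
  rewrite lee_fin natrX le_eqVlt; apply/orP; left; apply/eqP.
  have : (2 ^+ k : R) != 0 by rewrite expf_neq0.
  rewrite !exprS expr0 !mulr1; move: (2 ^+ k : R) => q q0; field.
  by rewrite q0 gt_eqF.
have A2 : {ae P, forall w, W 0 w = 0} by case: bW.
move: H A2; apply: filterS2 => w Hw W0 e e0.
pose r := Num.truncn e^-1.
have re : r.+1%:R^-1 <= e.
  have ei : 0 <= e^-1 by rewrite invr_ge0 ltW.
  by rewrite invf_ple ?posrE//; apply: ltW; have /andP[] := truncn_itv ei.
have [k0 Hk0] := Hw r; exists (Num.max 1 (2 ^+ k0)) => t.
rewrite ge_max => /andP[t1 tk0]; have [k /andP[k1 k2]] := dyadic_bracket t1.
have kk : (k0 <= k)%N.
  rewrite -ltnS ltnNge; apply/negP => kk.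
  have := lt_le_trans (le_lt_trans tk0 k2) (ler_weXn2l _ kk).
  by rewrite ltxx ler1n => /(_ isT).
have t0 : 0 <= t by rewrite (le_trans ler01).
rewrite leNgt; apply/negP => h; apply: (Hk0 k kk).
apply: (@excessP _ _ _ t); first by rewrite t0 ltW.
rewrite /increment W0 !mxE subr0; apply: le_lt_trans h.
by rewrite ler_pM// ?exprn_ge0.
Qed.

End Growth.

(** Within two standard deviations the density is at least its peak times exp (- 2). *)
Lemma normal_prob_interval {R : realType} (s a b : R) : 0 < s -> a <= b ->
  (forall x, a <= x <= b -> `|x| <= 2 * s) ->
  ((normal_peak s * expR (- 2) * (b - a))%:E <= normal_prob 0 s `[a, b]%classic)%E.
Proof.
move=> s0 ab xs; rewrite /normal_prob.
have lab : lebesgue_measure `[a, b]%classic = (b - a)%:E.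
  rewrite lebesgue_measure_itv/= lte_fin; case: ltP => // ba.
  have -> : a = b by apply/eqP; rewrite eq_le ab ba.
  by rewrite subrr.
rewrite EFinM -lab -integral_cst//.
apply: ge0_le_integral => //.
- by move=> x _; rewrite lee_fin mulr_ge0 ?expR_ge0 ?normal_peak_ge0.
- apply/measurable_EFinP; apply: (measurable_funS measurableT) => //.
  exact: measurable_normal_pdf.
move=> x /=; rewrite in_itv/= => xab; rewrite lee_fin normal_pdfE ?gt_eqF//.
rewrite ler_pM2l ?normal_peak_gt0 ?gt_eqF// /normal_fun ler_expR subr0.
rewrite mulNr lerN2 ler_pdivrMr; last by rewrite pmulrn_lgt0// exprn_gt0.
have h : x ^+ 2 <= (2 * s) ^+ 2.
  rewrite -real_normK ?num_real// lerXn2r ?nnegrE ?xs//.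
  by rewrite mulr_ge0 ?ltW.
by apply: (le_trans h); rewrite le_eqVlt; apply/orP; left; apply/eqP; ring.
Qed.

(** * Recurrence of a difference of two Brownian coordinates *)

Section Recurrence.
Context {d : measure_display} {T : measurableType d} {R : realType}.
Variables (P : probability T R) (n : nat) (W : R -> T -> 'cV[R]_n).
Hypothesis bW : brownian_motion P W.
Variables (i k : 'I_n).
Hypothesis ik : i != k.

(* Each step is as long as the square of the current time, so that the
   increment over it has the order of magnitude of that time. *)
Fixpoint step_time (m : nat) : R :=
  if m is m'.+1 then step_time m' + step_time m' ^+ 2 else 1.
Local Notation tau := step_time.

Lemma step_time_ge m : m.+1%:R <= tau m.
Proof.
elim: m => [|m IH] //=; rewrite -natr1 lerD//.
by rewrite -[leLHS](expr1n _ 2) lerXn2r ?nnegrE// ?(le_trans _ IH)// ler1n.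
Qed.

Let tau_gt0 m : 0 < tau m. Proof. by apply: lt_le_trans (step_time_ge m). Qed.

Let tauS m : tau m < tau m.+1. Proof. by rewrite /= ltrDl exprn_gt0. Qed.

(** The increments have standard deviation [tau m]; both windows have width [tau m] and lie within
    two deviations, so the probability is bounded below uniformly in [m]. *)
Definition push (m : nat) : set T :=
  increment W i (tau m) (tau m.+1) @^-1` `[tau m, 2 * tau m] `&`
  increment W k (tau m) (tau m.+1) @^-1` `[- tau m, 0].

(** One factor [normal_peak 1 * expR (- 2)] for each of the two independent coordinates: peak times
    width does not depend on the scale. *)
Definition push_prob : R := (normal_peak 1 * expR (- 2)) ^+ 2.

Lemma push_prob_gt0 : 0 < push_prob.
Proof. by rewrite exprn_gt0// mulr_gt0 ?expR_gt0// normal_peak_gt0// oner_neq0. Qed.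

Lemma push_prob_ge m : (push_prob%:E <= P (push m))%E.
Proof.
have t0 := tau_gt0 m.
have peak s : 0 < s -> normal_peak s * s = normal_peak 1.
  move=> s0; rewrite /normal_peak -mulrnAr sqrtrM ?sqr_ge0// sqrtr_sqr gtr0_norm//.
  by rewrite expr1n mul1r invfM mulrAC mulVf ?mul1r// gt_eqF.
have sq : Num.sqrt (tau m.+1 - tau m) = tau m.
  by rewrite /= addrC addKr sqrtr_sqr gtr0_norm.
have law j (a b : R) : a <= b -> b - a = tau m ->
    (forall x, a <= x <= b -> `|x| <= 2 * tau m) ->
    ((normal_peak 1 * expR (- 2))%:E <=
      P (increment W j (tau m) (tau m.+1) @^-1` `[a, b]))%E.
  move=> ab ba xs; case: (bW) => _ _ _ L _.
  have -> := L (tau m) (tau m.+1) j `[a, b]%classic (ltW t0) (tauS m)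
    (measurable_itv _).
  rewrite sq; apply: le_trans (normal_prob_interval t0 ab xs).
  by rewrite ba mulrAC peak.
rewrite (increment_coordinate_indep bW (ltW t0) (ltW (tauS m)) ik)//.
rewrite /push_prob expr2 EFinM; apply: lee_pmul.
- by rewrite lee_fin mulr_ge0 ?expR_ge0 ?normal_peak_ge0.
- by rewrite lee_fin mulr_ge0 ?expR_ge0 ?normal_peak_ge0.
- apply: law; [lra|lra|].
  by move=> x /andP[x1 x2]; rewrite ger0_norm// (le_trans (ltW t0)).
- apply: law; [lra|lra|].
  by move=> x /andP[x1 x2]; rewrite ler0_norm//; lra.
Qed.

Lemma push_increment m :
  <<s increment_events W (tau m) (tau m.+1) >> (push m).
Proof.
by apply: sigma_setI; apply: increment_wrt; exact: measurable_itv.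
Qed.

Lemma push_filtration m : brownian_filtration P W (tau m.+1) (push m).
Proof.
have h : 0 <= tau m <= tau m.+1 by rewrite !ltW.
have h' : 0 <= tau m.+1 <= tau m.+1 by rewrite lexx ltW.
by apply: sigma_setI; apply: increment_filtration h h' _ _; exact: measurable_itv.
Qed.

Definition no_push (a r : nat) : set T :=
  \bigcap_(m in [set m | (a <= m < a + r)%N]) ~` push m.

Let no_pushS a r : no_push a r.+1 = no_push a r `&` ~` push (a + r).
Proof.
apply/seteqP; split=> w.
  move=> H; split.
    by move=> m /= /andP[am mr]; apply: H; rewrite /= am addnS ltnS ltnW.
  by apply: H; rewrite /= leq_addr addnS ltnSn.
move=> [H1 H2] m /= /andP[am]; rewrite addnS ltnS leq_eqVlt => /orP[/eqP ->//|mr].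
by apply: H1; rewrite /= am.
Qed.

Let no_push_filtration a r : brownian_filtration P W (tau (a + r)) (no_push a r).
Proof.
elim: r => [|r IH].
  rewrite (_ : no_push a 0 = setT); first exact: sigma_setT.
  apply/seteqP; split=> // w _ m /= /andP[am]; rewrite addn0 ltnNge am.
  by [].
rewrite no_pushS addnS; apply: sigma_setI.
  by apply: filtration_mono IH; rewrite ltW.
by apply: sigma_setC; exact: push_filtration.
Qed.

Let push_measurable m : measurable (push m).
Proof. by apply: (filtration_measurable bW); exact: push_filtration. Qed.

Let no_push_measurable a r : measurable (no_push a r).
Proof. by apply: (filtration_measurable bW); exact: no_push_filtration. Qed.

(** The absence of earlier pushes belongs to the past of [tau (a + r)], of which the next push is
    independent; each step thus costs a factor [1 - push_prob]. *)
Lemma no_push_prob a r : (P (no_push a r) <= ((1 - push_prob) ^+ r)%:E)%E.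
Proof.
elim: r => [|r IH]; first by rewrite expr0 probability_le1.
rewrite no_pushS.
rewrite (filtration_indep bW (ltW (tau_gt0 (a + r))) (ltW (tauS (a + r)))
  (@no_push_filtration a r) (sigma_setC (@push_increment (a + r)))).
rewrite exprSr EFinM; apply: lee_pmul => //.
by rewrite probability_setC// EFinB leeB// push_prob_ge.
Qed.

Lemma ae_push_infinitely_often :
  {ae P, forall w, forall a, exists2 m, (a <= m)%N & push m w}.
Proof.
apply: ae_all => a.
pose N := \bigcap_r no_push a r.
have mN : measurable N by apply: bigcap_measurable => // r _; exact: no_push_measurable.
exists N; split => //; last first.
  move=> w /= H r _ m /= /andP[am _] pm; apply: H; by exists m.
apply/eqP; rewrite eq_le measure_ge0 andbT; apply/lee_addgt0Pr => e e0; rewrite add0e.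
have p0 := push_prob_gt0.
have p1 : push_prob <= 1.
  have := le_trans (push_prob_ge 0) (probability_le1 P (push_measurable 0)).
  by rewrite lee_fin.
have q1 : `|1 - push_prob| < 1 by rewrite ger0_norm ?subr_ge0// gtrBl.
have /cvgrPdist_lt/(_ _ e0)[r _ /(_ r (leqnn _))] := cvg_expr q1.
rewrite sub0r normrN ger0_norm ?exprn_ge0 ?subr_ge0// => hr.
apply: (@le_trans _ _ (P (no_push a r))).
  by apply: le_measure; rewrite ?inE// => w; apply.
by apply: (le_trans (no_push_prob a r)); rewrite lee_fin ltW.
Qed.

Lemma brownian_recurrence (a b : R) : 0 < a -> 0 < b ->
  {ae P, forall w, forall t0, exists2 t, t0 <= t & 0 < a * W t w i 0 - b * W t w k 0}.
Proof.
move=> a0 b0; move: ae_push_infinitely_often (sublinear_growth bW i)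
  (sublinear_growth bW k); apply: filterS3 => w Hpush gi gk t0.
have ab : 0 < a + b by exact: addr_gt0.
(* At the end of a push, a W_i - b W_k is at least a tau - (a + b) e tau, the last term accounting
   for the positions before the push; this [e] makes it a tau / 2. *)
pose e := a / (2 * (a + b)); have e0 : 0 < e by rewrite divr_gt0// mulr_gt0.
have [ti Hi] := gi e e0; have [tk Hk] := gk e e0.
pose s := Num.max t0 (Num.max ti tk).
have [m sm [/=]] := Hpush (Num.truncn (Num.max 0 s)).
rewrite !in_itv/= => /andP[pi1 pi2] /andP[pk1 pk2].
have st : s <= tau m.
  have p0 : 0 <= Num.max 0 s by rewrite le_max lexx.
  apply: (@le_trans _ _ (Num.max 0 s)); first by rewrite le_max lexx orbT.
  have /andP[_ /ltW h] := truncn_itv p0; apply: (le_trans h).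
  by apply: le_trans (step_time_ge m); rewrite ler_nat ltnS.
move: st; rewrite !ge_max => /andP[t0m /andP[tim tkm]].
exists (tau m.+1); first by rewrite (le_trans t0m)// ltW.
have /Hi hi := tim; have /Hk hk := tkm.
rewrite /increment in pi1 pk2.
have t := tau_gt0 m.
move: hi hk; rewrite !ler_norml => /andP[hi _] /andP[_ hk].
have e1 : (a + b) * (e * tau m) = a * tau m / 2 by rewrite /e; field; rewrite gt_eqF.
set x := W (tau m.+1) w i 0 in pi1 *; set y := W (tau m.+1) w k 0 in pk2 *.
have h1 : a * (tau m - e * tau m) <= a * x by rewrite ler_pM2l//; lra.
have h2 : b * y <= b * (e * tau m) by rewrite ler_pM2l//; lra.
have h3 : 0 < a * tau m by rewrite mulr_gt0.
have -> : a * x - b * y = (a * x - a * (tau m - e * tau m)) + (b * (e * tau m) - b * y) +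
  (a * tau m - (a + b) * (e * tau m)) by ring.
rewrite e1; lra.
Qed.

End Recurrence.

(** * Measurability of path events *)

Lemma continuous_le_rational {R : realType} (f : R -> R) (a t : R) : continuous f ->
  (forall q : rat, a <= ratr q -> f (ratr q) <= 0) -> a <= t -> f t <= 0.
Proof.
move=> cf fq at_; rewrite leNgt; apply/negP => ft.
have /cvgrPdist_lt/(_ _ ft)/nbhs_ballP[r /= r0 Hr] := cf t.
have [q] : exists q, ratr q \in `]t, t + r[ by apply: rat_in_itvoo; rewrite ltrDl.
rewrite in_itv/= => /andP[tq qr].
have h : `|f t - f (ratr q)| < f t.
  by apply: Hr; rewrite /ball/= distrC gtr0_norm ?subr_gt0// ltrBlDl.
have := fq q (le_trans at_ (ltW tq)).
by have := le_lt_trans (ler_norm _) h; lra.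
Qed.

Section CountableOperations.
Context {d : measure_display} {T : measurableType d}.

Lemma measurable_bigcup_countable {I : countType} (F : I -> set T) :
  (forall i, measurable (F i)) -> measurable (\bigcup_i F i).
Proof.
move=> mF; pose G r := if unpickle r is Some i then F i else set0.
rewrite (_ : \bigcup_i F i = \bigcup_r G r).
  by apply: bigcupT_measurable => r; rewrite /G; case: (unpickle r).
apply/seteqP; split=> w [i _].
  by exists (pickle i) => //; rewrite /G pickleK.
by rewrite /G; case: (unpickle i) => // j Fj; exists j.
Qed.

Lemma measurable_bigcap_countable {I : countType} (F : I -> set T) :
  (forall i, measurable (F i)) -> measurable (\bigcap_i F i).
Proof.
move=> mF; rewrite -[X in measurable X]setCK setC_bigcap; apply: measurableC.
by apply: measurable_bigcup_countable => i; exact: measurableC.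
Qed.

End CountableOperations.

Section PathEvents.
Context {d : measure_display} {T : measurableType d} {R : realType} {n : nat}.
Variable X : R -> T -> 'cV[R]_n.
Hypothesis cX : forall w, {within `[0, +oo[, continuous (fun t => X t w)}.
Hypothesis mX : forall t i, 0 <= t -> measurable_fun setT (fun w => X t w i 0).
Hypothesis X0 : forall t w i, 0 <= t -> 0 <= X t w i 0.

Let cX0 w : continuous (fun t : R => X (Num.max 0 t) w).
Proof. exact: (continuous_comp_max0 (@cX w)). Qed.

Lemma cvg_colP (f : R -> 'cV[R]_n) (v : 'cV[R]_n) :
  f t @[t --> +oo] --> v <-> forall e : R, 0 < e ->
    exists a, forall t, a <= t -> forall i, `|f t i 0 - v i 0| <= e.
Proof.
split=> [/cvg_ballP fv e e0|H].
  have [a [_ Ha]] := fv e e0; exists (a + 1) => t at_ i.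
  have [_ /(_ i 0)] : ball v e (f t) by apply: Ha; rewrite (lt_le_trans _ at_)// ltrDl.
  by rewrite /ball/= distrC => /ltW.
apply/cvg_ballP => e e0; have e2 : 0 < e / 2 by rewrite divr_gt0.
have [a Ha] := H _ e2; exists a; split; first exact: num_real.
move=> t /ltW/Ha {}Ha; split=> // i j; rewrite (ord1 j) /ball/= distrC.
by apply: le_lt_trans (Ha i) _; rewrite ltr_pdivrMr// ltr_pMr// ltr1n.
Qed.

(** Being within 1 / (m + 1) of the limit after time [a] is a closed condition, so by continuity it
    is enough to test it at rational times. *)
Lemma convergence_measurable (v : 'cV[R]_n) :
  measurable [set w | X t w @[t --> +oo] --> v].
Proof.
pose E (m a : nat) (q : rat) (i : 'I_n) :=
  [set w | a%:R <= ratr q :> R -> `|X (ratr q) w i 0 - v i 0| <= m.+1%:R^-1].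
rewrite (_ : [set w | _] = \bigcap_m \bigcup_a \bigcap_q \bigcap_i E m a q i).
  apply: measurable_bigcap_countable => m; apply: measurable_bigcup_countable => a.
  apply: measurable_bigcap_countable => q; apply: measurable_bigcap_countable => i.
  have [aq|qa] := boolP (a%:R <= ratr q :> R); last first.
    rewrite (_ : E _ _ _ _ = setT)//; apply/seteqP; split=> // w _ /=.
    by move=> h; rewrite h in qa.
  rewrite (_ : E _ _ _ _ = (fun w => `|X (ratr q) w i 0 - v i 0|) @^-1`
    `]-oo, m.+1%:R^-1]); last first.
    by apply/seteqP; split=> w; rewrite /E/= in_itv/= ?aq => h //; exact: h.
  rewrite -[X in measurable X]setTI.
  have m1 : measurable_fun setT (fun w => `|X (ratr q) w i 0 - v i 0|).
    apply: measurableT_comp => //; apply: measurable_funB => //; apply: mX.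
    by rewrite (le_trans _ aq).
  exact: m1.
apply/seteqP; split=> w.
  move=> /cvg_colP H m _; have m0 : 0 < m.+1%:R^-1 :> R by rewrite invr_gt0.
  have [a Ha] := H _ m0; exists (Num.truncn (Num.max 0 a)).+1 => // q _ i _ aq.
  apply: Ha; apply: le_trans aq.
  have p0 : 0 <= Num.max 0 a by rewrite le_max lexx.
  apply: (@le_trans _ _ (Num.max 0 a)); first by rewrite le_max lexx orbT.
  by have /andP[_ /ltW] := truncn_itv p0.
move=> H; apply/cvg_colP => e e0.
have ei : 0 <= e^-1 by rewrite invr_ge0 ltW.
have [a _ Ha] := H (Num.truncn e^-1) I; exists a%:R => t at_ i.
have t0 : 0 <= t by rewrite (le_trans _ at_).
have me : (Num.truncn e^-1).+1%:R^-1 <= e.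
  by rewrite invf_ple ?posrE//; apply: ltW; have /andP[] := truncn_itv ei.
have h : `|X (Num.max 0 t) w i 0 - v i 0| - (Num.truncn e^-1).+1%:R^-1 <= 0.
  apply: (@continuous_le_rational _
    (fun t => `|X (Num.max 0 t) w i 0 - v i 0| - (Num.truncn e^-1).+1%:R^-1) a%:R t) => //.
    move=> s; apply: cvgB; last exact: cvg_cst.
    apply: cvg_norm; apply: cvgB; last exact: cvg_cst.
    apply: (@continuous_comp _ _ _ (fun t : R => X (Num.max 0 t) w)
      (fun M : 'cV[R]_n => M i 0)); first exact: cX0.
    exact: coord_continuous.
  move=> q aq; rewrite subr_le0 (max_idPr (_ : 0 <= ratr q)) ?(le_trans _ aq)//.
  exact: Ha.
move: h; rewrite (max_idPr t0) subr_le0 => h; exact: le_trans me.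
Qed.

(* Rounding takes countably many values, so that [S (rounded r (X t w))] is an
   event for an arbitrary set [S]. *)
Definition rounded (r : nat) (y : 'cV[R]_n) : 'cV[R]_n :=
  \col_i ((Num.truncn (y i 0 * r.+1%:R))%:R / r.+1%:R).

Lemma rounded_dist r (y : 'cV[R]_n) i : 0 <= y i 0 -> 0 <= y i 0 - rounded r y i 0 < r.+1%:R^-1.
Proof.
move=> y0; rewrite mxE.
have r0 : 0 < r.+1%:R :> R by [].
have /andP[h1 h2] := truncn_itv (mulr_ge0 y0 (ltW r0)).
rewrite subr_ge0 ler_pdivrMr// h1/= ltrBlDr -[X in X + _]mul1r -mulrDl.
by rewrite ltr_pdivlMr// nat1r.
Qed.

Lemma rounded_measurable r t (S : set 'cV[R]_n) : 0 <= t ->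
  measurable [set w | S (rounded r (X t w))].
Proof.
move=> t0; pose pt (q : 'cV[nat]_n) : 'cV[R]_n := \col_i ((q i 0)%:R / r.+1%:R).
rewrite (_ : [set w | _] = \bigcup_(q : 'cV[nat]_n) ([set w | S (pt q)] `&`
  \bigcap_(i : 'I_n) ((fun w => X t w i 0 * r.+1%:R) @^-1`
    `[(q i 0)%:R, (q i 0).+1%:R[))).
  apply: measurable_bigcup_countable => q; apply: measurableI.
    have [Sq|Sq] := pselect (S (pt q)).
      by rewrite (_ : [set w | _] = setT)//; apply/seteqP; split.
    by rewrite (_ : [set w | _] = set0)//; apply/seteqP; split.
  apply: measurable_bigcap_countable => i; rewrite -[X in measurable X]setTI.
  have m1 : measurable_fun setT (fun w => X t w i 0 * r.+1%:R).
    by apply: measurable_funM => //; exact: mX.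
  exact: m1.
have xr w i : 0 <= X t w i 0 * r.+1%:R by rewrite mulr_ge0 ?X0.
apply/seteqP; split=> w.
  move=> Sw; exists (\col_i Num.truncn (X t w i 0 * r.+1%:R)) => //; split.
    rewrite /= (_ : pt _ = rounded r (X t w))//.
    by apply/matrixP => i j; rewrite !mxE.
  by move=> i _ /=; rewrite in_itv/= mxE truncn_itv.
move=> [q _ [/= Sq Hq]]; rewrite (_ : rounded _ _ = pt q)//.
apply/matrixP => i j; rewrite !mxE; congr (_%:R / _).
by apply: truncn_def; have := Hq i I; rewrite /= in_itv.
Qed.

(** Compactness of [[0, u]] turns the pointwise radii of balls inside [U] into one common margin. *)
Lemma path_tube (U : set 'cV[R]_n) (u : R) w : open U ->
  (forall t, 0 <= t -> U (X t w)) -> exists2 del, 0 < del &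
    forall t, 0 <= t <= u -> ball (X t w) del `<=` U.
Proof.
move=> oU XU.
have /compact_near_coveringP/(_ R (0^'+)
  (fun del t => ball (X (Num.max 0 t) w) del `<=` U)) := @segment_compact R 0 u.
move=> /(_ _) H.
have {}H : \forall del \near 0^'+, `[0, u] `<=`
    (fun t => ball (X (Num.max 0 t) w) del `<=` U).
  apply: H => t _.
  have /open_nbhs_nbhs Ut : open_nbhs (X (Num.max 0 t) w) U.
    by split => //; apply: XU; rewrite le_max lexx.
  move: Ut => /nbhs_ballP[r /= r0 Hr].
  have r2 : 0 < r / 2 by rewrite divr_gt0.
  have /cvg_ballP/(_ _ r2)/nbhs_ballP[s /= s0 Hs] := @cX0 w t.
  exists (ball t s, [set del | del < r / 2]).
    split; first exact: nbhsx_ballx.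
    by near=> del; rewrite /=; near: del; exact: nbhs_right_lt.
  move=> [t' del] /= [tt' delr] y y'; apply: Hr.
  rewrite (splitr r); apply: ball_triangle (Hs _ tt') _.
  exact: (le_ball (ltW delr) y').
have [del [del0 Hdel]] : exists del, 0 < del /\ `[0, u] `<=`
    (fun t => ball (X (Num.max 0 t) w) del `<=` U).
  near (0 : R)^'+ => del.
  exists del; split; first by near: del; exact: nbhs_right_gt.
  by near: del.
exists del => // t tu; have /andP[t0 _] := tu.
by have := Hdel t; rewrite /= in_itv/= (max_idPr t0); exact.
Unshelve. all: by end_near.
Qed.

(** Membership in an open set cannot be tested at rational times alone, since a path may touch the
    complement at an irrational time. What is tested is membership with a margin, uniform on each
    [[0, a]], whose existence is given by [path_tube]. *)
Lemma stays_measurable (U : set 'cV[R]_n) : open U ->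
  measurable [set w | forall t, 0 <= t -> U (X t w)].
Proof.
move=> oU.
pose inner (m : nat) := [set y : 'cV[R]_n | ball y m.+1%:R^-1 `<=` U].
(* Fine enough for the rounding error to use at most half of the margin 1 / (m + 1); the other half
   serves the passage from rational to arbitrary times. *)
pose res (m : nat) := (2 * m.+1)%N.
pose E (a m : nat) (q : rat) := [set w | 0 <= (ratr q : R) <= a%:R ->
  inner m (rounded (res m) (X (ratr q) w))].
rewrite (_ : [set w | _] = \bigcap_a \bigcup_m \bigcap_q E a m q).
  apply: measurable_bigcap_countable => a; apply: measurable_bigcup_countable => m.
  apply: measurable_bigcap_countable => q.
  have [qa|qa] := boolP (0 <= (ratr q : R) <= a%:R); last first.
    rewrite (_ : E _ _ _ = setT)//; apply/seteqP; split=> // w _ /=.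
    by move=> h; rewrite h in qa.
  rewrite (_ : E _ _ _ = [set w | inner m (rounded (res m) (X (ratr q) w))]).
    by apply: rounded_measurable; case/andP: qa.
  by apply/seteqP; split=> w h //; exact: h.
have resm m : (res m).+1%:R^-1 <= m.+1%:R^-1 / 2 :> R.
  rewrite -invfM lef_pV2 ?posrE ?mulr_gt0// mulrC -natrM ler_nat.
  by rewrite /res leqW.
have m2 m : 0 < m.+1%:R^-1 / 2 :> R by rewrite divr_gt0 ?invr_gt0.
have close m (t : R) w : 0 <= t ->
    ball (X t w) (m.+1%:R^-1 / 2) (rounded (res m) (X t w)).
  move=> t0; split=> // i j; rewrite (ord1 j) /ball/=.
  have /andP[h1 h2] := rounded_dist (res m) (X0 w i t0).
  by rewrite ger0_norm// (lt_le_trans h2).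
apply/seteqP; split=> w.
  move=> /= XU a _; have [del del0 Hdel] := path_tube a%:R oU XU.
  have di : 0 <= (del / 2)^-1 by rewrite invr_ge0 divr_ge0 ?ltW.
  pose m := Num.truncn (del / 2)^-1.
  have md : m.+1%:R^-1 <= del / 2.
    by rewrite invf_ple ?posrE ?divr_gt0//; apply: ltW; have /andP[] := truncn_itv di.
  exists m => // q _ qa y hy; apply: (Hdel _ qa).
  rewrite (splitr del); apply: (@ball_triangle _ _ (rounded (res m) (X (ratr q) w))).
    apply: le_ball (close m _ w _); last by case/andP: qa.
    by rewrite (le_trans _ md)// ler_pdivrMr// ler_peMr ?invr_ge0// ler1n.
  exact: le_ball md _ hy.
move=> H t t0.
have [m _ Hm] := H (Num.truncn t).+1 I.
have /cvg_ballP/(_ _ (m2 m))/nbhs_ballP[r /= r0 Hr] := @cX0 w t.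
have tu : t < (Num.truncn t).+1%:R by have /andP[] := truncn_itv t0.
have [q] : exists q, ratr q \in `]t, Num.min (t + r) (Num.truncn t).+1%:R[.
  by apply: rat_in_itvoo; rewrite lt_min ltrDl r0 tu.
rewrite in_itv/= lt_min => /andP[tq /andP[qr qa]].
have q0 : 0 <= ratr q :> R by rewrite (le_trans t0)// ltW.
apply: (Hm q I); first by rewrite q0 ltW.
rewrite (splitr m.+1%:R^-1); apply: (@ball_triangle _ _ (X (ratr q) w)).
  by apply: ball_sym; exact: close.
apply: ball_sym; have := Hr (ratr q).
rewrite (max_idPr t0) (max_idPr q0); apply.
by rewrite /ball/= distrC gtr0_norm ?subr_gt0// ltrBlDl.
Qed.

End PathEvents.

(** * Long-time behaviour *)

(** A minimum would need a non-empty index type; the inverse of 1 plus the sum of inverses does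
    not. *)
Lemma finite_pos_lb {R : realFieldType} (I : finType) (f : I -> R) :
  (forall i, 0 < f i) -> exists2 e, 0 < e & forall i, e <= f i.
Proof.
move=> f0; have S0 : 0 <= \sum_i (f i)^-1.
  by apply: sumr_ge0 => i _; rewrite invr_ge0 ltW.
exists (\sum_i (f i)^-1 + 1)^-1; first by rewrite invr_gt0 ltr_wpDl.
move=> i; rewrite invf_ple ?posrE ?ltr_wpDl//.
rewrite (bigD1 i)//= -addrA lerDl addr_ge0// sumr_ge0// => j _.
by rewrite invr_ge0 ltW.
Qed.

(** The bound on the derivative is required on the open interval only: in [decay] it is not yet
    available at the right end. *)
Lemma mean_value_le {R : realType} (f df : R -> R) (a b K : R) : a <= b ->
  (forall s, a <= s <= b -> is_derive s 1 f (df s)) ->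
  (forall s, a < s < b -> df s <= K) -> f b - f a <= K * (b - a).
Proof.
rewrite le_eqVlt => /orP[/eqP <- _ _|ab fd dfK]; first by rewrite !subrr mulr0.
have [||c cab ->] := @MVT R f df a b ab.
- by move=> x; rewrite in_itv/= => /andP[/ltW h1 /ltW h2]; apply: fd; rewrite h1.
- apply: derivable_within_continuous => x; rewrite in_itv/= => hx.
  by have [] := fd x hx.
by rewrite ler_wpM2r ?subr_ge0 ?(ltW ab)// dfK//; move: cab; rewrite in_itv.
Qed.

Section SimplexGeometry.
Context {R : realType} {n : nat}.
Implicit Types (B : 'M[R]_n) (y : 'cV[R]_n).

Lemma simplex_le_compl y (i k : 'I_n) : simplex y -> i != k -> y i 0 <= 1 - y k 0.
Proof.
move=> [y01 y1] ik; rewrite -y1 (bigD1 k)//= [X in X - _]addrC addrK.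
rewrite (bigD1 i)//= lerDl sumr_ge0// => j _; by case/andP: (y01 j).
Qed.

Lemma simplex_dist_vertex y (k i : 'I_n) : simplex y ->
  `|y i 0 - vertex k i 0| <= 1 - y k 0.
Proof.
move=> sy; have [y01 _] := sy; rewrite /vertex mxE eqxx andbT.
have [->|ik] := eqVneq i k.
  by rewrite distrC ger0_norm// subr_ge0; case/andP: (y01 k).
by rewrite subr0 ger0_norm ?simplex_le_compl//; case/andP: (y01 i).
Qed.

Lemma payoff_differenceE B y (i k : 'I_n) :
  (B *m y) i 0 - (B *m y) k 0 = \sum_j y j 0 * (B i j - B k j).
Proof. by rewrite !mxE -sumrB; apply: eq_bigr => j _; ring. Qed.

(** The difference is the sum of the y_j (c_j - c_k): the term j = k vanishes, and every other y_j
    is at most 1 - y_k. *)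
Lemma payoff_difference_near B (i k : 'I_n) : exists2 C, 0 <= C &
  forall y, simplex y ->
  `|(B *m y) i 0 - (B *m y) k 0 - (B i k - B k k)| <= C * (1 - y k 0).
Proof.
pose c j := B i j - B k j; pose C := \sum_j `|c j - c k|.
exists C; first by apply: sumr_ge0.
move=> y sy; have [y01 y1] := sy; rewrite payoff_differenceE.
rewrite -[B i k - B k k]mul1r -[X in X * (B i k - _)]y1 mulr_suml -sumrB.
apply: (le_trans (ler_norm_sum _ _ _)); rewrite /C mulr_suml; apply: ler_sum => j _.
rewrite -mulrBr normrM mulrC; have [->|jk] := eqVneq j k.
  by rewrite /c !subrr normr0 !mul0r.
by rewrite ler_wpM2l// ger0_norm ?simplex_le_compl//; case/andP: (y01 j).
Qed.

Lemma strict_payoff_margin B (k : 'I_n) : (forall i, i != k -> B i k < B k k) ->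
  exists c eta : R, [/\ 0 < c, 0 < eta & forall y i, simplex y -> i != k ->
    1 - eta < y k 0 -> (B *m y) i 0 - (B *m y) k 0 <= - c].
Proof.
move=> Bk.
have /choice[C HC] : forall i, exists C, 0 <= C /\ forall y, simplex y ->
    `|(B *m y) i 0 - (B *m y) k 0 - (B i k - B k k)| <= C * (1 - y k 0).
  by move=> i; have [C C0 H] := payoff_difference_near B i k; exists C.
(* The value 1 at [k] only makes [gap] positive everywhere. *)
pose gap i := if i == k then 1 else B k k - B i k.
have gap0 i : 0 < gap i.
  by rewrite /gap; have [//|ik] := eqVneq i k; rewrite subr_gt0 Bk.
have [c c0 Hc] := finite_pos_lb gap0.
have eta0 i : 0 < c / 2 / (C i + 1).
  by rewrite !divr_gt0// ltr_wpDl//; case: (HC i).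
have [eta e0 He] := finite_pos_lb eta0.
exists (c / 2), eta; split=> //; first by rewrite divr_gt0.
move=> y i sy ik yk; have [C0 H] := HC i.
have := H y sy; rewrite ler_norml => /andP[_].
have := Hc i; rewrite /gap (negbTE ik) => h1.
have := He i; rewrite ler_pdivlMr ?ltr_wpDl// => h2.
have h3 : C i * (1 - y k 0) <= C i * eta by rewrite ler_wpM2l// ltW// ltrBlDr -ltrBlDl.
have : C i * eta <= c / 2 by rewrite (le_trans _ h2)// mulrC ler_pM2l// lerDl.
lra.
Qed.

End SimplexGeometry.

(** * Events bounding the noise by a linear function of time *)

Section NoiseControl.
Context {d : measure_display} {T : measurableType d} {R : realType}.
Variables (P : probability T R) (n : nat) (sigma : 'rV[R]_n).
Variables (W : R -> T -> 'cV[R]_n).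
Hypothesis bW : brownian_motion P W.
Variable k : 'I_n.

Lemma noise_gap_sublinear : {ae P, forall w i (e : R), 0 < e ->
  exists t0, forall t, t0 <= t -> `|noise_gap sigma W i k w t| <= e * t}.
Proof.
have := ae_all (sublinear_growth bW); apply: filterS => w Hw i e e0.
pose S := `|sigma 0 i| + `|sigma 0 k| + 1.
have S0 : 0 < S by rewrite ltr_wpDl// addr_ge0.
have [ti Hi] := Hw i _ (divr_gt0 e0 S0); have [tk Hk] := Hw k _ (divr_gt0 e0 S0).
exists (Num.max 0 (Num.max ti tk)) => t; rewrite !ge_max => /andP[t0 /andP[/Hi hi /Hk hk]].
rewrite /noise_gap (max_idPr t0); apply: (le_trans (ler_normB _ _)); rewrite !normrM.
have -> : e * t = S * (e / S * t) by field; rewrite gt_eqF.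
rewrite /S mulrDl mulrDl mul1r -[leLHS]addr0 lerD//; last first.
  by rewrite mulr_ge0// divr_ge0// ltW.
by rewrite lerD// ler_wpM2l.
Qed.

(** Sublinear growth covers large times and boundedness on a compact interval the others. [K] is a
    natural number so that the events [noise_below] form an increasing sequence with union of
    probability 1. *)
Lemma noise_gap_bounded (c : R) : 0 < c -> {ae P, forall w, exists K : nat,
  forall t i, 0 <= t -> noise_gap sigma W i k w t <= c * t + K%:R}.
Proof.
move=> c0; apply: filterS noise_gap_sublinear => w Hw.
have /choice[K HK] : forall i, exists K : nat, forall t, 0 <= t ->
    noise_gap sigma W i k w t <= c * t + K%:R.
  move=> i; have [t0 Ht0] := Hw i c c0.
  have cn : continuous (noise_gap sigma W i k w) by exact: (noise_gap_continuous bW).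
  have [K K0 HK] := bounded_on t0 cn.
  exists (Num.truncn K).+1 => t tp; have ct : 0 <= c * t by rewrite mulr_ge0// ltW.
  have [tt|tt] := leP t0 t.
    by apply: (le_trans (ler_norm _)); rewrite (le_trans (Ht0 _ tt))// lerDl.
  have /andP[_ /ltW KK] := truncn_itv (ltW K0).
  apply: (le_trans (ler_norm _)); apply: (le_trans (HK t _)); first by rewrite tp ltW.
  by rewrite (le_trans KK)// lerDr.
exists (\max_i K i)%N => t i t0; apply: (le_trans (HK i t t0)).
by rewrite lerD2l ler_nat leq_bigmax.
Qed.

Definition noise_below (c : R) (K : nat) : set T := \bigcap_(q : rat) \bigcap_(i : 'I_n)
  [set w | 0 <= ratr q :> R -> noise_gap sigma W i k w (ratr q) <= c * ratr q + K%:R].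

Lemma noise_below_measurable c K : measurable (noise_below c K).
Proof.
apply: measurable_bigcap_countable => q; apply: measurable_bigcap_countable => i.
have [q0|q0] := pselect (is_true (0 <= ratr q :> R)); last first.
  by rewrite (_ : [set w | _] = setT)//; apply/seteqP; split=> // w _ /q0.
rewrite (_ : [set w | _] = noise_gap sigma W i k ^~ (ratr q) @^-1`
  `]-oo, c * ratr q + K%:R]); last first.
  by apply/seteqP; split=> w /=; rewrite in_itv/= => h //; exact: h.
rewrite -[X in measurable X]setTI.
have m : measurable_fun setT (noise_gap sigma W i k ^~ (ratr q)).
  rewrite /noise_gap (max_idPr q0).
  by apply: measurable_funB; apply: measurable_funM => //; exact: (brownian_measurable bW).
exact: m.
Qed.

Lemma noise_belowP c K w : noise_below c K w -> forall t i, 0 <= t ->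
  noise_gap sigma W i k w t <= c * t + K%:R.
Proof.
move=> H t i t0; rewrite -subr_le0.
apply: (@continuous_le_rational _
  (fun t => noise_gap sigma W i k w t - (c * t + K%:R)) 0 t) => //.
  move=> s; apply: cvgB; first exact: (noise_gap_continuous bW).
  apply: cvgD; last exact: cvg_cst.
  by apply: cvgM; [exact: cvg_cst|exact: cvg_id].
by move=> q q0; rewrite subr_le0; exact: (H q I i I q0).
Qed.

Lemma noise_below_prob (c eps : R) : 0 < c -> 0 < eps -> exists K,
  ((1 - eps)%:E <= P (noise_below c K))%E.
Proof.
move=> c0 e0.
have mU : measurable (\bigcup_K noise_below c K).
  by apply: bigcupT_measurable => K; exact: noise_below_measurable.
have nd : nondecreasing_seq (noise_below c).
  move=> K1 K2 K12; apply/subsetPset => w H q _ i _ q0.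
  by apply: (le_trans (H q I i I q0)); rewrite lerD2l ler_nat.
have PU : P (\bigcup_K noise_below c K) = 1%E.
  rewrite -[\bigcup_K _]setCK probability_setC; last exact: measurableC.
  rewrite (_ : P (~` _) = 0%E) ?sube0//.
  apply: measure_negligible; first exact: measurableC.
  apply: negligibleS (noise_gap_bounded c0) => w H /= [K HK]; apply: H.
  by exists K => // q _ i _ q0; exact: HK.
have C : P (noise_below c K) @[K --> \oo] --> 1%:E.
  rewrite -PU; apply: nondecreasing_cvg_mu => // K; exact: noise_below_measurable.
have h1 : ((1 - eps)%:E < 1%:E :> \bar R)%E by rewrite lte_fin gtrBl.
have [K _ HK] := C _ (open_ereal_gt' h1).
by exists K; apply: ltW; exact: HK (leqnn _).
Qed.

End NoiseControl.

Section LongTime.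
Context {d : measure_display} {T : measurableType d} {R : realType}.
Variables (P : probability T R) (n : nat) (A : 'M[R]_n) (sigma : 'rV[R]_n).
Variables (W : R -> T -> 'cV[R]_n) (x : 'cV[R]_n) (X : R -> T -> 'cV[R]_n).
Hypothesis bW : brownian_motion P W.
Hypothesis hx : int_simplex x.
Hypothesis sol : stochastic_replicator P A sigma W x X.
Variable k : 'I_n.
Local Notation Z := (extended X).
Local Notation At := (modified_payoff A sigma).

Let xp i : 0 < x i 0. Proof. by case: hx. Qed.

Let mX t i : 0 <= t -> measurable_fun setT (fun w => X t w i 0).
Proof.
by move=> t0; case: sol => _ _ m _ _; exact: (measurable_wrt_measurable bW (m t i t0)).
Qed.

Let X0 t w i : 0 <= t -> 0 <= X t w i 0.
Proof. by move=> t0; case: sol => /(_ t w t0)[/(_ i)/andP[]]. Qed.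

Let cX w : {within `[0, +oo[, continuous (fun t => X t w)}.
Proof. by case: sol. Qed.

Lemma absorption_measurable : measurable [set w | X t w @[t --> +oo] --> vertex k].
Proof. exact: convergence_measurable. Qed.

Lemma stable_event_measurable (U : set 'cV[R]_n) : open U ->
  measurable [set w | (forall t, 0 <= t -> U (X t w)) /\
    (X t w @[t --> +oo] --> vertex k)].
Proof.
by move=> oU; apply: measurableI; [exact: stays_measurable|exact: absorption_measurable].
Qed.

Section attraction.
Variables (w : T) (c eta K : R).
Hypotheses (c0 : 0 < c) (eta0 : 0 < eta).
Hypothesis margin : forall y i, simplex y -> i != k -> 1 - eta < y k 0 ->
  (At *m y) i 0 - (At *m y) k 0 <= - c.
Hypothesis ratio : forall u, 0 <= u -> ratio_identity A sigma W x X w u.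
Hypothesis noise : forall t i, 0 <= t -> noise_gap sigma W i k w t <= c / 2 * t + K.
Hypothesis start : (1 - x k 0) / x k 0 * expR K < eta.

Let decay (u : R) : 0 <= u -> (forall s, 0 <= s < u -> 1 - eta < Z s w k 0) ->
  1 - Z u w k 0 <= (1 - x k 0) / x k 0 * expR K * expR (- (c / 2 * u)).
Proof.
move=> u0 near_k.
have Zi i : i != k -> Z u w i 0 <= x i 0 / x k 0 * (expR K * expR (- (c / 2 * u))).
  move=> ik; have [H dH _] := antiderivative (@payoff_gap_continuous _ _ _ _ _ _ _ _ _ _ sol i k w).
  have Hu : H u - H 0 <= - c * (u - 0).
    apply: (mean_value_le (df := payoff_gap A sigma X i k w)) => // s /andP[s0 su].
      exact: dH.
    by apply: margin => //; [exact: (extended_simplex sol)|apply: near_k; rewrite ltW].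
  rewrite (ratio u0 dH) -expRD -[leRHS]mul1r -mulrA ler_pM//.
  - by case/andP: (extended_itv sol u w k).
  - by rewrite mulr_ge0 ?expR_ge0// divr_ge0// ltW.
  - by case/andP: (extended_itv sol u w k).
  by rewrite ler_wpM2l ?divr_ge0 ?(ltW (xp _))// ler_expR; have := noise i u0; lra.
have -> : 1 - Z u w k 0 = \sum_(i < n | i != k) Z u w i 0.
  by rewrite -(extended_sum sol u w) (bigD1 k)//= addrC addrK.
have -> : 1 - x k 0 = \sum_(i < n | i != k) x i 0.
  by case: hx => -[_ <-] _; rewrite (bigD1 k)//= addrC addrK.
rewrite !mulr_suml; apply: ler_sum => i ik.
by rewrite -mulrA Zi.
Qed.

(** Continuity induction: [decay] and [start] give the strict inequality at [u] from its validity
    before [u]. *)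
Lemma attracted u : 0 <= u -> 1 - eta < Z u w k 0.
Proof.
apply: (continuity_induction (Q := fun u => 1 - eta < Z u w k 0)) => {}u u0; last first.
  by move=> h; apply: (cvgr_gt _ (@extended_continuous _ _ _ _ _ _ _ _ _ _ sol w k u)).
move=> near_k; have := decay u0 near_k; rewrite ltrBlDr -ltrBlDl => h.
apply: le_lt_trans h _; apply: le_lt_trans start.
have xk1 : 0 <= 1 - x k 0 by rewrite subr_ge0; case: hx => -[/(_ k)/andP[]].
rewrite ler_piMr//; first by rewrite mulr_ge0 ?expR_ge0// divr_ge0// ltW.
by rewrite -expR0 ler_expR oppr_le0 mulr_ge0// divr_ge0// ltW.
Qed.

Lemma attracted_cvg : X t w @[t --> +oo] --> vertex k.
Proof.
(* From exp (- c t / 2) <= 1 / (1 + c t / 2): beyond this [a], eta is at most e c t / 2. *)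
apply/cvg_colP => e e0; pose a := 2 * eta / (c * e).
have a0 : 0 <= a by rewrite divr_ge0 ?mulr_ge0 ?ltW.
exists a => t at_ i; have t0 := le_trans a0 at_.
rewrite -(extendedE X w t0).
apply: (le_trans (simplex_dist_vertex k i (extended_simplex sol t w))).
apply: (le_trans (decay t0 _)); first by move=> s /andP[s0 _]; exact: attracted.
apply: (@le_trans _ _ (eta * expR (- (c / 2 * t)))).
  by rewrite ler_pM2r ?expR_gt0// ltW.
rewrite expRN ler_pdivrMr ?expR_gt0//.
apply: (@le_trans _ _ (e * (1 + c / 2 * t))); last by rewrite ler_pM2l// expR_ge1Dx.
have : c * e / 2 * a <= c * e / 2 * t by rewrite ler_pM2l// divr_gt0// mulr_gt0.
have -> : c * e / 2 * a = eta by rewrite /a; field; rewrite !gt_eqF.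
have -> : e * (1 + c / 2 * t) = e + c * e / 2 * t by field.
lra.
Qed.

End attraction.

Lemma payoff_gap_limit (i : 'I_n) w (e : R) : X t w @[t --> +oo] --> vertex k -> 0 < e ->
  exists a, forall t, a <= t ->
    `|payoff_gap A sigma X i k w t - (At i k - At k k)| <= e.
Proof.
move=> /cvg_colP lim e0; have [C C0 HC] := payoff_difference_near At i k.
have [a Ha] := lim (e / (C + 1)) (divr_gt0 e0 (ltr_wpDl C0 ltr01)).
exists (Num.max 0 a) => t; rewrite ge_max => /andP[t0 /Ha/(_ k)].
rewrite -(extendedE X w t0) /vertex mxE !eqxx => h.
apply: (le_trans (HC _ (extended_simplex sol t w))).
move: h; rewrite distrC => /(le_trans (ler_norm _)).
rewrite ler_pdivlMr ?ltr_wpDl// => h.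
have zk : 0 <= 1 - Z t w k 0 by rewrite subr_ge0; case/andP: (extended_itv sol t w k).
by apply: le_trans h; rewrite mulrC ler_wpM2l// lerDl.
Qed.

Let drift_integral i w : exists H : R -> R, forall s : R, 0 <= s ->
  is_derive s 1 H (payoff_gap A sigma X i k w s).
Proof.
have [H dH _] := antiderivative (@payoff_gap_continuous _ _ _ _ _ _ _ _ _ _ sol i k w).
by exists H.
Qed.

(** With [c] half the positive gap, the drift integral eventually grows at rate at least [c], of
    which the noise cancels at most half; the contradiction is X_i > 1. *)
Lemma absorption_nash :
  {ae P, forall w, X t w @[t --> +oo] --> vertex k -> forall i, At i k <= At k k}.
Proof.
move: (ratio_identity_all bW hx sol) (noise_gap_sublinear sigma bW k).
apply: filterS2 => w Hw Hn lim i; rewrite leNgt; apply/negP => gap0.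
pose c := (At i k - At k k) / 2.
have c0 : 0 < c by rewrite divr_gt0// subr_gt0.
have [a Ha] := payoff_gap_limit i lim c0.
have [b Hb] := Hn i (c / 2) (divr_gt0 c0 (ltr0Sn _ _)).
have /cvg_colP/(_ (1 / 2)) := lim.
rewrite divr_gt0// => /(_ isT)[e He].
have [H dH] := drift_integral i w.
have [a' a'0 aa'] : exists2 a', 0 <= a' & a <= a'.
  by exists (Num.max 0 a); rewrite le_max lexx ?orbT.
pose D := H a' - H 0 - c * a'.
pose r := x i 0 / x k 0; have r0 : 0 < r by rewrite divr_gt0.
(* The last requirement makes the exponent at least [2 / r], where [D] collects what happened before
   [a']. As X_k is at least 1 / 2 by then, X_i exceeds r / 2 times 2 / r. *)
have [t [ta tb te tD]] : exists t,
    [/\ a' <= t, b <= t, e <= t & 2 / c * (2 / r - D) <= t].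
  exists (Num.max (Num.max a' b) (Num.max e (2 / c * (2 / r - D)))).
  by split; rewrite !le_max lexx ?orbT.
have t0 := le_trans a'0 ta; have [_ /(_ i k H dH) E] := Hw t t0.
have grow : c * (t - a') <= H t - H a'.
  have := @mean_value_le R (fun s => - H s) (fun s => - payoff_gap A sigma X i k w s)
    a' t (- c) ta.
  move=> h; have : - H t - - H a' <= - c * (t - a'); last by lra.
  apply: h => s /andP[s1 s2].
    by apply: is_deriveN; apply: dH; exact: le_trans s1.
  have : a <= s by rewrite (le_trans aa')// ltW.
  by move=> /Ha; rewrite ler_norml => /andP[h1 _]; rewrite /c in h1 *; lra.
have nb : - (c / 2 * t) <= noise_gap sigma W i k w t.
  by have := Hb t tb; rewrite ler_norml => /andP[].
have big : 2 / r <= c / 2 * t + D.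
  have : c / 2 * (2 / c * (2 / r - D)) <= c / 2 * t by rewrite ler_pM2l// divr_gt0.
  have -> : c / 2 * (2 / c * (2 / r - D)) = 2 / r - D by field; rewrite !gt_eqF.
  lra.
have zk : 1 / 2 <= Z t w k 0.
  have := He t te k; rewrite -(extendedE X w t0) /vertex mxE !eqxx ler_norml => /andP[h _].
  rewrite mulr1n in h; lra.
have ex : 2 / r < expR (H t - H 0 + noise_gap sigma W i k w t).
  apply: lt_le_trans (expR_ge1Dx _).
  rewrite /D in big; lra.
have : 1 < Z t w i 0.
  rewrite E -/r; apply: (@lt_le_trans _ _ (1 / 2 * r *
      expR (H t - H 0 + noise_gap sigma W i k w t))).
    have half : 1 / 2 * r * (2 / r) = 1 by field; rewrite gt_eqF.
    by rewrite -[ltLHS]half ltr_pM2l// mulr_gt0// divr_gt0.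
  by rewrite ler_pM2r ?expR_gt0// ler_pM2r.
by case/andP: (extended_itv sol t w i) => _ /le_lt_trans h /h; rewrite ltxx.
Qed.

Lemma no_absorption (i : 'I_n) : 0 < sigma 0 i -> 0 < sigma 0 k -> i != k ->
  At i k = At k k -> (forall j, j != k -> At k j <= At i j) ->
  {ae P, forall w, ~ (X t w @[t --> +oo] --> vertex k)}.
Proof.
move=> si sk ik aik aij.
move: (ratio_identity_all bW hx sol) (brownian_recurrence bW ik si sk).
apply: filterS2 => w Hw Hr /cvg_colP lim.
pose r := x i 0 / x k 0; have r0 : 0 < r by rewrite divr_gt0.
have r1 : 0 < 1 + r by rewrite addr_gt0.
(* At a time of positive noise X_i is at least r X_k. With X_i <= e and X_k >= 1 - e this would give
   r <= e (1 + r), which is only r / 2 for this [e]. *)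
pose e := r / (2 * (1 + r)).
have e0 : 0 < e by rewrite divr_gt0// mulr_gt0.
have [a Ha] := lim _ e0.
have [t ta noise] := Hr (Num.max 0 a).
move: ta; rewrite ge_max => /andP[t0 /Ha ta].
have [H dH] := drift_integral i w.
have [_ /(_ i k H dH) E] := Hw t t0.
have mono : H 0 <= H t.
  have := @mean_value_le R (fun s => - H s) (fun s => - payoff_gap A sigma X i k w s)
    0 t 0 t0.
  move=> h; have : - H t - - H 0 <= 0 * (t - 0); last by rewrite mul0r; lra.
  apply: h => s /andP[s1 s2]; first exact/is_deriveN/dH.
  rewrite oppr_le0 /payoff_gap payoff_differenceE sumr_ge0// => j _.
  rewrite mulr_ge0//; first by case/andP: (extended_itv sol s w j).
  by rewrite subr_ge0; have [->|/aij//] := eqVneq j k; rewrite aik.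
have ex : 1 <= expR (H t - H 0 + noise_gap sigma W i k w t).
  rewrite -[leLHS]expR0 ler_expR; apply: addr_ge0; first by rewrite subr_ge0.
  by rewrite /noise_gap (max_idPr t0) ltW.
have zk := ta k; have zi := ta i; move: zk zi.
rewrite -(extendedE X w t0) /vertex !mxE !eqxx (negbTE ik) /= subr0.
move=> /ler_normlP[zk _] /(le_trans (ler_norm _)) zi.
have zr : Z t w k 0 * r <= Z t w i 0.
  rewrite E -/r ler_peMr// mulr_ge0 ?(ltW r0)//.
  by case/andP: (extended_itv sol t w k).
have : (1 - e) * r <= Z t w k 0 * r by rewrite ler_pM2r//; rewrite mulr1n in zk; lra.
have : e * (1 + r) = r / 2 by rewrite /e; field; rewrite gt_eqF.
lra.
Qed.

End LongTime.

Section AlmostSureInclusion.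
Context {d : measure_display} {T : measurableType d} {R : realType}.
Variable P : probability T R.

Lemma le_probability_ae (G E : set T) : measurable G -> measurable E ->
  {ae P, forall w, G w -> E w} -> (P G <= P E)%E.
Proof.
move=> mG mE [N [mN N0 sub]].
apply: (@le_trans _ _ (P (E `|` N))).
  apply: le_measure; rewrite ?inE//; first exact: measurableU.
  by move=> w Gw; have [Ew|Ew] := pselect (E w); [left|right; apply: sub => /(_ Gw)].
have PN : P N = 0%E by exact: N0.
have U2 : (P (E `|` N) <= P E + P N)%E by exact: measureU2.
by rewrite PN adde0 in U2.
Qed.

(** [Q] does not depend on the path, so one path of [E] outside the null set decides it. *)
Lemma ae_imply_positive_prob (E : set T) (Q : Prop) : measurable E -> (0 < P E)%E ->
  {ae P, forall w, E w -> Q} -> Q.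
Proof.
move=> mE PE H; apply: contrapT => nQ; move: PE.
rewrite measure_negligible ?ltxx//.
by apply: negligibleS H => w Ew /= /(_ Ew).
Qed.

End AlmostSureInclusion.

Theorem theorem4p11 (R : realType) (d : measure_display) (T : measurableType d)
    (P : probability T R) (n : nat) (A : 'M[R]_n) (sigma : 'rV[R]_n)
    (W : R -> T -> 'cV[R]_n) (X : 'cV[R]_n -> R -> T -> 'cV[R]_n) (k : 'I_n)
    (hn : (2 <= n)%N)
    (hsigma : forall i, 0 < sigma 0 i)
    (hW : brownian_motion P W)
    (hX : forall x, int_simplex x -> stochastic_replicator P A sigma W x (X x)) :
  let At := modified_payoff A sigma in
  (strict_nash At (vertex k) -> stoch_asymp_stable P X (vertex k)) /\
  ((exists2 x, int_simplex x &
      let E := [set w | X x t w @[t --> +oo] --> vertex k] in (0 < P E)%E) ->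
    nash At (vertex k) /\
    (forall i, i != k -> At i k = At k k ->
      exists2 j, j != k & At i j < At k j)).
Proof.
move=> At; split=> [/strict_nash_vertexP Bk U eps oU Uk eps0|[x hx PE]]; last first.
  have sol := hX x hx; have mE := absorption_measurable hW sol k.
  split.
    apply/nash_vertexP => j; apply: (ae_imply_positive_prob mE PE).
    by apply: filterS (absorption_nash hW hx sol k) => w H /H.
  move=> i ik aik; apply: contrapT => noj.
  apply: (ae_imply_positive_prob mE PE).
  apply: filterS (no_absorption hW hx sol (hsigma i) (hsigma k) ik aik _) => [w H /H//|].
  by move=> j jk; rewrite leNgt; apply/negP => h; apply: noj; exists j.
have [c [eta0 [c0 eta00 margin]]] := strict_payoff_margin Bk.
have /nbhs_ballP[r /= r0 rU] : nbhs (vertex k : 'cV[R]_n) U by exact: open_nbhs_nbhs.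
pose eta := Num.min eta0 r.
have e0 : 0 < eta by rewrite lt_min eta00.
(* The noise does not involve the initial state, so [K] is fixed before the neighbourhood is chosen
   and serves all its points. *)
have [K HK] := noise_below_prob sigma hW k (divr_gt0 c0 (ltr0Sn _ 1)) eps0.
(* The first bound gives x_k > 1 / 2, hence (1 - x_k) / x_k < 2 eta'; the second makes 2 eta' exp K
   at most eta, as [start] demands. *)
pose eta' := Num.min (1 / 2) (eta / (2 * expR K%:R)).
have e'0 : 0 < eta'.
  by rewrite lt_min !divr_gt0// mulr_gt0// expR_gt0.
exists [set y : 'cV[R]_n | 1 - eta' < y k 0].
  have := @coord_continuous R n 1 k 0 (vertex k) => /cvgr_gt; apply.
  by rewrite /vertex mxE !eqxx gtrBl.
move=> x /= Vx hx; have sol := hX x hx.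
have start : (1 - x k 0) / x k 0 * expR K%:R < eta.
  have : eta' <= 1 / 2 by rewrite ge_min lexx.
  have : eta' <= eta / (2 * expR K%:R) by rewrite ge_min lexx orbT.
  rewrite ler_pdivlMr ?mulr_gt0 ?expR_gt0// => h1 h2.
  have xk : 1 / 2 < x k 0 by lra.
  have xk0 : 0 < x k 0 by lra.
  apply: lt_le_trans h1; rewrite mulrA ltr_pM2r ?expR_gt0// ltr_pdivrMr//.
  have : eta' * (1 / 2) < eta' * x k 0 by rewrite ltr_pM2l.
  lra.
apply: (le_trans HK); apply: le_probability_ae.
- exact: (noise_below_measurable _ hW).
- exact: (stable_event_measurable hW sol k oU).
apply: filterS (ratio_identity_all hW hx sol) => w Hw Gw.
have margin' y i : simplex y -> i != k -> 1 - eta < y k 0 ->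
    (At *m y) i 0 - (At *m y) k 0 <= - c.
  move=> sy ik yk; apply: margin => //; apply: le_lt_trans yk.
  by rewrite lerD2l lerN2 ge_min lexx.
have noise := noise_belowP hW Gw.
have ratio u (u0 : 0 <= u) := proj2 (Hw u u0).
split=> [t t0|].
  (* Balls are taken in the sup norm, and every coordinate is within 1 - X_k < eta <= r of the
     vertex. *)
  apply: rU; split=> // i j; rewrite (ord1 j) /ball/= distrC -(extendedE (X x) w t0).
  apply: le_lt_trans (simplex_dist_vertex k i (extended_simplex sol t w)) _.
  have h := attracted hx sol c0 margin' ratio noise start t0.
  by rewrite ltrBlDr -ltrBlDl; apply: le_lt_trans h; rewrite lerD2l lerN2 ge_min lexx orbT.
exact: (attracted_cvg hx sol c0 e0 margin' ratio noise start).
Qed.
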